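(* Let $B=\bigoplus_{\nu\in\mathbb{N}^r}[B]_\nu$ be a finitely generated standard $\mathbb{N}^r$-graded algebra over an Artinian local ring $A=[B]_{\mathbf 0}$, and let $M$ be a finitely generated $\mathbb{Z}^r$-graded $B$-module. Let $d=\dim(M)$ and $d_{++}=\dim(\mathrm{Supp}_{++}(M))$. (I) [A structural result for Hilbert series] For each $\mathbf n=(n_1,\ldots,n_r)\in\mathbb{N}^r$ with $|\mathbf n|=d$ there exists a Laurent polynomial $Q_{\mathbf n}(\mathbf t)\in\mathbb{Z}[t_1,\ldots,t_r,t_1^{-1},\ldots,t_r^{-1}]$ with $Q_{\mathbf n}(\mathbf 1)=Q_{\mathbf n}(1,\ldots,1)\ge 0$ such that $$\mathrm{Hilb}_M(\mathbf t)=\sum_{\mathbf n\in\mathbb{N}^r,\ |\mathbf n|=d}\frac{Q_{\mathbf n}(\mathbf t)}{(1-t_1)^{n_1}\cdots(1-t_r)^{n_r}},$$ and the following statements hold: (a) there is at least one $\mathbf n\in\mathbb{N}^r$ with $|\mathbf n|=d$ such that $Q_{\mathbf n}(\mathbf 1)>0$; (b) the values $Q_{\mathbf n}(\mathbf 1)$ are uniquely determined by the module $M$. (II) [Definition] For each $\mathbf n=(n_1,\ldots,n_r)\in\mathbb{Z}^r$ with $n_i\ge -1$ for all $i$ and $|\mathbf n|=d-r$, the mixed multiplicity of $M$ of type $\mathbf n$ in terms of Hilbert series is defined as $$e_{\mathbf n}(M)=e_{(n_1,\ldots,n_r)}(M):=Q_{\mathbf n+\mathbf 1}(\mathbf 1),$$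 where the $Q_{\mathbf n+\mathbf 1}(\mathbf t)\in\mathbb{Z}[t_1,\ldots,t_r,t_1^{-1},\ldots,t_r^{-1}]$ are Laurent polynomials obtained in part (I). (III) [Relation between the two notions of mixed multiplicities] For each $\mathbf n\in\mathbb{N}^r$ with $|\mathbf n|=d_{++}$, $$e(\mathbf n;M)=e_{\mathbf n}\big(M/\mathrm{H}^0_{\mathfrak N}(M)\big),$$ where $e(\mathbf n;M)$ is the mixed multiplicity defined in terms of the Hilbert polynomial of $M$.
   Context: $\mathbb{N}=\{0,1,2,\ldots\}$, $r\ge1$. Standard means that $[B]_{\mathbf 0}=A$ and $B$ is generated over $A$ by finitely many elements of degrees $\mathbf e_1,\ldots,\mathbf e_r$ (the standard basis vectors). For $\nu\in\mathbb{Z}^r$, $|\nu|=\nu_1+\cdots+\nu_r$; $\mathbf 0=(0,\ldots,0)$, $\mathbf 1=(1,\ldots,1)$, $\mathbf t=(t_1,\ldots,t_r)$; inequalities of vectors are componentwise. $\dim(M)$ is Krull dimension. The Hilbert series is $\mathrm{Hilb}_M(\mathbf t)=\sum_{\nu\in\mathbb{Z}^r}\mathrm{length}_A([M]_\nu)\,t_1^{\nu_1}\cdots t_r^{\nu_r}$; rational functions with denominators $(1-t_i)$ are expanded as geometric series in $t_i$. The irrelevant ideal is $\mathfrak N=\bigoplus_{\nu_1>0,\ldots,\nu_r>0}[B]_\nu$, and $\mathrm{H}^0_{\mathfrak N}(M)=\{m\in M: \mathfrak N^k m=0 \text{ for some } k\}$. $\mathrm{MultiProj}(B)$ is the set (with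 Zariski topology) of graded primes $\mathfrak p\subset B$ with $\mathfrak p\not\supseteq\mathfrak N$, and $\mathrm{Supp}_{++}(M)=\mathrm{Supp}(M)\cap\mathrm{MultiProj}(B)$, a closed subset, with its topological dimension. One has $\dim(M/\mathrm{H}^0_{\mathfrak N}(M))=r+d_{++}$ (both $\dim(\mathrm{Supp}_{++}(M))$ and $\dim(M/\mathrm{H}^0_{\mathfrak N}(M))$ are $-\infty$ by convention if $\mathrm{Supp}_{++}(M)=\emptyset$), so the definition in part (II), applied to $M/\mathrm{H}^0_{\mathfrak N}(M)$, gives the right-hand side in (III). Hilbert polynomial (known fact): there is a polynomial $P_M(X_1,\ldots,X_r)\in\mathbb{Q}[X_1,\ldots,X_r]$ of total degree $d_{++}$ with $P_M(\nu)=\mathrm{length}_A([M]_\nu)$ for all $\nu\gg\mathbf 0$ (i.e. for all $\nu\ge\nu_0$ for some $\nu_0$). Writing $P_M=\sum_{n_1,\ldots,n_r\ge0}e(n_1,\ldots,n_r)\binom{X_1+n_1}{n_1}\cdots\binom{X_r+n_r}{n_r}$ with $e(n_1,\ldots,n_r)\in\mathbb{Z}$, for $\mathbf n\in\mathbb{N}^r$ with $|\mathbf n|=d_{++}$ one sets $e(\mathbf n;M):=e(n_1,\ldots,n_r)$. *)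

(* Defs.v *)
From HB Require Import structures.
From mathcomp Require Import all_boot all_order all_algebra.
From mathcomp Require Import boolp classical_sets.
From mathcomp Require Import finmap mpoly.

Set Implicit Arguments.
Unset Strict Implicit.
Unset Printing Implicit Defensive.

Import Order.TTheory GRing.Theory Num.Theory.

Local Open Scope classical_set_scope.
Local Open Scope ring_scope.
Local Open Scope quotient_scope.

(* Values of lengths and dimensions; the empty supremum is [NegInf]. *)
Variant extnat := NegInf | Fin of nat | PosInf.

(* [n] is in [chain_lengths P] iff there are Z_0 < Z_1 < ... < Z_n in P
   (strict inclusions). *)
Definition chain_lengths (T : Type) (P : set (set T)) : set nat :=
  [set n | exists Z : nat -> set T,
     (forall i, (i <= n)%N -> P (Z i)) /\
     (forall i, (i < n)%N -> Z i `<` Z i.+1)].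

Definition chain_sup (T : Type) (P : set (set T)) : extnat :=
  if `[< chain_lengths P = set0 >] then NegInf
  else if `[< has_ubound (chain_lengths P) >]
       then Fin (supremum 0%N (chain_lengths P))
       else PosInf.

Definition is_ideal (R : comNzRingType) (I : set R) : Prop :=
  [/\ I 0, forall x y, I x -> I y -> I (x + y)
    & forall a x, I x -> I (a * x)].

Definition prime_ideal (R : comNzRingType) (p : set R) : Prop :=
  idealr_closed [pred x in p] /\ prime_idealr_closed [pred x in p].

Definition maximal_ideal (R : comNzRingType) (m : set R) : Prop :=
  [/\ is_ideal m, ~ m 1
    & forall J : set R, is_ideal J -> ~ J 1 -> m `<=` J -> J = m].

Definition local_ring (R : comNzRingType) : Prop :=
  exists! m : set R, maximal_ideal m.

Definition artinian_ring (R : comNzRingType) : Prop :=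
  forall I : nat -> set R, (forall k, is_ideal (I k)) ->
    (forall k, I k.+1 `<=` I k) ->
  exists k, forall l, (k <= l)%N -> I l = I k.

Definition ideal_pow (R : comNzRingType) (I : set R) (k : nat) : set R :=
  smallest (@is_ideal R)
    [set \prod_(j < k) x j | x in [set x : 'I_k -> R | forall j, I (x j)]].

Definition finitely_generated (R : comNzRingType) (M : lmodType R) : Prop :=
  exists (k : nat) (g : 'I_k -> M),
    forall m, exists c : 'I_k -> R, m = \sum_j c j *: g j.

(* M_p <> 0: the fraction m/1 is nonzero for some m, i.e. no element outside p
   annihilates m. *)
Definition Supp (R : comNzRingType) (M : lmodType R) : set (set R) :=
  [set p | prime_ideal p /\
           exists m : M, forall s : R, ~ p s -> s *: m != 0].

Definition krull_dim (R : comNzRingType) (M : lmodType R) : extnat :=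
  chain_sup (@Supp R M).

Definition irreducible_set (T : Type) (closed : set (set T)) (Z : set T) :
    Prop :=
  Z !=set0 /\
  forall C1 C2, closed C1 -> closed C2 ->
    Z `<=` C1 `|` C2 -> Z `<=` C1 \/ Z `<=` C2.

(* Dimension of the subspace S of a topological space given by its family of
   closed sets. *)
Definition top_dim (T : Type) (closed : set (set T)) (S : set T) : extnat :=
  chain_sup [set Z | (exists2 C, closed C & Z = S `&` C) /\
                     irreducible_set closed Z].

Definition sum_of (I : eqType) (V : zmodType) (G : I -> set V) : set V :=
  [set x | exists (s : seq I) (f : I -> V),
     (forall i, i \in s -> G i (f i)) /\ x = \sum_(i <- s) f i].

Definition is_direct_sum (I : eqType) (V : zmodType) (G : I -> set V) : Prop :=
  [/\ forall i, zmod_closed [pred x in G i],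
      forall x, sum_of G x
    & forall (s : seq I) (f : I -> V), uniq s ->
        (forall i, i \in s -> G i (f i)) -> \sum_(i <- s) f i = 0 ->
        forall i, i \in s -> f i = 0].

Definition to_Zr (r : nat) (n : 'X_{1..r}) : 'rV[int]_r := \row_i (n i)%:Z.

Definition graded_algebra (r : nat) (A : comNzRingType) (B : comAlgType A)
    (Bg : 'X_{1..r} -> set B) : Prop :=
  is_direct_sum Bg /\
  forall mu nu x y, Bg mu x -> Bg nu y -> Bg (mu + nu)%MM (x * y).

Definition graded_module (r : nat) (A : comNzRingType) (B : comAlgType A)
    (Bg : 'X_{1..r} -> set B) (M : lmodType B) (Mg : 'rV[int]_r -> set M) :
    Prop :=
  is_direct_sum Mg /\
  forall mu nu b m, Bg mu b -> Mg nu m -> Mg (to_Zr mu + nu) (b *: m).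

(* A is identified with [B]_0 through a |-> a%:A. *)
Definition standard_graded (r : nat) (A : comNzRingType) (B : comAlgType A)
    (Bg : 'X_{1..r} -> set B) : Prop :=
  [/\ injective (in_alg B), Bg 0%MM = range (in_alg B)
    & exists (k : nat) (x : 'I_k -> B),
        (forall j, exists i : 'I_r, Bg U_(i)%MM (x j)) /\
        (forall b, exists p : {mpoly A[k]}, b = mmap (in_alg B) x p)].

Definition irrelevant_ideal (r : nat) (A : comNzRingType) (B : comAlgType A)
    (Bg : 'X_{1..r} -> set B) : set B :=
  sum_of (fun nu => [set b | Bg nu b /\ forall i, (0 < nu i)%N]).

Definition homogeneous (r : nat) (A : comNzRingType) (B : comAlgType A)
    (Bg : 'X_{1..r} -> set B) (J : set B) : Prop :=
  J `<=` sum_of (fun nu => Bg nu `&` J).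

Definition MultiProj (r : nat) (A : comNzRingType) (B : comAlgType A)
    (Bg : 'X_{1..r} -> set B) : set (set B) :=
  [set p | [/\ prime_ideal p, homogeneous Bg p
             & ~ (irrelevant_ideal Bg `<=` p)]].

Definition MultiProj_closed (r : nat) (A : comNzRingType) (B : comAlgType A)
    (Bg : 'X_{1..r} -> set B) : set (set (set B)) :=
  [set Z | exists J : set B, [/\ is_ideal J, homogeneous Bg J
                   & Z = [set p | MultiProj Bg p /\ J `<=` p]]].

Definition Supp_pp (r : nat) (A : comNzRingType) (B : comAlgType A)
    (Bg : 'X_{1..r} -> set B) (M : lmodType B) : set (set B) :=
  @Supp B M `&` MultiProj Bg.

Definition dim_pp (r : nat) (A : comNzRingType) (B : comAlgType A)
    (Bg : 'X_{1..r} -> set B) (M : lmodType B) : extnat :=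
  top_dim (MultiProj_closed Bg) (Supp_pp Bg M).

Definition A_submodule (A : comNzRingType) (B : comAlgType A) (M : lmodType B)
    (N : set M) : Prop :=
  [/\ N 0, forall x y, N x -> N y -> N (x + y)
    & forall (a : A) x, N x -> N (a%:A *: x)].

Definition lengthA (A : comNzRingType) (B : comAlgType A) (M : lmodType B)
    (V : set M) : extnat :=
  chain_sup [set N : set M | A_submodule N /\ N `<=` V].

(* A submodule, seen as a subgroup in order to reuse the library quotient. *)
Definition submod_pred (R : pzRingType) (M : lmodType R) (N : submodClosed M) :
  {pred M} := N.

Lemma submod_pred_zmod (R : pzRingType) (M : lmodType R)
    (N : submodClosed M) : zmod_closed (submod_pred N).
Proof.
split; first exact: (rpred0 N).
by move=> x y Nx Ny; rewrite -scaleN1r; apply: rpredD => //; apply: rpredZ.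
Qed.

HB.instance Definition _ (R : pzRingType) (M : lmodType R)
  (N : submodClosed M) :=
  GRing.isZmodClosed.Build M (submod_pred N) (submod_pred_zmod N).

Definition quot_module (R : pzRingType) (M : lmodType R) (N : submodClosed M) :
  Type := Quotient.quot (submod_pred N).

HB.instance Definition _ (R : pzRingType) (M : lmodType R) (N : submodClosed M) :=
  GRing.Zmodule.on (quot_module N).
HB.instance Definition _ (R : pzRingType) (M : lmodType R) (N : submodClosed M) :=
  EqQuotient.on (quot_module N).

Definition quot_scale (R : pzRingType) (M : lmodType R) (N : submodClosed M)
    (a : R) (x : quot_module N) : quot_module N :=
  \pi_(quot_module N) (a *: repr x).

Lemma pi_quotD (R : pzRingType) (M : lmodType R) (N : submodClosed M) (x y : M) :
  \pi_(quot_module N) (x + y) =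
    \pi_(quot_module N) x + \pi_(quot_module N) y :> quot_module N.
Proof. exact: (@Quotient.pi_add M (submod_pred N) x y). Qed.

Lemma pi_quotE (R : pzRingType) (M : lmodType R) (N : submodClosed M) (x y : M) :
  (\pi_(quot_module N) x = \pi_(quot_module N) y) <-> (x - y \in N).
Proof. by rewrite -[x - y \in N]/(x - y \in submod_pred N) Quotient.idealrBE; split => /eqP. Qed.

Lemma pi_quotZ (R : pzRingType) (M : lmodType R) (N : submodClosed M) a x :
  quot_scale a (\pi_(quot_module N) x) = \pi_(quot_module N) (a *: x).
Proof.
apply/pi_quotE; rewrite -scalerBr rpredZ //.
by apply/pi_quotE; rewrite reprK.
Qed.

Lemma quot_scalerA (R : pzRingType) (M : lmodType R) (N : submodClosed M) a b
    (x : quot_module N) : quot_scale a (quot_scale b x) = quot_scale (a * b) x.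
Proof. by elim/quotW: x => x; rewrite (pi_quotZ N b) !pi_quotZ scalerA. Qed.

Lemma quot_scale1r (R : pzRingType) (M : lmodType R) (N : submodClosed M) :
  left_id 1 (@quot_scale R M N).
Proof. by elim/quotW=> x; rewrite pi_quotZ scale1r. Qed.

Lemma quot_scalerDr (R : pzRingType) (M : lmodType R) (N : submodClosed M) :
  right_distributive (@quot_scale R M N) +%R.
Proof.
move=> a; elim/quotW=> x; elim/quotW=> y.
by rewrite -pi_quotD !pi_quotZ scalerDr pi_quotD.
Qed.

Lemma quot_scalerDl (R : pzRingType) (M : lmodType R) (N : submodClosed M)
    (x : quot_module N) : {morph (@quot_scale R M N)^~ x : a b / a + b}.
Proof.
by move=> a b; elim/quotW: x => x; rewrite !pi_quotZ scalerDl pi_quotD.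
Qed.

HB.instance Definition _ (R : pzRingType) (M : lmodType R) (N : submodClosed M) :=
  GRing.Zmodule_isLmodule.Build R (quot_module N) (@quot_scalerA R M N)
    (@quot_scale1r R M N) (@quot_scalerDr R M N) (@quot_scalerDl R M N).

Definition quot_grading (I : Type) (R : pzRingType) (M : lmodType R)
    (N : submodClosed M) (Mg : I -> set M) : I -> set (quot_module N) :=
  fun nu => [set \pi_(quot_module N) m | m in Mg nu].

Arguments quot_grading {I R M} N Mg _ _.

Definition H0_set (r : nat) (A : comNzRingType) (B : comAlgType A)
    (Bg : 'X_{1..r} -> set B) (M : lmodType B) : set M :=
  [set m | exists k, forall b,
     ideal_pow (irrelevant_ideal Bg) k b -> b *: m = 0].

Arguments H0_set {r A B} Bg M _.

Definition H0 (r : nat) (A : comNzRingType) (B : comAlgType A)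
    (Bg : 'X_{1..r} -> set B) (M : lmodType B) : {pred M} :=
  fun m => m \in H0_set Bg M.

Arguments H0 {r A B} Bg M _.

Lemma ideal_pow_ideal (R : comNzRingType) (I : set R) k :
  is_ideal (ideal_pow I k).
Proof.
split=> [J [[J0 _ _] _] //|x y Ix Iy J [JI sJ]|a x Ix J [JI sJ]].
  by case: (JI) => _ JD _; apply: JD; [apply: Ix | apply: Iy].
by case: (JI) => _ _ JM; apply: JM; apply: Ix.
Qed.

Lemma ideal_pow_le (R : comNzRingType) (I : set R) k l :
  (k <= l)%N -> ideal_pow I l `<=` ideal_pow I k.
Proof.
move=> /subnKC <- b; apply; split; first exact: ideal_pow_ideal.
move=> _ [x Ix <-]; rewrite big_split_ord /= mulrC.
have [_ _] := ideal_pow_ideal I k; apply=> J [_ sJ].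
by apply: sJ; exists (fun j => x (lshift _ j)) => // j; apply: Ix.
Qed.

Lemma H0_closed (r : nat) (A : comNzRingType) (B : comAlgType A)
    (Bg : 'X_{1..r} -> set B) (M : lmodType B) : subsemimod_closed (H0 Bg M).
Proof.
split; first split.
- by apply/mem_set; exists 0%N => b _; rewrite scaler0.
- move=> u v /set_mem [k uk] /set_mem [l vl]; apply/mem_set.
  exists (maxn k l) => b bkl; rewrite scalerDr uk ?vl ?addr0 //.
    exact: ideal_pow_le (leq_maxr k l) _ bkl.
  exact: ideal_pow_le (leq_maxl k l) _ bkl.
- move=> a u /set_mem [k uk]; apply/mem_set; exists k => b bk.
  by rewrite scalerA mulrC -scalerA uk ?scaler0.
Qed.

HB.instance Definition _ (r : nat) (A : comNzRingType) (B : comAlgType A)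
  (Bg : 'X_{1..r} -> set B) (M : lmodType B) :=
  GRing.isSubmodClosed.Build B M (H0 Bg M) (H0_closed Bg M).

Definition mod_H0 (r : nat) (A : comNzRingType) (B : comAlgType A)
    (Bg : 'X_{1..r} -> set B) (M : lmodType B) : lmodType B :=
  quot_module (H0 Bg M).

Definition mod_H0_grading (r : nat) (A : comNzRingType) (B : comAlgType A)
    (Bg : 'X_{1..r} -> set B) (M : lmodType B) (Mg : 'rV[int]_r -> set M) :
    'rV[int]_r -> set (mod_H0 Bg M) :=
  quot_grading (H0 Bg M) Mg.

Arguments mod_H0_grading {r A B} Bg {M} Mg _ _.

(* Laurent polynomials are given by their finitely supported coefficients. *)
Definition laurent (r : nat) := {fsfun 'rV[int]_r -> int with 0}.

Definition laurent_at1 (r : nat) (Q : laurent r) : int :=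
  \sum_(mu <- finsupp Q) Q mu.

(* Coefficient of t^k in (1 + t + t^2 + ...)^n; powers of t above t^k do not
   contribute. *)
Definition geom_coef (n : nat) (k : int) : int :=
  if k is Posz j then ((\poly_(i < j.+1) (1 : int)) ^+ n)`_j else 0.

(* Coefficient of t^nu in Q(t) / ((1-t_1)^n_1 ... (1-t_r)^n_r). *)
Definition frac_coef (r : nat) (Q : laurent r) (n : 'X_{1..r})
    (nu : 'rV[int]_r) : int :=
  \sum_(mu <- finsupp Q) Q mu * \prod_(i < r) geom_coef (n i) (nu 0 i - mu 0 i).

Definition sum_frac_coef (r : nat) (d : extnat) (Q : 'X_{1..r} -> laurent r)
    (nu : 'rV[int]_r) : int :=
  if d is Fin k
  then \sum_(n : 'X_{1..r < k.+1} | mdeg n == k) frac_coef (Q n) n nu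
  else 0.

(* Coefficientwise: Hilb_M(t) = sum over |n| = dim M of
   Q_n(t) / ((1-t_1)^n_1 ... (1-t_r)^n_r). *)
Definition hilb_identity (r : nat) (A : comNzRingType) (B : comAlgType A)
    (M : lmodType B) (Mg : 'rV[int]_r -> set M) (Q : 'X_{1..r} -> laurent r) :
    Prop :=
  forall nu, exists2 l, lengthA (Mg nu) = Fin l
                      & l%:Z = sum_frac_coef (krull_dim M) Q nu.

Definition hilb_decomposition (r : nat) (A : comNzRingType) (B : comAlgType A)
    (M : lmodType B) (Mg : 'rV[int]_r -> set M) (Q : 'X_{1..r} -> laurent r) :
    Prop :=
  hilb_identity Mg Q /\
  forall n, krull_dim M = Fin (mdeg n) -> 0 <= laurent_at1 (Q n).

(* n + 1 for n in Z^r with n >= -1 (meaningless otherwise). *)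
Definition succ_exp (r : nat) (n : 'rV[int]_r) : 'X_{1..r} :=
  [multinom `|(n 0%R i + 1)%R|%N | i < r].

(* e_n(M), in terms of the Hilbert series; meaningful for n >= -1 and
   |n| = dim M - r. *)
Definition hilb_mult (r : nat) (A : comNzRingType) (B : comAlgType A)
    (M : lmodType B) (Mg : 'rV[int]_r -> set M) (n : 'rV[int]_r) : int :=
  xget 0 [set c | exists2 Q, hilb_decomposition Mg Q
                           & c = laurent_at1 (Q (succ_exp n))].

Definition is_hilb_poly (r : nat) (A : comNzRingType) (B : comAlgType A)
    (M : lmodType B) (Mg : 'rV[int]_r -> set M) (P : {mpoly rat[r]}) : Prop :=
  exists nu0 : 'rV[int]_r, forall nu : 'rV[int]_r,
    (forall i, nu0 0 i <= nu 0 i) ->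
    exists2 l, lengthA (Mg nu) = Fin l & P.@[fun i => (nu 0 i)%:~R] = l%:R.

Definition hilb_poly (r : nat) (A : comNzRingType) (B : comAlgType A)
    (M : lmodType B) (Mg : 'rV[int]_r -> set M) : {mpoly rat[r]} :=
  xget 0 [set P | is_hilb_poly Mg P].

(* The polynomial binomial(X_i + k, k) = (X_i + 1) ... (X_i + k) / k!. *)
Definition binom_poly (r : nat) (i : 'I_r) (k : nat) : {mpoly rat[r]} :=
  (k`!)%:R^-1 *: \prod_(j < k) ('X_i + j.+1%:R).

(* The coefficients e(n) of P in the basis prod_i binomial(X_i + n_i, n_i). *)
Definition binom_coefs (r : nat) (P : {mpoly rat[r]}) :
    {fsfun 'X_{1..r} -> int with 0} :=
  xget [fsfun] [set e : {fsfun 'X_{1..r} -> int with 0} |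
    P = \sum_(n <- finsupp e) (e n)%:~R *: \prod_(i < r) binom_poly i (n i)].

(* e(n; M), in terms of the Hilbert polynomial; meaningful for
   |n| = dim Supp_++(M). *)
Definition poly_mult (r : nat) (A : comNzRingType) (B : comAlgType A)
    (M : lmodType B) (Mg : 'rV[int]_r -> set M) (n : 'X_{1..r}) : int :=
  binom_coefs (hilb_poly Mg) n.

(* Main.v *)
(** Let h_p denote the Hilbert function of B/p.  The module M has a filtration
    by graded submodules whose quotients are shifts of B/p with p a homogeneous
    prime, so it is enough to understand h_p.  If no generator of B survives in
    B/p, then Hilb = 1; otherwise some x of degree e_i is not in p, and
    (1 - t_i) Hilb(B/p) = Hilb(B/(p + xB)), which is a sum of shifted series of
    larger primes.  Noetherian induction yields the decomposition, a chain of d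
    strict inclusions of primes above p, and the bound O(s^d) for the sum of
    h_p over the box [0, s]^r.  No longer chain exists: multiplication by an f in
    q_1 \ q_0 is injective on B/q_0, so a chain q_0 < ... < q_l makes the part
    of B/q_0 of degree in [0, es]^r grow at least like binom(s + l, l).

    Uniqueness of Q_n(1), and its comparison with e(n; M), come from finite
    difference functionals that vanish on all t^mu / (1 - t)^m with
    |m| <= |n|, m <> n, and take the value 1 for m = n.

    For dim(M / H^0) = r + d_++: a chain of relevant primes can be prolonged by
    r further homogeneous primes; conversely, if no chain of n + 1 strict
    inclusions of relevant primes starts at p, then h_p(s, ..., s) = O(s^n) by
    induction along x as above, and h_p is nondecreasing, so its sum over the
    box is O(s^(n + r)). *)

Require Import Defs.
From HB Require Import structures.
From Stdlib Require List.
From mathcomp Require Import all_boot all_order all_algebra.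
From mathcomp Require Import boolp classical_sets.
From mathcomp Require Import finmap mpoly.
From mathcomp Require Import zify ring.

Set Implicit Arguments.
Unset Strict Implicit.
Unset Printing Implicit Defensive.

Import Order.TTheory GRing.Theory Num.Theory.

Local Open Scope classical_set_scope.
Local Open Scope ring_scope.

(** * Chains of submodules and length *)

Section ChainLength.
Variables (A : comNzRingType) (B : comAlgType A).

(** Krull dimension is squeezed between two inequalities, without heights of ideals or Noether
    normalization. One number d is at once the order of the pole of Hilb(B/p), the exponent bounding
    the sums over boxes, and the length of an explicit chain of primes; this is why [hilb_prime]
    carries all three through a single induction. Lengths are suprema of chains, so their additivity
    has to come from splitting and transporting chains. When series of different orders are added,
    those of lower order are multiplied by (1 - t_i)/(1 - t_i). Their new numerators cancel at t =
    1, so only the quotients of largest dimension contribute to Q_n(1); nonnegativity and positivity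
    survive. The shift from n to n + 1 in (III) comes from binom(x + n, n) being the coefficient of
    t^x in 1/(1 - t)^(n+1). The Hilbert polynomial is tied to lengths only in large degrees, so the
    functionals used for it must be supported there; this is possible because all exponents n_i + 1
    are positive, whereas an exponent 0 is visible only near the exponent of the numerator. *)

Definition interval (M : lmodType B) (U V : set M) : set (set M) :=
  [set N | [/\ A_submodule N, U `<=` N & N `<=` V]].

Definition len_ge (M : lmodType B) (U V : set M) (n : nat) : Prop :=
  chain_lengths (interval U V) n.

Definition len_le (M : lmodType B) (U V : set M) (n : nat) : Prop :=
  forall k, len_ge U V k -> (k <= n)%N.

Definition has_len (M : lmodType B) (U V : set M) (n : nat) : Prop :=
  len_ge U V n /\ len_le U V n.

Section OneModule.
Variable M : lmodType B.
Implicit Types (U V W X Y N : set M).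

Lemma Asub0 N : A_submodule N -> N 0. Proof. by case. Qed.
Lemma AsubD N x y : A_submodule N -> N x -> N y -> N (x + y).
Proof. by case=> _ h _; apply: h. Qed.
Lemma AsubZ N (a : A) x : A_submodule N -> N x -> N (a%:A *: x).
Proof. by case=> _ _ h; apply: h. Qed.
Lemma AsubN N x : A_submodule N -> N x -> N (- x).
Proof.
move=> aN Nx; have := AsubZ (-1) aN Nx.
by rewrite scaleN1r scaleN1r.
Qed.
Lemma AsubB N x y : A_submodule N -> N x -> N y -> N (x - y).
Proof. by move=> aN Nx Ny; apply: AsubD => //; apply: AsubN. Qed.

Definition sumset U V : set M := [set x | exists2 u, U u & V (x - u)].

Lemma Asub_sum U V : A_submodule U -> A_submodule V -> A_submodule (sumset U V).
Proof.
move=> aU aV; split.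
- by exists 0; rewrite ?subr0; apply: Asub0.
- move=> x y [u Uu Vu] [v Uv Vv]; exists (u + v); first exact: AsubD.
  by rewrite opprD addrACA; apply: AsubD.
- move=> a x [u Uu Vu]; exists (a%:A *: u); first exact: AsubZ.
  by rewrite -scalerBr; apply: AsubZ.
Qed.

Lemma Asub_cap U V : A_submodule U -> A_submodule V -> A_submodule (U `&` V).
Proof.
move=> aU aV; split.
- by split; apply: Asub0.
- by move=> x y [? ?] [? ?]; split; apply: AsubD.
- by move=> a x [? ?]; split; apply: AsubZ.
Qed.

Lemma sumset_l U V : A_submodule V -> U `<=` sumset U V.
Proof. by move=> aV x Ux; exists x => //; rewrite subrr; apply: Asub0. Qed.
Lemma sumset_r U V : A_submodule U -> V `<=` sumset U V.
Proof. by move=> aU x Vx; exists 0; rewrite ?subr0 //; apply: Asub0. Qed.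

Lemma sumset_min U V W : A_submodule W -> U `<=` W -> V `<=` W ->
  sumset U V `<=` W.
Proof.
move=> aW UW VW x [u Uu Vu]; rewrite -(subrK u x).
by apply: AsubD => //; [apply: VW|apply: UW].
Qed.

Lemma len_ge_sub U V n : len_ge U V n -> U `<=` V.
Proof. by case=> Z [/(_ 0%N isT) [_ UZ ZV] _]; apply: subset_trans UZ ZV. Qed.

Lemma len_ge0 U V : A_submodule U -> U `<=` V -> len_ge U V 0.
Proof. by move=> aU UV; exists (fun=> U); split=> // i _; split. Qed.

Lemma len_ge1 U V : A_submodule U -> A_submodule V -> U `<` V -> len_ge U V 1.
Proof.
move=> aU aV UV; exists (fun i => if i is 0%N then U else V); split.
  by case=> [|i] _; split => //; case: UV.
by case.
Qed.

Lemma len_ge_cat U V W a b : len_ge U V a -> len_ge V W b -> len_ge U W (a + b).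
Proof.
move=> UVa VWb; have UV := len_ge_sub UVa; have VW := len_ge_sub VWb.
case: UVa => Z [Zi Zl]; case: VWb => Z' [Zi' Zl'].
exists (fun i => if (i < a)%N then Z i else Z' (i - a)%N); split.
  move=> i ile; case: ltnP => ia.
    by have [? ? ?] := Zi i (ltnW ia); split=> //; apply: subset_trans VW.
  by have [|? ? ?] := Zi' (i - a)%N; [lia|split=> //; apply: subset_trans UV _].
move=> i ilt; case: (ltnP i a) => ia; last first.
  have -> : (i.+1 < a)%N = false by lia.
  by rewrite subSn //; apply: Zl'; lia.
case: ltnP => ia1; first exact: Zl.
have -> : (i.+1 - a = 0)%N by lia.
have h := Zl _ ia; have ai : i.+1 = a by lia.
rewrite ai in h.
have [_ _ ZV] := Zi a (leqnn _); have [_ VZ _] := Zi' 0%N isT.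
have ZaZ := subset_trans ZV VZ.
case: h => sub ne; split; first exact: subset_trans ZaZ.
by move=> Z'sub; apply: ne; apply: subset_trans Z'sub.
Qed.

Lemma len_ge_mono U V U' V' n : U' `<=` U -> V `<=` V' ->
  len_ge U V n -> len_ge U' V' n.
Proof.
move=> UU VV [Z [Zi Zl]]; exists Z; split=> // i /Zi [aZ UZ ZV].
by split => //; [apply: subset_trans UZ|apply: subset_trans VV].
Qed.

(* Each strict step of a chain from U to W is strict below V or above V, by
   the modular law. *)
Lemma len_ge_split U V W n : A_submodule V -> A_submodule W ->
  U `<=` V -> V `<=` W ->
  len_ge U W n -> exists a b, [/\ len_ge U V a, len_ge V W b & (n <= a + b)%N].
Proof.
move=> aV aW UV VW [Z [Zi Zl]].
have aZ i : (i <= n)%N -> A_submodule (Z i) by case/Zi.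
have UZ i : (i <= n)%N -> U `<=` Z i by case/Zi.
have acap i : (i <= n)%N -> A_submodule (Z i `&` V).
  by move=> /aZ ?; apply: Asub_cap.
have asum i : (i <= n)%N -> A_submodule (sumset (Z i) V).
  by move=> /aZ ?; apply: Asub_sum.
suff H i : (i <= n)%N -> exists a b, [/\ len_ge U (Z i `&` V) a,
    len_ge V (sumset (Z i) V) b & (i <= a + b)%N].
  have [a [b [Ua Vb le]]] := H n (leqnn _).
  exists a, b; split=> //; first by apply: len_ge_mono Ua => // x [].
  by apply: len_ge_mono Vb => //; apply: sumset_min => //; case: (Zi n).
elim: i => [|i IH] ilen.
  exists 0%N, 0%N; split=> //.
    exists (fun=> Z 0%N `&` V); split=> // i _; split=> //; first exact: acap.
    by move=> x Ux; split; [apply: UZ|apply: UV].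
  by apply: len_ge0 => //; apply: sumset_r; apply: aZ.
have [a [b [Ua Vb le]]] := IH (ltnW ilen).
have [sub nsub] := Zl i ilen.
have cs : Z i `&` V `<=` Z i.+1 `&` V by move=> x [/sub].
have ss : sumset (Z i) V `<=` sumset (Z i.+1) V.
  by move=> x [u /sub Zu Vx]; exists u.
have [eqc|neqc] := pselect (Z i.+1 `&` V `<=` Z i `&` V); last first.
  exists (a + 1)%N, b; split; last by lia.
    apply: len_ge_cat Ua _; apply: len_ge1; [|exact: acap|by split].
    by apply: acap; apply: ltnW.
  by apply: len_ge_mono Vb.
exists a, (b + 1)%N; split; last by lia.
  by apply: len_ge_mono Ua.
apply: len_ge_cat Vb _; apply: len_ge1; [|exact: asum|split=> //].
  by apply: asum; apply: ltnW.
move=> seq; apply: nsub => x Zx.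
have [u Zu Vxu] := seq x (sumset_l aV Zx).
have [Zxu _] : (Z i `&` V) (x - u).
  by apply: eqc; split=> //; apply: AsubB => //; [apply: aZ|apply: sub].
by rewrite -(subrK u x); apply: AsubD => //; apply: aZ; apply: ltnW.
Qed.

Lemma len_le_cat U V W a b : A_submodule V -> A_submodule W ->
  U `<=` V -> V `<=` W -> len_le U V a -> len_le V W b -> len_le U W (a + b).
Proof.
move=> aV aW UV VW Ua Vb k /(len_ge_split aV aW UV VW) [a' [b' [ha hb h]]].
by have := Ua _ ha; have := Vb _ hb; lia.
Qed.

Lemma has_len_cat U V W a b : A_submodule V -> A_submodule W ->
  has_len U V a -> has_len V W b -> has_len U W (a + b).
Proof.
move=> aV aW [Ua Ua'] [Vb Vb']; split; first exact: len_ge_cat Vb.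
by apply: (len_le_cat aV); rewrite //; apply: len_ge_sub; eassumption.
Qed.

Lemma has_len_inj U V m n : has_len U V m -> has_len U V n -> m = n.
Proof.
move=> [ge le] [ge' le']; apply/eqP.
by rewrite eqn_leq (le _ ge') (le' _ ge).
Qed.

Lemma has_len_refl U : A_submodule U -> has_len U U 0.
Proof.
move=> aU; split; first exact: len_ge0.
case=> // k [Z [Zi Zl]]; have [_ n] := Zl 0%N isT.
have [_ _ h1] := Zi 1%N isT; have [_ h0 _] := Zi 0%N isT.
by case: n; apply: subset_trans h0.
Qed.

Lemma chain_sup_Fin (T : Type) (P : set (set T)) n : chain_lengths P n ->
  (forall k, chain_lengths P k -> (k <= n)%N) -> chain_sup P = Fin n.
Proof.
move=> Pn Pk; rewrite /chain_sup; case: asboolP => [e|_].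
  by move: Pn; rewrite e.
have ub : has_ubound (chain_lengths P) by exists n => k /Pk; rewrite leEnat.
case: asboolP => [_|/(_ ub)//]; congr Fin; apply/eqP.
have sn : supremums (chain_lengths P) n.
  by split=> [k /Pk|k /(_ _ Pn)]; rewrite ?leEnat.
rewrite /supremum; case: ifPn => [/eqP e|_]; first by move: Pn; rewrite e.
by case: xgetP => [y _ ys|/(_ _ sn)//]; apply/eqP/(is_subset1_supremums ys sn).
Qed.

Lemma chain_sup_FinP (T : Type) (P : set (set T)) n : chain_sup P = Fin n ->
  chain_lengths P n /\ (forall k, chain_lengths P k -> (k <= n)%N).
Proof.
rewrite /chain_sup; case: asboolP => // /eqP/set0P [k Pk].
case: asboolP => // ub e.
have [m Pm maxm] : exists2 m, chain_lengths P m &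
    forall k, chain_lengths P k -> (k <= m)%N.
  have ex : exists k, `[< chain_lengths P k >] by exists k; apply/asboolP.
  case: ub => N Nub.
  have ubN j : `[< chain_lengths P j >] -> (j <= N)%N by move/asboolP/Nub.
  case: (ex_maxnP ex ubN) => m /asboolP Pm maxm; exists m => // j Pj.
  by apply: maxm; apply/asboolP.
have := chain_sup_Fin Pm maxm; rewrite /chain_sup.
case: asboolP => // _; case: asboolP => // _ e'.
by move: e; rewrite e' => -[<-].
Qed.

Lemma interval0 (V : set M) :
  interval [set 0] V = [set N | A_submodule N /\ N `<=` V].
Proof.
apply/seteqP; split=> N [aN]; first by [].
by move=> NV; split=> // _ ->; apply: Asub0.
Qed.

Lemma lengthA_Fin (V : set M) n : has_len [set 0] V n -> lengthA V = Fin n.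
Proof. by rewrite /has_len/len_le/len_ge interval0 => -[]; apply: chain_sup_Fin. Qed.

End OneModule.

Lemma chain_lengths_map (T T' : Type) (P : set (set T)) (P' : set (set T'))
    (f : set T -> set T') n :
  (forall X, P X -> P' (f X)) ->
  (forall X Y, P X -> P Y -> X `<` Y -> f X `<` f Y) ->
  chain_lengths P n -> chain_lengths P' n.
Proof.
move=> PP' mono [Z [Zi Zl]]; exists (f \o Z); split=> i ilt /=.
  exact: PP' (Zi _ ilt).
by apply: mono; [apply: Zi; apply: ltnW|apply: Zi|apply: Zl].
Qed.

Section Transfer.
Variables (M M' : lmodType B) (phi : M -> M').
Hypothesis phiD : {morph phi : x y / x + y}.
Hypothesis phiZ : forall (a : A) x, phi (a%:A *: x) = a%:A *: phi x.
Variables (U V : set M) (U' V' : set M').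
Hypotheses (aU : A_submodule U) (aV : A_submodule V).
Hypotheses (aU' : A_submodule U') (aV' : A_submodule V').

Let phi0 : phi 0 = 0.
Proof. by apply: (addrI (phi 0)); rewrite -phiD !addr0. Qed.

Let phiB : {morph phi : x y / x - y}.
Proof.
by move=> x y; apply: (addIr (phi y)); rewrite -phiD !subrK.
Qed.

(** Preimages of a strict chain stay strict, because modulo U' every element of V' comes from V. *)
Lemma len_ge_preim n : U `<=` V -> (forall u, U u -> U' (phi u)) ->
  (forall x, V' x -> exists2 v, V v & U' (x - phi v)) ->
  len_ge U' V' n -> len_ge U V n.
Proof.
move=> UV hU hV; apply: (chain_lengths_map
  (f := fun N => [set v | V v /\ N (phi v)])).
  move=> N [aN UN NV]; split.
  - split; first by split; [exact: Asub0|rewrite phi0; exact: Asub0].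
      move=> x y [Vx Nx] [Vy Ny]; split; first exact: AsubD.
      by rewrite phiD; apply: AsubD.
    move=> a x [Vx Nx]; split; first exact: AsubZ.
    by rewrite phiZ; apply: AsubZ.
  - by move=> u Uu; split; [apply: UV|apply: UN; apply: hU].
  - by move=> v [].
move=> X Y [aX UX XV] [aY UY YV] [XY nYX]; split.
  by move=> v [Vv Xv]; split=> //; apply: XY.
move=> sub; apply: nYX => y Yy.
have [v Vv Uv] := hV y (YV y Yy).
have Xv : X (phi v).
  have [] // := sub v; split=> //.
  by rewrite -(subKr y (phi v)); apply: AsubB => //; apply: UY.
by rewrite -(subrK (phi v) y); apply: AsubD => //; apply: UX.
Qed.

(** Images of a chain, enlarged by U', stay strict, because the map induced on V/U is injective. *)
Lemma len_ge_im n : U' `<=` V' -> (forall v, V v -> V' (phi v)) ->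
  (forall v, V v -> U' (phi v) -> U v) ->
  len_ge U V n -> len_ge U' V' n.
Proof.
move=> UV hV hU; apply: (chain_lengths_map
  (f := fun N => [set x | exists2 v, N v & U' (x - phi v)])).
  move=> N [aN UN NV]; split.
  - split; first by exists 0; rewrite ?phi0 ?subr0; apply: Asub0.
      move=> x y [v Nv Ux] [w Nw Uy]; exists (v + w); first exact: AsubD.
      by rewrite phiD opprD addrACA; apply: AsubD.
    move=> a x [v Nv Ux]; exists (a%:A *: v); first exact: AsubZ.
    by rewrite phiZ -scalerBr; apply: AsubZ.
  - by move=> u Uu; exists 0; rewrite ?phi0 ?subr0 //; apply: Asub0.
  - move=> x [v Nv Ux]; rewrite -(subrK (phi v) x); apply: AsubD => //.
      exact: UV.
    by apply: hV; apply: NV.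
move=> X Y [aX UX XV] [aY UY YV] [XY nYX]; split.
  by move=> x [v Xv Ux]; exists v => //; apply: XY.
move=> sub; apply: nYX => y Yy.
have [|v Xv Uyv] := sub (phi y).
  by exists y => //; rewrite subrr; apply: Asub0.
rewrite -(subrK v y); apply: AsubD => //; apply: UX; apply: hU.
  by apply: AsubB => //; [apply: YV|apply: XV].
by rewrite phiB.
Qed.

Lemma has_len_iso n : U `<=` V -> U' `<=` V' -> (forall v, V v -> V' (phi v)) ->
  (forall v, V v -> (U' (phi v) <-> U v)) ->
  (forall x, V' x -> exists2 v, V v & U' (x - phi v)) ->
  has_len U V n -> has_len U' V' n.
Proof.
move=> UV UV' hV hU hV' [ge le]; split.
  by apply: len_ge_im ge => // v Vv; case: (hU v Vv).
move=> k h; apply: le; apply: len_ge_preim h => //.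
by move=> u Uu; case: (hU u (UV u Uu)) => _; apply.
Qed.

End Transfer.
End ChainLength.

(** * Chain conditions and Artinian local rings *)

Definition acc (T : Type) (P : set (set T)) : Prop :=
  forall I : nat -> set T, (forall k, P (I k)) ->
    (forall k, I k `<=` I k.+1) -> exists k, forall l, (k <= l)%N -> I l = I k.

Lemma mem_predP (T : Type) (p : set T) x : x \in [pred y in p] <-> p x.
Proof. by rewrite inE /=; split=> [/set_mem|/mem_set]. Qed.

Lemma chain_mono (T : Type) (I : nat -> set T) :
  (forall k, I k `<=` I k.+1) -> forall k l, (k <= l)%N -> I k `<=` I l.
Proof.
move=> h k l /subnK <-; elim: (l - k)%N => // n IH.
by rewrite addSn; apply: subset_trans IH (h _).
Qed.

Lemma proper_of_neq (T : Type) (X Y : set T) : X `<=` Y -> X <> Y -> X `<` Y.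
Proof. by move=> XY ne; split=> // YX; apply: ne; apply/seteqP. Qed.

Lemma proper_irrefl (T : Type) (X : set T) : ~ (X `<` X).
Proof. by case=> _ /(_ (fun x h => h)). Qed.

(** Noetherian induction: a counterexample always has a larger one above it, and dependent choice
    turns this into a chain that never stabilizes. *)
Lemma acc_ind (T : Type) (P Q : set (set T)) : acc P ->
  (forall X, P X -> (forall Y, P Y -> X `<` Y -> Q Y) -> Q X) ->
  forall X, P X -> Q X.
Proof.
move=> accP step X PX; apply: contrapT => nQX.
have next (Z : {Z : set T | P Z /\ ~ Q Z}) :
    {Z' : {Z : set T | P Z /\ ~ Q Z} | sval Z `<` sval Z'}.
  apply: cid; case: Z => Z [PZ nQZ] /=; apply: contrapT => nex; apply: nQZ.
  apply: step => // Y PY ZY; apply: contrapT => nQY; apply: nex.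
  by exists (exist _ Y (conj PY nQY)).
pose s k := iter k (fun Z => sval (next Z)) (exist _ X (conj PX nQX)).
have slt k : sval (s k) `<` sval (s k.+1) by rewrite /s iterS; case: (next _).
have [k|k|k /(_ k.+1 (leqnSn _)) e] := accP (fun k => sval (s k)).
- by case: (svalP (s k)).
- by case: (slt k).
by have := slt k; rewrite e => /proper_irrefl.
Qed.

Lemma not_acc_strict (T : Type) (P : set (set T)) : ~ acc P ->
  exists2 K : nat -> set T, (forall k, P (K k)) & (forall k, K k `<` K k.+1).
Proof.
move=> /existsNP [I /not_implyP [iI /not_implyP [Isub nst]]].
have next k : {l | (k < l)%N /\ I k <> I l}.
  apply: cid; apply: contrapT => nex; apply: nst; exists k => l kl.
  apply: contrapT => ne; apply: nex; exists l; split; last by move/esym.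
  by rewrite ltn_neqAle kl andbT; apply/eqP => e; apply: ne; rewrite e.
pose s n := iter n (fun k => sval (next k)) 0%N.
exists (fun k => I (s k)) => // k; rewrite /s iterS.
case: (next _) => l [kl ne] /=; apply: proper_of_neq => //.
by apply: chain_mono => //; apply: ltnW.
Qed.

Lemma dcc_min (T : Type) (P Q : set (set T)) :
  (forall I : nat -> set T, (forall k, P (I k)) ->
    (forall k, I k.+1 `<=` I k) -> exists k, forall l, (k <= l)%N -> I l = I k) ->
  (exists X, P X /\ Q X) ->
  exists X, [/\ P X, Q X & forall Y, P Y -> Y `<` X -> ~ Q Y].
Proof.
move=> dcc [X [PX QX]]; apply: contrapT => nmin.
have next (Z : {Z : set T | P Z /\ Q Z}) :
    {Z' : {Z : set T | P Z /\ Q Z} | sval Z' `<` sval Z}.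
  apply: cid; case: Z => Z [PZ QZ] /=; apply: contrapT => nex; apply: nmin.
  exists Z; split=> // Y PY YZ QY; apply: nex.
  by exists (exist _ Y (conj PY QY)).
pose s k := iter k (fun Z => sval (next Z)) (exist _ X (conj PX QX)).
have slt k : sval (s k.+1) `<` sval (s k) by rewrite /s iterS; case: (next _).
have [k|k|k /(_ k.+1 (leqnSn _)) e] := dcc (fun k => sval (s k)).
- by case: (svalP (s k)).
- by case: (slt k).
by have := slt k; rewrite e => /proper_irrefl.
Qed.

Section Ideals.
Variable R : comNzRingType.
Implicit Types (I J p : set R) (x y : R).

Lemma ideal0 I : is_ideal I -> I 0. Proof. by case. Qed.
Lemma idealD I x y : is_ideal I -> I x -> I y -> I (x + y).
Proof. by case=> _ h _; apply: h. Qed.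
Lemma idealM I x y : is_ideal I -> I y -> I (x * y).
Proof. by case=> _ _ h; apply: h. Qed.
Lemma idealMr I x y : is_ideal I -> I x -> I (x * y).
Proof. by rewrite mulrC; apply: idealM. Qed.
Lemma idealN I x : is_ideal I -> I x -> I (- x).
Proof. by move=> iI Ix; rewrite -mulN1r; apply: idealM. Qed.
Lemma idealB I x y : is_ideal I -> I x -> I y -> I (x - y).
Proof. by move=> iI Ix Iy; apply: idealD => //; apply: idealN. Qed.
Lemma ideal_sum I (T : Type) (s : seq T) (P : pred T) (f : T -> R) :
  is_ideal I -> (forall i, P i -> I (f i)) -> I (\sum_(i <- s | P i) f i).
Proof.
move=> iI If; elim/big_ind: _ => //; first exact: ideal0.
by move=> x y; apply: idealD.
Qed.

Lemma prime_idealP p : prime_ideal p <->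
  [/\ is_ideal p, ~ p 1 & forall x y, p (x * y) -> p x \/ p y].
Proof.
split.
  case=> -[/mem_predP p0 p1 pD] pM.
  have {}pD a x y : p x -> p y -> p (a * x + y).
    by move=> /mem_predP px /mem_predP py; apply/mem_predP/pD.
  split; first last.
  - move=> x y /mem_predP/pM/orP [] /mem_predP; by [left|right].
  - by move=> /mem_predP; apply/negP.
  split=> //; first by move=> x y px py; rewrite -(mul1r x); apply: pD.
  by move=> a x px; rewrite -(addr0 (a * x)); apply: pD.
case=> ip p1 pM; split; first split.
- by apply/mem_predP; apply: ideal0.
- by apply/negP => /mem_predP.
- move=> a x y /mem_predP px /mem_predP py; apply/mem_predP.
  by apply: idealD => //; apply: idealM.
move=> x y /mem_predP /pM [px|py]; apply/orP.
  by left; apply/mem_predP.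
by right; apply/mem_predP.
Qed.

Lemma prime_is_ideal p : prime_ideal p -> is_ideal p.
Proof. by case/prime_idealP. Qed.
Lemma prime_not1 p : prime_ideal p -> ~ p 1.
Proof. by case/prime_idealP. Qed.
Lemma primeM p x y : prime_ideal p -> p (x * y) -> p x \/ p y.
Proof. by case/prime_idealP => _ _; apply. Qed.
Lemma primeX p x n : prime_ideal p -> p (x ^+ n) -> p x.
Proof.
move=> pp; elim: n => [|n IH]; first by rewrite expr0 => /(prime_not1 pp).
by rewrite exprS => /(primeM pp) [].
Qed.

(** Zorn's lemma on the ideals containing x but not 1, of which the principal ideal of x is one. *)
Lemma nonunit_in_maximal x : (forall y, y * x <> 1) ->
  exists2 m, maximal_ideal m & m x.
Proof.
move=> nux.
pose T := {I : set R | [/\ is_ideal I, ~ I 1 & I x]}.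
have t0 : T.
  exists [set z | exists y, z = y * x]; split.
  - split; first by exists 0; rewrite mul0r.
      by move=> _ _ [a ->] [b ->]; exists (a + b); rewrite mulrDl.
    by move=> a _ [b ->]; exists (a * b); rewrite mulrA.
  - by case=> y /esym; apply: nux.
  - by exists 1; rewrite mul1r.
pose le (I J : T) := `[< sval I `<=` sval J >].
have [||C totC|I maxI] := @ZL_preorder T t0 le.
- by move=> ?; apply/asboolP.
- by move=> ? ? ? /asboolP IJ /asboolP JK; apply/asboolP; apply: subset_trans JK.
- have [[I0 CI0]|C0] := pselect (exists s : T, C s); last first.
    by exists t0 => s Cs; case: C0; exists s.
  pose U := [set y | exists2 I : T, C I & sval I y].
  have PU : [/\ is_ideal U, ~ U 1 & U x].
    split.
    - split.
      + by exists I0 => //; case: (svalP I0) => /ideal0.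
      + move=> y z [s Cs sy] [t Ct tz].
        have [/asboolP h|/asboolP h] := totC s t Cs Ct.
          by exists t => //; case: (svalP t) => it _ _; apply: idealD => //; apply: h.
        by exists s => //; case: (svalP s) => it _ _; apply: idealD => //; apply: h.
      + move=> a y [s Cs sy]; exists s => //.
        by case: (svalP s) => it _ _; apply: idealM.
    - by case=> s _; case: (svalP s).
    - by exists I0 => //; case: (svalP I0).
  exists (exist _ U PU) => s Cs; apply/asboolP => y sy /=.
  by exists s.
have [iI I1 Ix] := svalP I; exists (sval I) => //; split=> // J iJ J1 IJ.
have := maxI (exist _ J (And3 iJ J1 (IJ _ Ix))).
move=> h; apply/seteqP; split=> //.
by apply/asboolP/h/asboolP.
Qed.

(** The chain of ideals (x^k) stabilizes, so x^k (1 - y x) = 0 for some k and y. A nonunit x lies in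
    the only maximal ideal, hence 1 - y x lies in none and is a unit, and x^k = 0. *)
Lemma artinian_local_unit_or_nilpotent : artinian_ring R -> local_ring R ->
  forall x, (exists y, y * x = 1) \/ (exists n, x ^+ n = 0).
Proof.
move=> art [m [mm mu]] x; have [|nux] := pselect (exists y, y * x = 1); first by left.
right; have mx : m x.
  have [|m' mm' m'x] := @nonunit_in_maximal x.
    by move=> y yx; apply: nux; exists y.
  by rewrite (mu m' mm').
have [k|k _ [y ->]|k hk] := art (fun k => [set z | exists y, z = y * x ^+ k]).
- split; first by exists 0; rewrite mul0r.
    by move=> _ _ [a ->] [b ->]; exists (a + b); rewrite mulrDl.
  by move=> a _ [b ->]; exists (a * b); rewrite mulrA.
- by exists (y * x); rewrite exprS mulrA.
have : [set z | exists y, z = y * x ^+ k] (x ^+ k) by exists 1; rewrite mul1r.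
rewrite -(hk k.+1 (leqnSn _)) => -[y xk].
have e : x ^+ k * (1 - y * x) = 0.
  by rewrite mulrBr mulr1 {1}xk exprS; apply/eqP; rewrite subr_eq0; apply/eqP; ring.
have [[z zu]|nu] := pselect (exists z, z * (1 - y * x) = 1).
  by exists k; rewrite -(mulr1 (x ^+ k)) -zu mulrCA e mulr0.
have [m1 m1m mu1] : exists2 m', maximal_ideal m' & m' (1 - y * x).
  by apply: nonunit_in_maximal => z zu; apply: nu; exists z.
move: mu1; rewrite -(mu _ m1m) => mu1.
case: mm => im n1 _; case: n1.
by rewrite -(subrK (y * x) 1); apply: idealD => //; apply: idealM.
Qed.

(* A minimal ideal J violating the ascending chain condition is killed by
   every nilpotent, hence is a vector space in which a strict ascending chain
   produces an independent sequence and thereby a smaller bad ideal. *)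
Lemma artinian_local_noetherian : artinian_ring R -> local_ring R ->
  acc (@is_ideal R).
Proof.
move=> art loc; have un := artinian_local_unit_or_nilpotent art loc.
pose sub (J : set R) := [set I | is_ideal I /\ I `<=` J].
apply: contrapT => nacc.
have [|J [iJ badJ minJ]] := @dcc_min R (@is_ideal R) (fun J => ~ acc (sub J)) art.
  exists setT; split=> //; move=> accT; apply: nacc => I iI Isub.
  by apply: accT => // k; split.
have {}minJ Z : is_ideal Z -> Z `<=` J -> Z <> J -> acc (sub Z).
  by move=> iZ ZJ neZ; apply: contrapT; apply: minJ => //; apply: proper_of_neq.
have [K sK Klt] := not_acc_strict badJ.
have iK k : is_ideal (K k) by case: (sK k).
have KJ k : K k `<=` J by case: (sK k).
have Kmono k l : (k <= l)%N -> K k `<=` K l.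
  by apply: chain_mono => i; case: (Klt i).
have stab Z : is_ideal Z -> Z `<=` J -> Z <> J ->
    exists k, forall l, (k <= l)%N -> K l `&` Z = K k `&` Z.
  move=> iZ ZJ neZ; apply: (minJ Z iZ ZJ neZ) => k.
    split; last by move=> z [].
    split; first by split; apply: ideal0.
      by move=> x y [? ?] [? ?]; split; apply: idealD.
    by move=> a x [? ?]; split; apply: idealM.
  by move=> z [Kz Zz]; split=> //; case: (Klt k) => + _; apply.
(* Compare J with its submodules xJ and Y = {z in J : x z = 0}. If both are proper, the chain K
   stabilizes in Y and after multiplication by x, hence stabilizes outright. If xJ = J, then J = x^n
   J = 0. *)
have killed x : ~ (exists y, y * x = 1) -> forall z, J z -> x * z = 0.
  move=> nux; have [//|[n xn]] := un x.
  pose X := [set z | exists2 w, J w & z = x * w].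
  have iX : is_ideal X.
    split; first by exists 0; rewrite ?mulr0 //; apply: ideal0.
      move=> _ _ [v Jv ->] [w Jw ->]; exists (v + w); last by rewrite mulrDr.
      exact: idealD.
    by move=> a _ [w Jw ->]; exists (a * w); [apply: idealM|rewrite mulrCA].
  pose Y := [set z | J z /\ x * z = 0].
  have iY : is_ideal Y.
    split; first by split; [apply: ideal0|rewrite mulr0].
      by move=> v w [Jv xv] [Jw xw]; split; [apply: idealD|rewrite mulrDr xv xw addr0].
    by move=> a w [Jw xw]; split; [apply: idealM|rewrite mulrCA xw mulr0].
  have XJ : X `<=` J by move=> _ [w Jw ->]; apply: idealM.
  have YJ : Y `<=` J by move=> w [].
  have [eY|neY] := pselect (Y = J); first by move=> z; rewrite -eY => -[].
  have [eX|neX] := pselect (X = J).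
    have Jn z k : J z -> exists2 w, J w & z = x ^+ k * w.
      elim: k z => [|k IH] z Jz; first by exists z; rewrite ?expr0 ?mul1r.
      have [w Jw ->] := IH _ Jz; have [v Jv ->] : X w by rewrite eX.
      by exists v => //; rewrite exprSr mulrA.
    by move=> z /(Jn z n) [w _ ->]; rewrite xn mul0r mulr0.
  have [k1 hk1] := stab Y iY YJ neY.
  have [k2|k2|k2 hk2] := minJ X iX XJ neX (fun k => [set z | exists2 w, K k w & z = x * w]).
  - split; last by move=> _ [w /KJ Jw ->]; exists w.
    split; first by exists 0; rewrite ?mulr0 //; apply: ideal0.
      move=> _ _ [v Jv ->] [w Jw ->]; exists (v + w); last by rewrite mulrDr.
      exact: idealD.
    by move=> a _ [w Jw ->]; exists (a * w); [apply: idealM|rewrite mulrCA].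
  - by move=> _ [w Kw ->]; exists w => //; case: (Klt k2) => + _; apply.
  exfalso; pose l := maxn k1 k2; have [_] := Klt l; apply=> z Kz.
  have : [set z | exists2 w, K l.+1 w & z = x * w] (x * z) by exists z.
  have e (f : nat -> set R) k : (forall l, (k <= l)%N -> f l = f k) ->
      (k <= l)%N -> f l.+1 = f l.
    by move=> h kl; rewrite h ?h //; apply: leqW.
  rewrite (e _ _ hk2 (leq_maxr _ _)) => -[w Kw xzw].
  have : (K l.+1 `&` Y) (z - w).
    split; first by apply: idealB => //; apply: Kmono Kw.
    split; last by rewrite mulrBr xzw subrr.
    by apply: (KJ l.+1); apply: idealB => //; apply: Kmono Kw.
  rewrite (e _ _ hk1 (leq_maxl _ _)) => -[Kzw _].
  by rewrite -(subrK w z); apply: idealD.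
have /choice [v vK] k : exists v, K k.+1 v /\ ~ K k v.
  case: (Klt k) => _ ns; apply: contrapT => nv; apply: ns => z Kz.
  by apply: contrapT => nKz; apply: nv; exists z.
(* [T k] is the span of [v 1], ..., [v k]. Leaving out [v 0] is what will make the union of the
   [T k] a proper subideal of J. *)
pose T := fix T k := if k is k'.+1
  then [set z | exists c, T k' (z - c * v k)] else [set (0 : R)].
have TS k z : T k.+1 z <-> exists c, T k (z - c * v k.+1) by [].
have iT k : is_ideal (T k).
  elim: k => [|k IH].
    by split=> // [x y -> ->|a x ->]; rewrite ?addr0 ?mulr0.
  split.
  - by exists 0; rewrite mul0r subr0; apply: ideal0.
  - move=> x y [c Tx] [d Ty]; exists (c + d).
    by rewrite mulrDl opprD addrACA; apply: idealD.
  - by move=> a x [c Tx]; exists (a * c); rewrite -mulrA -mulrBr; apply: idealM.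
have Tm k : T k `<=` T k.+1.
  by move=> z Tz; apply/TS; exists 0; rewrite mul0r subr0.
have Tmono k l : (k <= l)%N -> T k `<=` T l by apply: chain_mono.
have TK k : T k `<=` K k.+1.
  elim: k => [|k IH] z; first by move=> ->; apply: ideal0.
  move=> /TS [c Tz]; rewrite -(subrK (c * v k.+1) z); apply: idealD => //.
    by case: (Klt k.+1) => + _; apply; apply: IH.
  by apply: idealM => //; case: (vK k.+1).
(* The last coefficient c cannot be a unit, since [v k.+1] is not in [K k.+1]; so c kills [v k.+1]
   and the term drops out. *)
have TK0 k z : T k z -> K 1%N z -> z = 0.
  elim: k z => [|k IH] z; first by [].
  move=> /TS [c Tz] Kz.
  have Kc : K k.+1 (c * v k.+1).
    rewrite -(subKr z (c * v _)); apply: idealB => //; first exact: Kmono Kz.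
    exact: TK.
  have [[d dc]|nu] := pselect (exists d, d * c = 1).
    by case: (vK k.+1) => _ []; rewrite -(mul1r (v _)) -dc -mulrA; apply: idealM.
  apply: IH => //; move: Tz; rewrite killed ?subr0 //.
  by apply: KJ; case: (vK k.+1) => h _; exact: h.
pose TT := [set z | exists k, T k z].
have iTT : is_ideal TT.
  split; first by exists 0%N.
    move=> x y [k Tx] [l Ty]; exists (maxn k l); apply: idealD => //.
      by apply: Tmono Tx; apply: leq_maxl.
    by apply: Tmono Ty; apply: leq_maxr.
  by move=> a x [k Tx]; exists k; apply: idealM.
have [| |k hk] := stab TT iTT.
- by move=> z [k /TK]; apply: KJ.
- move=> eT; have [K1 K0] := vK 0%N.
  have [k Tk] : TT (v 0%N) by rewrite eT; apply: KJ K1.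
  by case: K0; rewrite (TK0 k (v 0%N) Tk K1); apply: ideal0.
have [vin nv] := vK k.+1.
have : (K k.+2 `&` TT) (v k.+1).
  split=> //; exists k.+1; apply/TS; exists 1.
  by rewrite mul1r subrr; apply: ideal0.
rewrite hk ?leqW // => -[Kv _]; apply: nv.
by apply: Kmono Kv.
Qed.

End Ideals.

(** * Hilbert's basis theorem *)

Section HilbertBasis.
Variable R : comNzRingType.
Implicit Types (S I J : set R).

Definition subring_set S : Prop :=
  [/\ S 0, S 1, forall x y, S x -> S y -> S (x - y)
    & forall x y, S x -> S y -> S (x * y)].

Definition submod_in S I : Prop :=
  [/\ I 0, forall x y, I x -> I y -> I (x - y),
      forall a x, S a -> I x -> I (a * x) & I `<=` S].

(** The values at t of the polynomials over S of degree less than n. Since t may satisfy relations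
    over S, such an expression is not unique; the proof of the basis theorem is run on the values
    themselves. *)
Fixpoint poly_lt S (t : R) (n : nat) : set R :=
  if n is n'.+1 then [set y | exists2 c, S c & poly_lt S t n' (y - c * t ^+ n')]
  else [set 0].

Definition adjoin S t : set R := [set y | exists n, poly_lt S t n y].

Section Adjoin.
Variables (S : set R) (t : R).
Hypothesis ringS : subring_set S.
Local Notation P := (poly_lt S t).

Lemma poly_lt0 n : P n 0.
Proof.
elim: n => // n IH; exists 0; first by case: ringS.
by rewrite mul0r subr0.
Qed.

Lemma poly_ltB n x y : P n x -> P n y -> P n (x - y).
Proof.
case: ringS => _ _ SB _; elim: n x y => [x y -> ->|n IH x y]; first by rewrite subr0.
move=> [c Sc Px] [d Sd Py]; exists (c - d); first exact: SB.
have -> : x - y - (c - d) * t ^+ n = (x - c * t ^+ n) - (y - d * t ^+ n) by ring.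
exact: IH.
Qed.

Lemma poly_ltM n a x : S a -> P n x -> P n (a * x).
Proof.
case: ringS => _ _ _ SM Sa; elim: n x => [x ->|n IH x]; first by rewrite mulr0.
move=> [c Sc Px]; exists (a * c); first exact: SM.
by rewrite -mulrA -mulrBr; apply: IH.
Qed.

Lemma poly_lt_mono m n : (m <= n)%N -> P m `<=` P n.
Proof.
apply: chain_mono => k y Py; exists 0; first by case: ringS.
by rewrite mul0r subr0.
Qed.

Lemma poly_lt_shift n x : P n x -> P n.+1 (t * x).
Proof.
elim: n x => [x ->|n IH x [c Sc Px]]; first by rewrite mulr0; apply: poly_lt0.
exists c => //.
have -> : t * x - c * t ^+ n.+1 = t * (x - c * t ^+ n) by rewrite exprS; ring.
exact: IH.
Qed.

Lemma poly_lt_monom n c : S c -> P n.+1 (c * t ^+ n).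
Proof. by move=> Sc; exists c; rewrite // subrr; apply: poly_lt0. Qed.

Lemma adjoin_sub : S `<=` adjoin S t.
Proof. by move=> x Sx; exists 1%N; rewrite -(mulr1 x) -(expr0 t); apply: poly_lt_monom. Qed.

Lemma adjoin_gen : adjoin S t t.
Proof.
exists 2%N; have := @poly_lt_monom 1 1; rewrite mul1r expr1; apply.
by case: ringS.
Qed.

Lemma adjoinB x y : adjoin S t x -> adjoin S t y -> adjoin S t (x - y).
Proof.
move=> [m Pm] [n Pn]; exists (maxn m n); apply: poly_ltB.
  by apply: poly_lt_mono Pm; apply: leq_maxl.
by apply: poly_lt_mono Pn; apply: leq_maxr.
Qed.

Lemma adjoin0 : adjoin S t 0.
Proof. by exists 0%N. Qed.

Lemma adjoin_mulXn n x : adjoin S t x -> adjoin S t (t ^+ n * x).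
Proof.
move=> ax; elim: n => [|n [m IH]]; first by rewrite expr0 mul1r.
by exists m.+1; rewrite exprS -mulrA; apply: poly_lt_shift.
Qed.

Lemma adjoinD x y : adjoin S t x -> adjoin S t y -> adjoin S t (x + y).
Proof.
move=> ax ay; rewrite -(opprK y); apply: adjoinB => //.
by rewrite -sub0r; apply: adjoinB => //; apply: adjoin0.
Qed.

Lemma adjoinM x y : adjoin S t x -> adjoin S t y -> adjoin S t (x * y).
Proof.
move=> [n Px] ay; elim: n x Px => [x ->|n IH x [c Sc Px]].
  by rewrite mul0r; apply: adjoin0.
rewrite -(subrK (c * t ^+ n) x) mulrDl; apply: adjoinD; first exact: IH.
rewrite -mulrA; have [m Pm] := adjoin_mulXn n ay.
by exists m; apply: poly_ltM.
Qed.

Lemma adjoin_ring : subring_set (adjoin S t).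
Proof.
split; [exact: adjoin0| |exact: adjoinB|exact: adjoinM].
by apply: adjoin_sub; case: ringS.
Qed.

(** The leading coefficients of I in degree n; one element of I may contribute several of them, as t
    may be algebraic over S. *)
Definition lead_coefs I n : set R :=
  [set c | S c /\ exists2 g, P n g & I (g + c * t ^+ n)].

Lemma lead_coefs_submod I n : submod_in (adjoin S t) I ->
  submod_in S (lead_coefs I n).
Proof.
case: ringS => S0 S1 SB SM [I0 IB IM IS]; split.
- by split=> //; exists 0; rewrite ?mul0r ?addr0 //; apply: poly_lt0.
- move=> c d [Sc [g Pg Ig]] [Sd [h Ph Ih]]; split; first exact: SB.
  exists (g - h); first exact: poly_ltB.
  have -> : g - h + (c - d) * t ^+ n = (g + c * t ^+ n) - (h + d * t ^+ n) by ring.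
  exact: IB.
- move=> a c Sa [Sc [g Pg Ig]]; split; first exact: SM.
  exists (a * g); first exact: poly_ltM.
  by rewrite -mulrA -mulrDr; apply: IM => //; apply: adjoin_sub.
- by move=> c [].
Qed.

Lemma lead_coefs_mono I n : submod_in (adjoin S t) I ->
  lead_coefs I n `<=` lead_coefs I n.+1.
Proof.
move=> [I0 IB IM IS] c [Sc [g Pg Ig]]; split=> //; exists (t * g).
  exact: poly_lt_shift.
have -> : t * g + c * t ^+ n.+1 = t * (g + c * t ^+ n) by rewrite exprS; ring.
by apply: IM => //; apply: adjoin_gen.
Qed.

Lemma lead_coefs_sub I J n : I `<=` J -> lead_coefs I n `<=` lead_coefs J n.
Proof. by move=> IJ c [Sc [g Pg Ig]]; split=> //; exists g => //; apply: IJ. Qed.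

(** Subtracting an element of I with the same leading coefficient lowers the degree of an element of
    J; induct on the degree. *)
Lemma lead_coefs_inj I J : submod_in (adjoin S t) I -> submod_in (adjoin S t) J ->
  I `<=` J -> (forall n, lead_coefs J n = lead_coefs I n) -> J = I.
Proof.
move=> [I0 IB IM IS] [J0 JB JM JS] IJ lJI; apply/seteqP; split=> //.
have ID x y : I x -> I y -> I (x + y).
  by move=> Ix Iy; rewrite -(opprK y); apply: (IB) => //; rewrite -sub0r; apply: (IB).
move=> y Jy; have [n Pn] := JS y Jy; elim: n y Pn Jy => [y -> _ //|n IH y [c Sc Pg]] Jy.
have : lead_coefs J n c by split=> //; exists (y - c * t ^+ n); rewrite ?subrK.
rewrite lJI => -[_ [h Ph Ih]]; rewrite -(subrK (h + c * t ^+ n) y).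
apply: ID => //; apply: IH; last by apply: JB => //; apply: IJ.
by rewrite opprD addrA addrAC; apply: poly_ltB.
Qed.

Lemma hilbert_basis : acc (submod_in S) -> acc (submod_in (adjoin S t)).
Proof.
move=> accS I subI monoI.
have Imono k l : (k <= l)%N -> I k `<=` I l by apply: chain_mono.
have Lmono k m n : (m <= n)%N -> lead_coefs (I k) m `<=` lead_coefs (I k) n.
  by apply: chain_mono => i; apply: lead_coefs_mono.
have Lm i j k l : (i <= j)%N -> (k <= l)%N ->
    lead_coefs (I i) k `<=` lead_coefs (I j) l.
  move=> ij kl; apply: subset_trans (Lmono j _ _ kl).
  by apply: lead_coefs_sub; apply: Imono.
(* The diagonal chain of leading coefficients settles at N, which fixes all pairs of indices beyond
   N. Only the finitely many degrees below N remain, and each of them stabilizes separately. *)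
have [k|k|N hN] := accS (fun n => lead_coefs (I n) n).
- exact: lead_coefs_submod.
- by apply: Lm.
have big i j : (N <= i)%N -> (N <= j)%N -> lead_coefs (I i) j = lead_coefs (I N) N.
  move=> Ni Nj; apply/seteqP; split; last exact: Lm.
  by rewrite -(hN (maxn i j)); [apply: Lm; lia|lia].
have /choice [s hs] n : exists k, forall l, (k <= l)%N ->
    lead_coefs (I l) n = lead_coefs (I k) n.
  by apply: accS => k; [apply: lead_coefs_submod|apply: Lm].
exists (maxn N (\max_(n < N) s n)) => l le.
apply: lead_coefs_inj => // [|n]; first exact: Imono.
case: (ltnP n N) => nN; last by rewrite !big //; lia.
have sn : (s n <= \max_(n < N) s n)%N by apply: (leq_bigmax (Ordinal nN)).
by rewrite !(hs n) //; lia.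
Qed.

End Adjoin.

(** Generation is expressed through all subrings containing S and the list, so that one generator at
    a time can be moved from the list into S. *)
Lemma noetherian_of_generators S (s : seq R) : subring_set S ->
  acc (submod_in S) -> 
  (forall T, subring_set T -> S `<=` T -> (forall x, x \in s -> T x) -> T = setT) ->
  acc (@is_ideal R).
Proof.
elim: s S => [|t s IH] S rS aS gen; last first.
  apply: (IH (adjoin S t)); [exact: adjoin_ring|exact: hilbert_basis|].
  move=> T rT ST sT; apply: gen => //; first by move=> y Sy; apply: ST; apply: adjoin_sub.
  move=> x; rewrite inE => /orP [/eqP ->|/sT //].
  by apply: ST; apply: adjoin_gen.
have eS := gen S rS (fun x h => h) (fun x => ltac:(by [])).
move=> I iI; apply: aS => k; split=> //.
- exact: ideal0.
- by move=> x y; apply: idealB.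
- by move=> a x _; apply: idealM.
- by rewrite eS.
Qed.

End HilbertBasis.

(** * Finitely generated algebras over an Artinian local ring are Noetherian *)

Section FinitelyGeneratedAlgebra.
Variables (A : comNzRingType) (B : comAlgType A) (k : nat) (x : 'I_k -> B).
Hypothesis gen : forall b, exists p : {mpoly A[k]}, b = mmap (in_alg B) x p.

Lemma generated_ind (T : set B) : (forall a, T (in_alg B a)) ->
  (forall y z, T y -> T z -> T (y + z)) -> (forall j y, T y -> T (x j * y)) ->
  forall b, T b.
Proof.
move=> TA TD TX b; have [p ->] := gen b; rewrite /mmap.
have T0 : T 0 by rewrite -(rmorph0 (in_alg B)); apply: TA.
apply: (big_ind T) => // m _; rewrite mulrC /mmap1.
apply: (big_rec (fun y => T (y * in_alg B p@_m))) => [|j y _ Ty].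
  by rewrite mul1r.
by elim: (m j) => [|e IH]; rewrite ?expr0 ?mul1r // exprS -!mulrA; apply: TX; rewrite mulrA.
Qed.

Lemma fg_algebra_noetherian : artinian_ring A -> local_ring A ->
  injective (in_alg B) -> acc (@is_ideal B).
Proof.
move=> art loc inj.
have accA := artinian_local_noetherian art loc.
apply: (@noetherian_of_generators B (range (in_alg B)) [seq x j | j <- enum 'I_k]).
- split; first by exists 0; rewrite ?rmorph0.
  + by exists 1; rewrite ?rmorph1.
  + by move=> _ _ [a _ <-] [b _ <-]; exists (a - b); rewrite ?rmorphB.
  + by move=> _ _ [a _ <-] [b _ <-]; exists (a * b); rewrite ?rmorphM.
- move=> I subI monoI.
  have [k'|k' a Ia|N hN] := accA (fun k => [set a | I k (in_alg B a)]).
  + have [I0 IB IM _] := subI k'; split; first by change (I k' (in_alg B 0)); rewrite rmorph0.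
      move=> a b Ia Ib; change (I k' (in_alg B (a + b))).
      rewrite -(opprK b) rmorphB; apply: (IB) => //.
      by rewrite rmorphN -sub0r; apply: (IB).
    move=> a b Ib; change (I k' (in_alg B (a * b))).
    by rewrite rmorphM; apply: IM => //; exists a.
  + exact: monoI.
  exists N => l Nl; apply/seteqP; split=> y Iy.
    have [_ _ _ /(_ y Iy) [a _ ya]] := subI l; rewrite -ya in Iy *.
    have : [set a | I l (in_alg B a)] a by [].
    by rewrite hN.
  have [_ _ _ /(_ y Iy) [a _ ya]] := subI N; rewrite -ya in Iy *.
  have : [set a | I N (in_alg B a)] a by [].
  by rewrite -(hN _ Nl).
- move=> T [T0 T1 TB TM] AT xT; apply/seteqP; split=> // b _.
  have TD y z : T y -> T z -> T (y + z).
    by move=> Ty Tz; rewrite -(opprK z); apply: (TB) => //; rewrite -sub0r; apply: (TB).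
  apply: generated_ind => //; first by move=> a; apply: AT; exists a.
  by move=> j y Ty; apply: TM => //; apply: xT; apply: map_f; rewrite mem_enum.
Qed.
End FinitelyGeneratedAlgebra.

(** * Graded rings and modules *)

Lemma big_seq_extend (I : eqType) (V : nmodType) (s t : seq I) (g : I -> V) :
  uniq s -> uniq t -> {subset s <= t} -> (forall i, i \notin s -> g i = 0) ->
  \sum_(i <- t) g i = \sum_(i <- s) g i.
Proof.
move=> us ut st g0; rewrite (bigID (mem s)) /= [X in _ + X]big1 ?addr0 => [|i /g0 //].
rewrite -big_filter; apply: perm_big; apply: uniq_perm => //.
  exact: filter_uniq.
by move=> i; rewrite mem_filter; case: (boolP (i \in s)) => // /st.
Qed.

Section DirectSum.
Variables (I : eqType) (V : zmodType) (G : I -> set V).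

Definition decomp (x : V) (g : I -> V) : Prop :=
  (forall i, G i (g i)) /\
  exists t, [/\ uniq t, forall i, i \notin t -> g i = 0 & x = \sum_(i <- t) g i].

Hypothesis dG : is_direct_sum G.

Lemma gr0 i : G i 0.
Proof. by case: dG => /(_ i) [/mem_predP]. Qed.
Lemma grB i x y : G i x -> G i y -> G i (x - y).
Proof.
case: dG => /(_ i) [_ h] _ _ /mem_predP Gx /mem_predP Gy.
by apply/mem_predP/h.
Qed.
Lemma grN i x : G i x -> G i (- x).
Proof. by move=> Gx; rewrite -sub0r; apply: grB => //; apply: gr0. Qed.
Lemma grD i x y : G i x -> G i y -> G i (x + y).
Proof. by move=> Gx Gy; rewrite -(opprK y); apply: grB => //; apply: grN. Qed.
Lemma grMn i x n : G i x -> G i (x *+ n).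
Proof.
move=> Gx; elim: n => [|n IH]; first by rewrite mulr0n; apply: gr0.
by rewrite mulrS; apply: grD.
Qed.

Lemma decomp_ex x : exists g, decomp x g.
Proof.
case: dG => _ /(_ x) [s [f [Gf ->]]] _.
(* [sum_of] admits lists with repetitions, and a repeated index contributes the same element each
   time; hence the multiplicity. *)
exists (fun i => f i *+ count_mem i s); split.
  move=> i; case: (boolP (i \in s)) => [/Gf Gi|/count_memPn ->]; first exact: grMn.
  by rewrite mulr0n; apply: gr0.
exists (undup s); split; first exact: undup_uniq.
  by move=> i; rewrite mem_undup => /count_memPn ->; rewrite mulr0n.
by rewrite -big_undup_iterop_count.
Qed.

Lemma decompD x y g h : decomp x g -> decomp y h ->
  decomp (x + y) (fun i => g i + h i).
Proof.
move=> [Gg [s [us g0 ->]]] [Gh [t [ut h0 ->]]]; split.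
  by move=> i; apply: grD.
exists (undup (s ++ t)); split; first exact: undup_uniq.
  move=> i; rewrite mem_undup mem_cat negb_or => /andP [/g0 -> /h0 ->].
  by rewrite addr0.
have uu := undup_uniq (s ++ t).
have su : {subset s <= undup (s ++ t)}.
  by move=> i it; rewrite mem_undup mem_cat it.
have tu : {subset t <= undup (s ++ t)}.
  by move=> i it; rewrite mem_undup mem_cat it orbT.
by rewrite big_split /= (big_seq_extend us uu su g0) (big_seq_extend ut uu tu h0).
Qed.

Lemma decomp0 g : decomp 0 g -> forall i, g i = 0.
Proof.
case: dG => _ _ ind [Gg [t [ut g0 /esym e]]] i.
case: (boolP (i \in t)) => [it|/g0 //].
exact: (ind t g ut (fun j _ => Gg j) e).
Qed.

Lemma decompN x g : decomp x g -> decomp (- x) (fun i => - g i).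
Proof.
move=> [Gg [s [us g0 ->]]]; split; first by move=> i; apply: grN.
by exists s; rewrite sumrN; split=> // i /g0 ->; rewrite oppr0.
Qed.

Lemma decomp_inj x g h : decomp x g -> decomp x h -> g = h.
Proof.
move=> dg /decompN dh; apply/funext => i.
have := decompD dg dh; rewrite subrr => /decomp0 /(_ i) /eqP.
by rewrite subr_eq0 => /eqP.
Qed.

Lemma decomp_hom i x : G i x -> decomp x (fun j => if j == i then x else 0).
Proof.
move=> Gx; split; first by move=> j; case: eqP => [->//|_]; apply: gr0.
exists [:: i]; split=> //; last by rewrite big_seq1 eqxx.
by move=> j; rewrite inE => /negPf ->.
Qed.
End DirectSum.

Definition proj (I : eqType) (V : zmodType) (G : I -> set V) (i : I) (x : V) : V :=
  xget 0 [set y | exists2 g, decomp G x g & y = g i].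

Section Projections.
Variables (I : eqType) (V : zmodType) (G : I -> set V).
Hypothesis dG : is_direct_sum G.
Local Notation pr := (proj G).

Lemma projE x g : decomp G x g -> forall i, pr i x = g i.
Proof.
move=> dg i; rewrite /proj; case: xgetP => [y _ [h dh ->]|/(_ (g i))].
  by rewrite (decomp_inj dG dh dg).
by case; exists g.
Qed.

Lemma decomp_proj x : decomp G x (fun i => pr i x).
Proof.
have [g dg] := decomp_ex dG x.
have -> : (fun i => pr i x) = g by apply/funext => i; apply: projE.
by [].
Qed.

Lemma proj_in i x : G i (pr i x).
Proof. by case: (decomp_proj x). Qed.

Lemma proj_sum x : exists2 s, uniq s & x = \sum_(i <- s) pr i x.
Proof. by case: (decomp_proj x) => _ [s [us _ e]]; exists s. Qed.

Lemma projD i x y : pr i (x + y) = pr i x + pr i y.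
Proof. exact: (projE (decompD dG (decomp_proj x) (decomp_proj y))). Qed.

Lemma projN i x : pr i (- x) = - pr i x.
Proof. exact: (projE (decompN dG (decomp_proj x))). Qed.

Lemma projB i x y : pr i (x - y) = pr i x - pr i y.
Proof. by rewrite projD projN. Qed.

Lemma proj0 i : pr i 0 = 0.
Proof. by rewrite -[X in pr i X](subrr 0) projB subrr. Qed.

Lemma proj_sumr i (T : Type) (s : seq T) (P : pred T) (f : T -> V) :
  pr i (\sum_(j <- s | P j) f j) = \sum_(j <- s | P j) pr i (f j).
Proof.
elim/big_rec2: _ => [|j y z _ <-]; first exact: proj0.
by rewrite projD.
Qed.

Lemma proj_hom i j x : G i x -> pr j x = if j == i then x else 0.
Proof. by move=> Gx; rewrite (projE (decomp_hom dG Gx)). Qed.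

Lemma proj_id i x : G i x -> pr i x = x.
Proof. by move=> Gx; rewrite (proj_hom _ Gx) eqxx. Qed.

Lemma proj_ext x y : (forall i, pr i x = pr i y) -> x = y.
Proof.
move=> h; apply/eqP; rewrite -subr_eq0; apply/eqP.
have [s _ ->] := proj_sum (x - y).
by rewrite big1 // => i _; rewrite projB h subrr.
Qed.

Lemma proj_supp x : exists2 s, uniq s & forall i, pr i x != 0 -> i \in s.
Proof.
case: (decomp_proj x) => _ [s [us h _]]; exists s => // i.
by apply: contraR => /h ->.
Qed.
End Projections.

Section Graded.
Variables (r : nat) (A : comNzRingType) (B : comAlgType A).
Variable Bg : 'X_{1..r} -> set B.
Local Notation T := 'rV[int]_r.

Definition of_Zr (nu : T) : 'X_{1..r} := [multinom `|nu 0%R i|%N | i < r].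

Lemma to_ZrK : cancel (@to_Zr r) of_Zr.
Proof. by move=> n; apply/mnmP => i; rewrite mnmE mxE absz_nat. Qed.

Lemma to_ZrD m n : to_Zr (m + n)%MM = to_Zr m + to_Zr n :> T.
Proof. by apply/rowP => i; rewrite !mxE mnmDE PoszD. Qed.

Lemma to_Zr0 : to_Zr 0%MM = 0 :> T.
Proof. by apply/rowP => i; rewrite !mxE mnm0E. Qed.

Lemma of_ZrK (nu : T) : (forall i, 0 <= nu 0 i) -> to_Zr (of_Zr nu) = nu.
Proof. by move=> h; apply/rowP => i; rewrite mxE mnmE gez0_abs. Qed.

Definition nonneg (nu : T) : bool := [forall i, 0 <= nu 0%R i].

(* B graded by Z^r, so that B is a graded module over itself. *)
Definition BZ (nu : T) : set B :=
  [set b | b = 0 \/ exists2 n, nu = to_Zr n & Bg n b].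

Lemma BZ_to n b : Bg n b -> BZ (to_Zr n) b.
Proof. by right; exists n. Qed.

Lemma BZ_neg (nu : T) b : ~~ nonneg nu -> BZ nu b -> b = 0.
Proof.
move=> neg [//|[n e _]]; case/negP: neg; apply/forallP => i.
by rewrite e mxE.
Qed.

Hypothesis B_graded : graded_algebra Bg.
Let dB : is_direct_sum Bg. Proof. by case: B_graded. Qed.

Lemma BZ_of n b : BZ (to_Zr n) b -> Bg n b.
Proof.
case=> [->|[m /(can_inj to_ZrK) -> //]]; exact: (gr0 dB).
Qed.

Lemma decomp_BZ x g : decomp Bg x g ->
  decomp BZ x (fun nu => if to_Zr (of_Zr nu) == nu then g (of_Zr nu) else 0).
Proof.
move=> [Gg [t [ut g0 ->]]]; split.
  move=> nu; case: eqP => [<-|_]; last by left.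
  by rewrite to_ZrK; apply: BZ_to.
exists (map (@to_Zr r) t); split.
- by rewrite map_inj_uniq //; apply: can_inj to_ZrK.
- move=> nu nt; case: eqP => // e; apply: g0; apply: contra nt => h.
  by rewrite -e; apply: map_f.
- by rewrite big_map; apply: eq_bigr => i _; rewrite to_ZrK eqxx.
Qed.

Lemma BZ_direct : is_direct_sum BZ.
Proof.
split.
- move=> nu; split; first by apply/mem_predP; left.
  move=> x y /mem_predP Bx /mem_predP By; apply/mem_predP.
  case: Bx By => [->|[n e Bx]].
    case=> [->|[n -> Bx]]; first by left; rewrite subr0.
    by right; exists n => //; rewrite sub0r; apply: (grN dB).
  case=> [->|[m e' By]]; first by rewrite subr0; right; exists n.
  right; exists n => //; apply: (grB dB) => //.
  by move: e' By; rewrite e => /(can_inj to_ZrK) ->.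
- move=> x; have [g /decomp_BZ [Gg [t [_ _ e]]]] := decomp_ex dB x.
  exists t; eexists; split; last exact: e.
  by move=> i _; apply: Gg.
- case: (dB) => _ _ ind s f us Gf fs nu nus.
  case: (boolP (nonneg nu)) => [pos|neg]; last first.
    exact: BZ_neg neg (Gf nu nus).
  have ek (mu : T) : nonneg mu -> to_Zr (of_Zr mu) = mu.
    by move/forallP => h; apply: of_ZrK.
  rewrite -(ek _ pos).
  pose s' := [seq mu <- s | nonneg mu].
  apply: (ind (map of_Zr s') (fun n => f (to_Zr n))).
  + rewrite map_inj_in_uniq ?filter_uniq // => x y.
    rewrite !mem_filter => /andP [px _] /andP [py _] e.
    by rewrite -(ek _ px) -(ek _ py) e.
  + move=> n /mapP [mu]; rewrite mem_filter => /andP [p ms] ->.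
    by apply: BZ_of; rewrite (ek _ p); apply: Gf.
  + rewrite big_map big_filter -[RHS]fs [RHS](bigID nonneg) /=.
    rewrite [X in _ + X]big_seq_cond [X in _ + X]big1 ?addr0.
      by apply: eq_bigr => mu /ek ->.
    by move=> mu /andP [ms neg]; apply: BZ_neg neg (Gf _ ms).
  + by apply: map_f; rewrite mem_filter pos.
Qed.

Lemma proj_BZ n b : proj BZ (to_Zr n) b = proj Bg n b.
Proof.
by rewrite (projE BZ_direct (decomp_BZ (decomp_proj dB b))) to_ZrK eqxx.
Qed.

Definition gmod (M : lmodType B) (Mg : T -> set M) : Prop :=
  is_direct_sum Mg /\
  forall mu nu b m, BZ mu b -> Mg nu m -> Mg (mu + nu) (b *: m).

Lemma graded_module_gmod (M : lmodType B) (Mg : T -> set M) :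
  graded_module Bg Mg -> gmod Mg.
Proof.
move=> [dM MM]; split=> // mu nu b m [->|[n -> Bb]] Mm; last exact: MM.
by rewrite scale0r; apply: (gr0 dM).
Qed.

Lemma BZ_gmod : @gmod B^o BZ.
Proof.
split; first exact: BZ_direct.
move=> mu nu b m [->|[n -> Bb]]; first by rewrite scale0r; left.
move=> [->|[k -> Bm]]; first by rewrite scaler0; left.
by right; exists (n + k)%MM; rewrite ?to_ZrD //; case: B_graded => _; apply.
Qed.

Section Module.
Variables (M : lmodType B) (Mg : T -> set M).
Hypothesis gM : gmod Mg.
Let dM : is_direct_sum Mg. Proof. by case: gM. Qed.

Lemma projZl mu nu b m : BZ mu b ->
  proj Mg nu (b *: m) = b *: proj Mg (nu - mu) m.
Proof.
move=> Bb; rewrite (projE dM (g := fun nu => b *: proj Mg (nu - mu) m)) //.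
have [Gg [t [ut g0 e]]] := decomp_proj dM m; split.
  move=> i; rewrite -{1}(subrKC mu i); case: gM => _; apply=> //.
exists (map (+%R mu) t); split.
- by rewrite map_inj_uniq //; apply: addrI.
- move=> i it; rewrite g0 ?scaler0 //; apply: contra it => h.
  by rewrite -(subrKC mu i); apply: map_f.
- rewrite big_map {1}e scaler_sumr; apply: eq_bigr => i _.
  by rewrite (addrC mu) addrK.
Qed.

Lemma projZr a nu b m : Mg a m ->
  proj Mg nu (b *: m) = (proj BZ (nu - a) b : B) *: m.
Proof.
move=> Mm; rewrite (projE dM (g := fun nu => (proj BZ (nu - a) b : B) *: m)) //.
have [Gg [t [ut g0 e]]] := decomp_proj BZ_direct b; split.
  move=> i; rewrite -{1}(subrK a i); case: gM => _; apply=> //.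
exists (map (+%R^~ a) t); split.
- by rewrite map_inj_uniq //; apply: addIr.
- move=> i it; rewrite g0 ?scale0r //; apply: contra it => h.
  by rewrite -(subrK a i); apply: map_f.
- rewrite big_map {1}e scaler_suml; apply: eq_bigr => i _.
  by rewrite addrK.
Qed.

Definition hsub (U : set M) : Prop :=
  [/\ U 0, forall x y, U x -> U y -> U (x + y), forall b x, U x -> U (b *: x)
    & forall nu x, U x -> U (proj Mg nu x)].

(** [adj U m] is U + B m and [colon U m] is the ideal (U : m). For m of degree a, the quotient (U +
    B m)/U is B/(U : m) shifted by a. *)
Definition adj (U : set M) (m : M) : set M := [set x | exists b, U (x - b *: m)].
Definition colon (U : set M) (m : M) : set B := [set b | U (b *: m)].

Section Sub.
Variable U : set M.
Hypothesis hU : hsub U.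

Lemma hsub0 : U 0. Proof. by case: hU. Qed.
Lemma hsubD x y : U x -> U y -> U (x + y). Proof. by case: hU => _ h _ _; apply: h. Qed.
Lemma hsubZ b x : U x -> U (b *: x). Proof. by case: hU => _ _ h _; apply: h. Qed.
Lemma hsub_proj nu x : U x -> U (proj Mg nu x). Proof. by case: hU => _ _ _; apply. Qed.
Lemma hsubN x : U x -> U (- x). Proof. by move=> Ux; rewrite -scaleN1r; apply: hsubZ. Qed.
Lemma hsubB x y : U x -> U y -> U (x - y).
Proof. by move=> Ux Uy; apply: hsubD => //; apply: hsubN. Qed.
Lemma hsub_Asub : A_submodule U.
Proof. by split; [apply: hsub0|apply: hsubD|move=> a x; apply: hsubZ]. Qed.

Lemma adj_sub m : U `<=` adj U m.
Proof. by move=> x Ux; exists 0; rewrite scale0r subr0. Qed.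

Lemma adj_gen m b : adj U m (b *: m).
Proof. by exists b; rewrite subrr; apply: hsub0. Qed.

Lemma hsub_adj a m : Mg a m -> hsub (adj U m).
Proof.
move=> Mm; split.
- by apply: adj_sub; apply: hsub0.
- move=> x y [b Ux] [c Uy]; exists (b + c).
  by rewrite scalerDl opprD addrACA; apply: hsubD.
- move=> b x [c Ux]; exists (b * c).
  by rewrite -scalerA -scalerBr; apply: hsubZ.
- move=> nu x [b Ux]; exists (proj BZ (nu - a) b).
  by rewrite -projZr // -(projB dM); apply: hsub_proj.
Qed.
End Sub.
End Module.

Lemma hsub_colon (M : lmodType B) (Mg : T -> set M) (U : set M) a m :
  gmod Mg -> hsub Mg U -> Mg a m -> @hsub B^o BZ (colon U m).
Proof.
move=> gM hU Mm; split; rewrite /colon /=.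
- by rewrite scale0r; apply: (hsub0 hU).
- by move=> b c Ub Uc; rewrite scalerDl; apply: (hsubD hU).
- by move=> b c Uc; rewrite -scalerA; apply: (hsubZ hU).
- move=> nu b Ub; have := hsub_proj hU (nu + a) Ub.
  by rewrite (projZr gM _ _ Mm) addrK.
Qed.

Definition hideal (I : set B) : Prop := @hsub B^o BZ I.

Lemma hideal_ideal I : hideal I -> is_ideal I.
Proof. by case=> I0 ID IM _; split. Qed.

Lemma hideal_sumE I b : hideal I -> (forall nu, I (proj BZ nu b)) -> I b.
Proof.
move=> hI h; have [s _ ->] := proj_sum BZ_direct b.
by apply: ideal_sum => //; apply: hideal_ideal.
Qed.

Lemma seq_has_max (d : Order.disp_t) (O : orderType d) (P : O -> Prop) (s : seq O) :
  (exists2 x, x \in s & P x) ->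
  exists2 m, m \in s /\ P m & forall y, y \in s -> P y -> (y <= m)%O.
Proof.
elim: s => [[x]//|x s IH] [y ys Py].
have [[z zs Pz]|ns] := pselect (exists2 z, z \in s & P z); last first.
  have yx z : z \in x :: s -> P z -> z = x.
    by rewrite inE => /orP [/eqP //|zs Pz]; case: ns; exists z.
  have e := yx y ys Py; rewrite e in Py.
  exists x; first by rewrite mem_head.
  by move=> z /yx h /h ->.
have [|m [ms Pm] mmax] := IH; first by exists z.
have [xm|mx] := leP x m.
  exists m; first by rewrite inE ms orbT.
  by move=> t; rewrite inE => /orP [/eqP ->//|]; apply: mmax.
have [Px|nPx] := pselect (P x).
  exists x; first by rewrite mem_head.
  move=> t; rewrite inE => /orP [/eqP ->//|ts Pt].
  by apply: le_trans (ltW mx); apply: mmax.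
exists m; first by rewrite inE ms orbT.
by move=> t; rewrite inE => /orP [/eqP ->//|]; apply: mmax.
Qed.

Lemma ideal_sum_term (R : comNzRingType) (I : set R) (K : eqType) (s : seq K)
    (f : K -> R) (i : K) : is_ideal I -> uniq s -> i \in s ->
  (forall j, j != i -> I (f j)) -> I (\sum_(j <- s) f j) -> I (f i).
Proof.
move=> iI us si fI; rewrite (bigD1_seq i) //= => H.
rewrite -(addrK (\sum_(j <- s | j != i) f j) (f i)); apply: idealB => //.
exact: ideal_sum.
Qed.

(** The monomial order is total and compatible with addition. Take the largest degrees a and b in
    which x and y have components outside I. In degree a + b every other product of components of x
    and y lies in I, hence so does the product of these two. *)
Lemma hideal_prime I : hideal I -> ~ I 1 ->
  (forall mu nu a b, BZ mu a -> BZ nu b -> I (a * b) -> I a \/ I b) ->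
  prime_ideal I.
Proof.
move=> hI I1 IM; have iI := hideal_ideal hI; apply/prime_idealP; split=> // x y Ixy.
apply: contrapT => /not_orP [nx ny].
have top z : ~ I z -> exists2 a, ~ I (proj Bg a z) &
    forall c, (a < c)%O -> I (proj Bg c z).
  move=> nz; have [s us supp] := proj_supp dB z.
  have [|m [ms nm] mmax] := @seq_has_max _ _ (fun n => ~ I (proj Bg n z)) s.
    apply: contrapT => nex; apply: nz; have [t _ ->] := proj_sum dB z.
    apply: ideal_sum => // i _; apply: contrapT => nI; apply: nex; exists i => //.
    by apply: supp; apply/eqP => e; apply: nI; rewrite e; apply: ideal0.
  exists m => // c mc; apply: contrapT => nc.
  have cs : c \in s.
    by apply: supp; apply/eqP => e; apply: nc; rewrite e; apply: ideal0.
  by have := mmax c cs nc; rewrite leNgt mc.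
have [a na amax] := top x nx; have [b nb bmax] := top y ny.
case: (IM _ _ _ _ (BZ_to (proj_in dB a x)) (BZ_to (proj_in dB b y)) _) => //.
have [_ [s [us s0 xs]]] := decomp_proj dB x.
have [_ [t [ut t0 yt]]] := decomp_proj dB y.
have as_ : a \in s by apply: contraT => /s0 e; case: na; rewrite e; apply: ideal0.
have bt : b \in t by apply: contraT => /t0 e; case: nb; rewrite e; apply: ideal0.
have := hsub_proj hI (to_Zr (a + b)%MM) Ixy.
rewrite proj_BZ {1}xs mulr_suml (proj_sumr dB) => H.
have Bxy i j : Bg (i + j)%MM (proj Bg i x * proj Bg j y).
  by case: B_graded => _; apply; apply: (proj_in dB).
have Ia : I (proj Bg (a + b)%MM (proj Bg a x * y)).
  apply: (ideal_sum_term iI us as_ _ H) => i ia.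
  rewrite {1}yt mulr_sumr (proj_sumr dB); apply: ideal_sum => // j _.
  rewrite (proj_hom dB _ (Bxy i j)); case: eqP => [e|_]; last exact: ideal0.
  have [ai|] := ltP a i; first by apply: idealMr => //; apply: amax.
  move=> ia'; have {ia ia'}ia : (i < a)%O by rewrite lt_neqAle ia ia'.
  have [bj|jb] := ltP b j; first by apply: idealM => //; apply: bmax.
  by have := ltmc_le_add ia jb; rewrite e ltxx.
rewrite {1}yt mulr_sumr (proj_sumr dB) in Ia.
rewrite -(proj_id dB (Bxy a b)); apply: (ideal_sum_term iI ut bt _ Ia) => j jb.
rewrite (proj_hom dB _ (Bxy a j)); case: eqP => [|_]; last exact: ideal0.
by move/eqP; rewrite eqm_add2l eq_sym (negPf jb).
Qed.
End Graded.

(** * Prime filtrations *)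

Section Filtration.
Variables (r : nat) (A : comNzRingType) (B : comAlgType A).
Variable Bg : 'X_{1..r} -> set B.
Local Notation T := 'rV[int]_r.
Local Notation BZ := (BZ Bg).
Hypothesis B_graded : graded_algebra Bg.
Let dB := BZ_direct B_graded.

Lemma BZ_in_alg : Bg 0%MM = range (in_alg B) -> forall a : A, BZ 0 (a%:A : B).
Proof.
by move=> B0 a; rewrite -(to_Zr0 r); apply: BZ_to; rewrite B0; exists a.
Qed.

(* A filtration of V over U with successive quotients (B/p)(-a), for the pairs
   (p, a) in the list, p prime. *)
Inductive pfilt (M : lmodType B) (Mg : T -> set M) (U : set M) :
    set M -> seq (set B * T) -> Prop :=
| pfilt_nil : pfilt Mg U U [::]
| pfilt_cons V L m a : pfilt Mg U V L -> Mg a m -> prime_ideal (colon V m) ->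
    pfilt Mg U (adj V m) ((colon V m, a) :: L).

(** The elements x with N^k x contained in U. Peeling off one factor at a time suits induction;
    [ideal_pow_torsion] makes the link with powers of the ideal. *)
Fixpoint torsion (M : lmodType B) (N : set B) (U : set M) (k : nat) : set M :=
  if k is k'.+1 then [set x | forall y, N y -> torsion N U k' (y *: x)] else U.

Section Module.
Variables (M : lmodType B) (Mg : T -> set M).
Hypothesis gM : gmod Bg Mg.

Lemma pfilt_hsub U V L : pfilt Mg U V L -> hsub Mg U -> hsub Mg V.
Proof.
move=> h hU; elim: h => // V' L' m a _ hV Mm _.
exact: (hsub_adj B_graded gM hV Mm).
Qed.

Lemma pfilt_sub U V L : pfilt Mg U V L -> U `<=` V.
Proof. by elim=> // V' L' m a _ UV _ _; apply: subset_trans UV (adj_sub _). Qed.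

Lemma pfilt_trans U V W L L' : pfilt Mg U V L -> pfilt Mg V W L' ->
  pfilt Mg U W (L' ++ L).
Proof. by move=> UV; elim=> //= W' K m a _ IH Mm pm; apply: pfilt_cons. Qed.

End Module.

Section Lift.
Variables (M : lmodType B) (Mg : T -> set M).
Hypothesis gM : gmod Bg Mg.
Let gB := BZ_gmod B_graded.

Definition lift (U : set M) (m : M) (J : set B) : set M :=
  [set x | exists2 b, J b & U (x - b *: m)].

(** The isomorphism from B/(U : m), shifted by a, to (U + B m)/U carries one filtration to the
    other: the ideal J goes to U + J m. *)
Lemma pfilt_lift U m a (J : set B) L : hsub Mg U -> Mg a m ->
  @pfilt B^o BZ (colon U m) J L ->
  pfilt Mg U (lift U m J) [seq (x.1, x.2 + a) | x <- L].
Proof.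
move=> hU Mm; elim=> [|V K c a' pV IH Bc pr] /=.
  have -> : lift U m (colon U m) = U; last exact: pfilt_nil.
  apply/seteqP; split=> x; last first.
    by move=> Ux; exists 0; rewrite /colon /= ?scale0r ?subr0 //; apply: hsub0 hU.
  move=> [b Ub Ux]; rewrite -(subrK (b *: m) x); exact: (hsubD hU).
have hI : hideal Bg (colon U m) := hsub_colon B_graded gM hU Mm.
have hV : hideal Bg V := pfilt_hsub gB pV hI.
have IV : colon U m `<=` V := pfilt_sub pV.
have -> : lift U m (adj V c) = adj (lift U m V) (c *: m).
  apply/seteqP; split=> x.
    move=> [b [b' Vb] Ux]; exists b'; exists (b - b' * c); first exact: Vb.
    by rewrite scalerBl scalerA opprB addrA subrK.
  move=> [b' [b Vb Ux]]; exists (b + b' * c).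
    by exists b'; rewrite /GRing.scale /= addrK.
  by rewrite scalerDl -scalerA opprD addrA addrAC.
(* The isomorphism preserves annihilators, because V contains (U : m); so the same prime appears in
   the new list. *)
have ec : colon V c = colon (lift U m V) (c *: m).
  apply/seteqP; split=> b.
    by move=> Vb; exists (b * c); rewrite ?scalerA ?subrr //; apply: hsub0 hU.
  move=> [b'' Vb'' h]; rewrite /colon /=.
  rewrite -(subrK (b'' : B^o) (b *: c)); apply: (hsubD hV) => //; apply: IV.
  by move: h; rewrite scalerA -scalerBl.
rewrite ec; apply: pfilt_cons => //; last by rewrite -ec.
by case: gM => _; apply.
Qed.
End Lift.

Hypothesis accB : acc (@is_ideal B).
Let gB := BZ_gmod B_graded.

Lemma hideal_ind (Q : set B -> Prop) :
  (forall I, hideal Bg I -> (forall J, hideal Bg J -> I `<` J -> Q J) -> Q I) ->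
  forall I, hideal Bg I -> Q I.
Proof.
move=> step; apply: (@acc_ind _ (hideal Bg) Q) => // I hI Isub.
by apply: accB => // k; apply: (hideal_ideal (hI k)).
Qed.

Hypothesis B_one : BZ 0 1.

(** If I is proper and not prime, there are homogeneous a and b outside I with a b in I. Then I + B
    a and (I : a) are both strictly larger than I, and B/I is an extension of B/(I + B a) by a shift
    of B/(I : a). *)
Lemma pfilt_ideal_ex I : hideal Bg I -> exists L, @pfilt B^o BZ I setT L.
Proof.
move: I; apply: hideal_ind => I hI IH; have iI := hideal_ideal hI.
have [I1|I1] := pselect (I 1).
  have -> : I = setT.
    by apply/seteqP; split=> // x _; rewrite -(mulr1 x); apply: idealM.
  by exists [::]; apply: pfilt_nil.
have [pI|npI] := pselect (prime_ideal I).
  have eI : @colon A B B^o I 1 = I.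
    by apply/seteqP; split=> x; rewrite /colon /= /GRing.scale /= mulr1.
  have -> : setT = @adj A B B^o I 1.
    apply/seteqP; split=> // x _; exists x.
    by rewrite /GRing.scale /= mulr1 subrr; apply: ideal0.
  exists [:: (@colon A B B^o I 1, 0)]; apply: pfilt_cons => //; first exact: pfilt_nil.
  by rewrite eI.
have [mu [nu [a [b [Ba Bb Iab nIa nIb]]]]] : exists mu nu a b,
    [/\ BZ mu a, BZ nu b, I (a * b), ~ I a & ~ I b].
  apply: contrapT => nex; apply: npI; apply: (hideal_prime B_graded) => //.
  move=> mu nu a b Ba Bb Iab; apply: contrapT => /not_orP [nIa nIb].
  by apply: nex; exists mu, nu, a, b.
have hadj : hideal Bg (@adj A B B^o I a) := hsub_adj B_graded gB hI Ba.
have hcol : hideal Bg (@colon A B B^o I a) := hsub_colon B_graded gB hI Ba.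
have [|L1 p1] := IH _ hcol.
  split; first by move=> x Ix; apply: idealMr.
  by move=> sub; apply: nIb; apply: sub; change (I (b * a)); rewrite mulrC.
have [|L2 p2] := IH _ hadj.
  split; first by move=> x Ix; exists 0; change (I (x - 0 * a)); rewrite mul0r subr0.
  move=> sub; apply: nIa; apply: sub; exists 1; change (I (a - 1 * a)).
  by rewrite mul1r subrr; apply: ideal0.
have := pfilt_lift gB hI Ba p1.
have -> : @lift B^o I a setT = @adj A B B^o I a.
  by apply/seteqP; split=> x [y]; [exists y|exists y].
by move=> p3; exists (L2 ++ [seq (x.1, x.2 + mu) | x <- L1]); apply: pfilt_trans p3 p2.
Qed.

Section Existence.
Variables (M : lmodType B) (Mg : T -> set M).
Hypothesis gM : gmod Bg Mg.
Let dM : is_direct_sum Mg. Proof. by case: gM. Qed.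

Lemma pfilt_adj_ex U m a : hsub Mg U -> Mg a m ->
  exists L, pfilt Mg U (adj U m) L.
Proof.
move=> hU Mm; have [L pL] := pfilt_ideal_ex (hsub_colon B_graded gM hU Mm).
exists [seq (x.1, x.2 + a) | x <- L]; have := pfilt_lift gM hU Mm pL.
have -> // : lift U m setT = adj U m.
by apply/seteqP; split=> x [y]; [exists y|exists y].
Qed.

Lemma pfilt_gen_ex U (s : seq M) : hsub Mg U ->
  (forall x, x \in s -> exists a, Mg a x) ->
  exists V L, pfilt Mg U V L /\ forall x, x \in s -> V x.
Proof.
move=> hU; elim: s => [|x s IH] hs.
  by exists U, [::]; split=> //; apply: pfilt_nil.
have [|V [L [pV Vs]]] := IH; first by move=> y ys; apply: hs; rewrite inE ys orbT.
have [a Mx] := hs x (mem_head _ _).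
have [L' pL'] := pfilt_adj_ex (pfilt_hsub gM pV hU) Mx.
exists (adj V x), (L' ++ L); split; first exact: pfilt_trans pV pL'.
move=> y; rewrite inE => /orP [/eqP ->|/Vs]; last exact: adj_sub.
by have := adj_gen (pfilt_hsub gM pV hU) x 1; rewrite scale1r.
Qed.

Lemma hsub_zero : hsub Mg [set 0].
Proof.
split=> // [x y -> ->|b x ->|nu x ->]; rewrite ?addr0 ?scaler0 //.
exact: (proj0 dM).
Qed.

Lemma pfilt_module_ex : finitely_generated M ->
  exists L, pfilt Mg [set 0] setT L.
Proof.
move=> [k [g gen]].
have /choice [t ht] j : exists t : seq T, g j = \sum_(i <- t) proj Mg i (g j).
  by have [t _ e] := proj_sum dM (g j); exists t.
pose s := flatten [seq [seq proj Mg i (g j) | i <- t j] | j <- enum 'I_k].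
have [|V [L [pV Vs]]] := @pfilt_gen_ex [set 0] s hsub_zero.
  move=> x /flattenP [_ /mapP [j _ ->]] /mapP [i _ ->].
  by exists i; apply: (proj_in dM).
exists L; have -> // : setT = V.
have hV := pfilt_hsub gM pV hsub_zero.
have Vsum (K : eqType) (u : seq K) (f : K -> M) :
    (forall i, i \in u -> V (f i)) -> V (\sum_(i <- u) f i).
  move=> h; rewrite big_seq_cond; elim/big_ind: _ => [|x y|i /andP [/h]//].
    exact: hsub0 hV.
  exact: hsubD hV x y.
apply/seteqP; split=> // m _; have [c ->] := gen m.
apply: (Vsum) => j _; apply: (hsubZ hV); rewrite (ht j).
apply: Vsum => i it; apply: Vs; apply/flattenP.
exists [seq proj Mg i (g j) | i <- t j]; first by apply: map_f; rewrite mem_enum.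
exact: map_f.
Qed.
End Existence.

Section Properties.
Variables (M : lmodType B) (Mg : T -> set M).
Hypothesis gM : gmod Bg Mg.
Let dM : is_direct_sum Mg. Proof. by case: gM. Qed.

(** A factor B/p with p not inside q is killed by some element outside q, and s is the product of
    such elements; every other factor is killed by N, and c counts these. With N the whole ring this
    says that the localization at q vanishes, and with N the irrelevant ideal that it is torsion. *)
Lemma pfilt_annihilator N U V L q : hsub Mg U -> pfilt Mg U V L -> prime_ideal q ->
  (forall p a, List.In (p, a) L -> ~ (p `<=` q) \/ N `<=` p) ->
  exists s c, ~ q s /\ forall x, V x -> torsion N U c (s *: x).
Proof.
move=> hU; elim=> [pq _|V' K m a pV IH Mm pr pq h].
  by exists 1, 0%N; split; [apply: prime_not1|move=> x Ux; rewrite scale1r].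
have [|s [c [qs hs]]] := IH pq; first by move=> p b pb; apply: (h p b); right.
have hV := pfilt_hsub gM pV hU.
case: (h _ a (or_introl erefl)) => [npq|Np].
  have [s' ps' qs'] : exists2 s', colon V' m s' & ~ q s'.
    apply: contrapT => nex; apply: npq => y py; apply: contrapT => qy.
    by apply: nex; exists y.
  exists (s * s'), c; split; first by move=> /(primeM pq) [].
  move=> x [b Vx]; rewrite -scalerA; apply: hs.
  rewrite -(subrK (b *: m) x) scalerDr; apply: (hsubD hV); first exact: (hsubZ hV).
  by rewrite scalerA mulrC -scalerA; apply: (hsubZ hV).
exists s, c.+1; split=> // x [b Vx] y Ny.
rewrite scalerA mulrC -scalerA; apply: hs.
rewrite -(subrK (b *: m) x) scalerDr; apply: (hsubD hV); first exact: (hsubZ hV).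
by rewrite scalerA mulrC -scalerA; apply: (hsubZ hV); apply: Np.
Qed.

Lemma pfilt_prime U V L p a : hsub Mg U -> pfilt Mg U V L -> List.In (p, a) L ->
  [/\ prime_ideal p, hideal Bg p &
     exists m, [/\ V m, Mg a m & forall s, U (s *: m) -> p s]].
Proof.
move=> hU; elim=> // V' K m b pV IH Mm pr /= [[<- <-]|/IH [? ? [x [Vx Mx xs]]]].
  have hV := pfilt_hsub gM pV hU.
  split=> //; first exact: (hsub_colon B_graded gM hV Mm).
  exists m; split=> //; first by have := adj_gen hV m 1; rewrite scale1r.
  by move=> s Us; apply: (pfilt_sub pV).
by split=> //; exists x; split=> //; apply: adj_sub.
Qed.

(** At the step of the filtration where x enters, x is congruent to b m modulo the previous
    submodule, so whatever sends x into U sends b into the prime of that step. *)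
Lemma pfilt_homog U V L x nu : hsub Mg U -> pfilt Mg U V L ->
  Mg nu x -> V x -> ~ U x ->
  exists p a b, [/\ List.In (p, a) L, BZ (nu - a) b, ~ p b &
    forall s, U (s *: x) -> p (s * b)].
Proof.
move=> hU; elim=> [//|V' K m a pV IH Mm pr Mx [b Vx] nUx].
have hV := pfilt_hsub gM pV hU.
have [V'x|nV'x] := pselect (V' x).
  have [p [a' [b' [inL Bb' pb' h]]]] := IH Mx V'x nUx.
  by exists p, a', b'; split=> //; right.
have Vx' : V' (x - (proj BZ (nu - a) b : B) *: m).
  rewrite -(projZr B_graded gM _ _ Mm) -{1}(proj_id dM Mx) -(projB dM).
  exact: (hsub_proj hV).
exists (colon V' m), a, (proj BZ (nu - a) b); split.
- by left.
- exact: (proj_in dB).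
- move=> h; apply: nV'x; rewrite -(subrK ((proj BZ (nu - a) b : B) *: m) x).
  exact: (hsubD hV).
- move=> s Us; rewrite /colon /= -scalerA.
  have := hsubZ hV s Vx'; rewrite scalerBr => h.
  rewrite -(subKr (s *: x) (s *: _)); apply: (hsubB hV) => //.
  exact: (pfilt_sub pV).
Qed.
End Properties.
End Filtration.

(** * Decompositions of Hilbert series *)

Section GeomCoef.

Lemma geom_coef_neg n (k : int) : k < 0 -> geom_coef n k = 0.
Proof. by case: k. Qed.

Lemma geom_coef0 (k : int) : geom_coef 0 k = (k == 0)%:Z.
Proof. by case: k => // j; rewrite /geom_coef expr0 coef1; case: j. Qed.

(** The truncation J is decoupled from j because the convolution reads all lower coefficients of the
    same truncated power. The resulting sum is the hockey-stick identity. *)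
Lemma geom_coefE n j : forall J, (j <= J)%N ->
  ((\poly_(i < J.+1) (1 : int)) ^+ n.+1)`_j = 'C(j + n, n)%:Z.
Proof.
elim: n j => [|n IH] j J jJ.
  by rewrite expr1 coef_poly ltnS jJ bin0.
rewrite exprS coefM (eq_bigr (fun i : 'I_j.+1 => ('C(j - i + n, n))%:Z)); last first.
  move=> i _; have iJ : (i < J.+1)%N by apply: leq_trans (ltn_ord i) _.
  rewrite coef_poly iJ mul1r.
  by apply: IH; apply: leq_trans jJ; apply: leq_subr.
rewrite (reindex_inj rev_ord_inj) /=.
rewrite (eq_bigr (fun i : 'I_j.+1 => ('C(i + n, n))%:Z)); last first.
  by move=> i _; rewrite subSS subKn // -ltnS.
elim: j {jJ} => [|j IHj]; first by rewrite big_ord1 /= !add0n !binn.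
rewrite big_ord_recr /= IHj -PoszD; congr Posz.
by rewrite !addSn [in RHS]binS addnS.
Qed.

Lemma geom_coefS n j : geom_coef n.+1 (Posz j) = 'C(j + n, n)%:Z.
Proof. by rewrite /geom_coef geom_coefE. Qed.

(** This is (1 - t)/(1 - t)^(n+1) = 1/(1 - t)^n, read off coefficientwise. *)
Lemma geom_coef_diff n (k : int) :
  geom_coef n.+1 k - geom_coef n.+1 (k - 1) = geom_coef n k.
Proof.
case: k => [[|j]|j].
- rewrite (geom_coef_neg n.+1 (k := 0 - 1)) // subr0 geom_coefS.
  by case: n => [|n]; rewrite ?geom_coef0 ?geom_coefS !add0n !binn.
- have -> : Posz j.+1 - 1 = Posz j by rewrite -addn1 PoszD addrK.
  case: n => [|n]; first by rewrite !geom_coefS !bin0 geom_coef0.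
  by rewrite !geom_coefS addSn binS PoszD addrC addKr addSnnS.
- by rewrite !geom_coef_neg ?subrr.
Qed.

End GeomCoef.

(** * Sums of terms c t^mu / (1 - t)^n *)

Section Terms.
Variable r : nat.
Local Notation T := 'rV[int]_r.

(* (c, mu, n) stands for c t^mu / (1 - t)^n. *)
Definition term := (int * T * 'X_{1..r})%type.

Definition tcoef (t : term) (nu : T) : int :=
  t.1.1 * \prod_(i < r) geom_coef (t.2 i) (nu 0 i - t.1.2 0 i).

Definition tsum (L : seq term) (nu : T) : int := \sum_(t <- L) tcoef t nu.

(** This is Q_n(1) once the terms with denominator (1 - t)^n are collected into one fraction. *)
Definition tval (L : seq term) (n : 'X_{1..r}) : int :=
  \sum_(t <- L | t.2 == n) t.1.1.

Definition basis (i : 'I_r) : T := to_Zr U_(i)%MM.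

Lemma basisE i j : basis i 0 j = (i == j)%:Z.
Proof. by rewrite mxE mnm1E. Qed.

(** [tincr i] divides a term by 1 - t_i, and [tshift a] multiplies it by t^a. *)
Definition tincr i (t : term) : term := (t.1, (t.2 + U_(i))%MM).
Definition tshift a (t : term) : term := (t.1.1, t.1.2 + a, t.2).
Definition tneg (t : term) : term := (- t.1.1, t.1.2, t.2).

Lemma tcoef_shift a t nu : tcoef (tshift a t) nu = tcoef t (nu - a).
Proof.
rewrite /tcoef /=; congr (_ * _); apply: eq_bigr => i _; congr geom_coef.
by rewrite !mxE; ring.
Qed.

Lemma tcoef_incr i t nu :
  tcoef (tincr i t) nu - tcoef (tincr i t) (nu - basis i) = tcoef t nu.
Proof.
rewrite /tcoef /= -mulrBr; congr (_ * _).
pose P := \prod_(j < r | j != i) geom_coef (t.2 j) (nu 0 j - t.1.2 0 j).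
have e (nu' : T) : (forall j, j != i -> nu' 0 j = nu 0 j) ->
    \prod_(j < r) geom_coef ((t.2 + U_(i))%MM j) (nu' 0 j - t.1.2 0 j) =
    geom_coef (t.2 i).+1 (nu' 0 i - t.1.2 0 i) * P.
  move=> h; rewrite (bigD1 i) //= mnmDE mnm1E eqxx addn1; congr (_ * _).
  by apply: eq_bigr => j ji; rewrite mnmDE mnm1E eq_sym (negPf ji) addn0 h.
rewrite !e //; last by move=> j ji; rewrite !mxE mnm1E eq_sym (negPf ji) subr0.
rewrite [RHS](bigD1 i) //= -mulrBl.
have -> : (nu - basis i) 0 i - t.1.2 0 i = nu 0 i - t.1.2 0 i - 1.
  by rewrite !mxE mnm1E eqxx addrAC.
by rewrite geom_coef_diff.
Qed.

Lemma tcoef_neg t nu : tcoef (tneg t) nu = - tcoef t nu.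
Proof. by rewrite /tcoef /= mulNr. Qed.

Lemma tcoef_far i (t : term) (nu : T) : nu 0 i < t.1.2 0 i -> tcoef t nu = 0.
Proof.
move=> h; rewrite /tcoef (bigD1 i) //= geom_coef_neg ?mul0r ?mulr0 //.
by rewrite subr_lt0.
Qed.

Lemma tsum_cat L L' nu : tsum (L ++ L') nu = tsum L nu + tsum L' nu.
Proof. by rewrite /tsum big_cat. Qed.

Lemma tval_cat L L' n : tval (L ++ L') n = tval L n + tval L' n.
Proof. by rewrite /tval big_cat. Qed.

(** A [weakdec] may use a d larger than the order of the series; the positive value required by
    [hdec] makes d the exact order. *)
Definition weakdec (h : T -> int) (d : nat) (L : seq term) : Prop :=
  [/\ forall t, t \in L -> mdeg t.2 = d, forall nu, h nu = tsum L nu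
    & forall n, 0 <= tval L n].

Definition hdec (h : T -> int) (d : nat) : Prop :=
  exists2 L, weakdec h d L & exists n, 0 < tval L n.

Lemma hdec_ext h h' d : (forall nu, h nu = h' nu) -> hdec h d -> hdec h' d.
Proof. by move=> /funext ->. Qed.

(** All values of the padded list are 0, since the numerators c t^mu and - c t^(mu + e_i) have
    opposite values at t = 1. *)
Lemma weakdec_pad h d L (i : 'I_r) : weakdec h d L -> exists L', weakdec h d.+1 L'.
Proof.
move=> [dL hL vL]; exists (flatten [seq [:: tincr i t; tneg (tshift (basis i) (tincr i t))] | t <- L]).
split.
- move=> t /flattenP [_ /mapP [u uL ->]].
  by rewrite !inE => /orP [] /eqP -> /=; rewrite mdegD mdeg1 dL ?addn1.
- move=> nu; rewrite hL /tsum big_flatten big_map /=; apply: eq_bigr => t _.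
  by rewrite big_cons big_seq1 tcoef_neg tcoef_shift tcoef_incr.
- move=> n; rewrite /tval big_flatten big_map big1 // => t _.
  by rewrite !big_cons big_nil /=; case: eqP => _ //; rewrite addr0 subrr.
Qed.

Lemma weakdec_le h d d' L (i : 'I_r) : (d <= d')%N -> weakdec h d L ->
  exists L', weakdec h d' L'.
Proof.
move=> /subnK <-; elim: (d' - d)%N => [|k IH]; first by exists L.
by move=> /IH [L' /(weakdec_pad i)]; rewrite addSn.
Qed.

Lemma weakdec_add h h' d L L' : weakdec h d L -> weakdec h' d L' ->
  weakdec (fun nu => h nu + h' nu) d (L ++ L').
Proof.
move=> [dL hL vL] [dL' hL' vL']; split.
- by move=> t; rewrite mem_cat => /orP [/dL|/dL'].
- by move=> nu; rewrite tsum_cat hL hL'.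
- by move=> n; rewrite tval_cat addr_ge0.
Qed.

Lemma hdec_addl h h' d d' (i : 'I_r) : (d' <= d)%N -> hdec h d -> hdec h' d' ->
  hdec (fun nu => h nu + h' nu) d.
Proof.
move=> dd [L wL [n vn]] [L' wL' _]; have [L'' wL''] := weakdec_le i dd wL'.
exists (L ++ L''); first exact: weakdec_add.
by exists n; rewrite tval_cat; case: wL'' => _ _ /(_ n) h''; apply: ltr_wpDr.
Qed.

Lemma hdec_add h h' d d' (i : 'I_r) : hdec h d -> hdec h' d' ->
  hdec (fun nu => h nu + h' nu) (maxn d d').
Proof.
move=> hd hd'; case: (leqP d' d) => dd; first exact: (hdec_addl i dd hd hd').
apply: (@hdec_ext (fun nu => h' nu + h nu)); first by move=> nu; rewrite addrC.
by apply: (hdec_addl i _ hd' hd); apply: ltnW.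
Qed.

Lemma hdec_shift h d a : hdec h d -> hdec (fun nu => h (nu - a)) d.
Proof.
move=> [L [dL hL vL] [n vn]]; exists (map (tshift a) L); last first.
  by exists n; rewrite /tval big_map.
split.
- by move=> t /mapP [u uL ->] /=; apply: dL.
- by move=> nu; rewrite hL /tsum big_map; apply: eq_bigr => t _; rewrite tcoef_shift.
- by move=> m; rewrite /tval big_map; apply: vL.
Qed.

(** In generating series, (1 - t_i) h = h'. Both h and the list divided by 1 - t_i satisfy this
    recursion in direction i and vanish when the i-th coordinate is very negative, so they agree by
    induction on that coordinate. *)
Lemma hdec_div (h h' : T -> int) d i : (forall nu : T, nu 0 i < 0 -> h nu = 0) ->
  (forall nu, h nu = h (nu - basis i) + h' nu) -> hdec h' d -> hdec h d.+1.
Proof.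
move=> h0 hh [L [dL hL vL] [n vn]]; exists (map (tincr i) L); last first.
  exists (n + U_(i))%MM; rewrite /tval big_map /=.
  by under eq_bigl do rewrite (inj_eq (@addIm _ _)).
split.
- by move=> t /mapP [u uL ->] /=; rewrite mdegD mdeg1 dL ?addn1.
- have [N hN] : exists N : nat, forall t, t \in L -> - N%:Z <= t.1.2 0 i.
    elim: (L) => [|t K [N IH]]; first by exists 0%N.
    exists (N + `|t.1.2 0%R i|)%N => u; rewrite inE PoszD opprD abszE.
    case/orP => [/eqP ->|/IH hu].
      by apply: le_trans (lerNnormlW (lexx _)); rewrite gerDr oppr_le0.
    by apply: le_trans hu; rewrite gerDl oppr_le0.
  have far (nu : T) : nu 0 i < - N%:Z -> h nu = tsum (map (tincr i) L) nu.
    move=> hnu; rewrite h0; last by lia.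
    rewrite /tsum big_map big_seq big1 // => t tL.
    by rewrite (@tcoef_far i) //; apply: lt_le_trans hnu (hN t tL).
  suff H k (nu : T) : nu 0 i < - N%:Z + k%:Z -> h nu = tsum (map (tincr i) L) nu.
    by move=> nu; apply: (H (`|nu 0%R i| + N)%N.+1); lia.
  elim: k nu => [|k IH] nu hnu; first by apply: far; lia.
  have e : (nu - basis i) 0 i = nu 0 i - 1 by rewrite !mxE mnm1E eqxx.
  rewrite hh IH; last by rewrite e; lia.
  rewrite hL /tsum !big_map -big_split /=; apply: eq_bigr => t _.
  by rewrite -(tcoef_incr i t nu); ring.
- move=> m; rewrite /tval big_map /=.
  case: (leqP 1 (m i)) => mi.
    have -> : m = ((m - U_(i)) + U_(i))%MM.
      by rewrite submK //; apply/mnm_lepP => j; rewrite mnm1E; case: eqP => [<-|].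
    by under eq_bigl do rewrite (inj_eq (@addIm _ _)); apply: vL.
  rewrite big1 // => t /eqP e; move: mi; rewrite -e mnmDE mnm1E eqxx.
  by rewrite addn1.
Qed.

Lemma hdec_delta : hdec (fun nu => (nu == 0)%:Z) 0.
Proof.
exists [:: (1, 0, 0%MM)]; last by exists 0%MM; rewrite /tval big_cons big_nil eqxx.
split.
- by move=> t; rewrite inE => /eqP ->; rewrite mdeg0.
- move=> nu; rewrite /tsum big_seq1 /tcoef /= mul1r.
  rewrite (eq_bigr (fun i => (nu 0 i == 0)%:Z)); last first.
    by move=> i _; rewrite mnm0E geom_coef0 mxE subr0.
  case: eqP => [->|ne]; first by rewrite big1 // => i _; rewrite mxE eqxx.
  have [i /negPf ni] : exists i, nu 0 i != 0.
    apply/existsP; apply: contraT => /existsPn h; case: ne.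
    by apply/rowP => i; rewrite mxE; apply/eqP; have := h i; rewrite negbK.
  by rewrite (bigD1 i) //= ni mul0r.
- by move=> n; rewrite /tval big_mkcond big_seq1; case: ifP.
Qed.

End Terms.

Lemma sum_seq_sub (I : eqType) (s t : seq I) (f : I -> nat) :
  uniq s -> uniq t -> (forall x, x \in s -> f x != 0%N -> x \in t) ->
  (\sum_(x <- s) f x <= \sum_(x <- t) f x)%N.
Proof.
move=> us ut st; rewrite (bigID (fun x => f x == 0%N)) /= big1 ?add0n => [|x /eqP //].
rewrite [leqRHS](bigID (fun x => (x \in s) && (f x != 0%N))) /=.
apply: leq_trans (leq_addr _ _).
rewrite -big_filter -[leqRHS]big_filter; apply: eq_leq; apply: perm_big.
apply: uniq_perm; rewrite ?filter_uniq // => x; rewrite !mem_filter.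
case: eqP => //= fx; rewrite ?andbF //; case: (boolP (x \in s)) => //= xs.
by rewrite st //; apply/eqP.
Qed.

(** * Growth of sums over boxes *)

Section Boxes.
Variable r : nat.
Local Notation T := 'rV[int]_r.

Definition box (s : nat) : seq T :=
  [seq \row_i (f i)%:Z | f : {ffun 'I_r -> 'I_s.+1}].

Lemma mem_box s (nu : T) :
  (nu \in box s) = [forall i, (0 <= nu 0 i) && (nu 0 i <= s%:Z)].
Proof.
apply/mapP/forallP => [[f _ ->] i|h].
  by rewrite mxE /= lez_nat -ltnS ltn_ord.
exists [ffun i => inord `|nu 0%R i|%N]; first by rewrite mem_enum.
apply/rowP => i; have /andP [h0 h1] := h i.
rewrite mxE ffunE inordK; first by rewrite gez0_abs.
by rewrite ltnS -lez_nat gez0_abs.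
Qed.

Lemma box_uniq s : uniq (box s).
Proof.
rewrite map_inj_uniq ?enum_uniq // => f g /rowP e; apply/ffunP => i.
by have := e i; rewrite !mxE => -[] /ord_inj.
Qed.

Lemma size_box s : size (box s) = (s.+1 ^ r)%N.
Proof. by rewrite size_map -cardE card_ffun !card_ord. Qed.

Lemma nonnegP (nu : T) : reflect (forall i, 0 <= nu 0 i) (nonneg nu).
Proof. exact: forallP. Qed.

Lemma box_shift (h : T -> nat) a s : (forall nu, ~~ nonneg nu -> h nu = 0%N) ->
  nonneg a -> (\sum_(nu <- box s) h (nu - a)%R <= \sum_(nu <- box s) h nu)%N.
Proof.
move=> h0 /nonnegP a0.
rewrite -(big_map (fun nu => nu - a) predT h); apply: sum_seq_sub.
- by rewrite map_inj_uniq ?box_uniq //; apply: addIr.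
- exact: box_uniq.
- move=> _ /mapP [nu + ->] hn; rewrite !mem_box => /forallP nub.
  have /nonnegP pos : nonneg (nu - a) by apply: contraNT hn => /h0 ->.
  apply/forallP => i; rewrite pos /=; have /andP [_ nus] := nub i.
  by rewrite !mxE lerBlDr; apply: le_trans nus _; rewrite lerDl.
Qed.

(** The base s + 1 is the number of lattice points on a side of the box, and it stays positive at s
    = 0. *)
Definition growth (h : T -> nat) (d : nat) : Prop :=
  exists C, forall s, (\sum_(nu <- box s) h nu <= C * s.+1 ^ d)%N.

Lemma growth_le h d d' : (d <= d')%N -> growth h d -> growth h d'.
Proof.
move=> dd [C hC]; exists C => s; apply: leq_trans (hC s) _.
by rewrite leq_mul2l leq_pexp2l // orbT.
Qed.

Lemma growth_add h h' d : growth h d -> growth h' d ->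
  growth (fun nu => h nu + h' nu)%N d.
Proof.
move=> [C hC] [C' hC']; exists (C + C')%N => s.
by rewrite big_split mulnDl leq_add.
Qed.

Lemma growth_shift h d a : (forall nu, ~~ nonneg nu -> h nu = 0%N) -> nonneg a ->
  growth h d -> growth (fun nu => h (nu - a)) d.
Proof.
move=> h0 a0 [C hC]; exists C => s; apply: leq_trans (hC s).
exact: box_shift.
Qed.

(** Unrolling the recursion s + 1 times in direction i leads out of the box, so the box sum of h is
    bounded by s + 1 box sums of shifts of h'. *)
Lemma growth_div (h h' : T -> nat) d i : (forall nu, ~~ nonneg nu -> h nu = 0%N) ->
  (forall nu, ~~ nonneg nu -> h' nu = 0%N) ->
  (forall nu, h nu = h (nu - basis i)%R + h' nu)%N -> growth h' d -> growth h d.+1.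
Proof.
move=> h0 h0' hh [C hC]; exists C => s.
have iter_h k nu : h nu = (\sum_(j < k) h' (nu - basis i *+ j)%R + h (nu - basis i *+ k)%R)%N.
  elim: k => [|k IH]; first by rewrite big_ord0 mulr0n subr0.
  rewrite big_ord_recr /= -addnA [X in (_ + X)%N]addnC mulrSr opprD addrA.
  by rewrite -hh.
have bn j : nonneg (basis i *+ j).
  by apply/nonnegP => l; rewrite mulmxnE basisE mulrn_wge0.
have h's nu : nu \in box s -> h nu = (\sum_(j < s.+1) h' (nu - basis i *+ j)%R)%N.
  rewrite mem_box => /forallP /(_ i) /andP [_ nus].
  rewrite (iter_h s.+1) [X in (_ + X)%N]h0 ?addn0 //.
  apply/negP => /nonnegP /(_ i); rewrite !mxE mulmxnE basisE eqxx.
  rewrite -mulr_natr mul1r natz subr_ge0 => le; have := le_trans le nus.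
  by rewrite lez_nat ltnn.
rewrite big_seq (eq_bigr _ h's) -big_seq exchange_big /=.
apply: leq_trans (_ : \sum_(j < s.+1) (C * s.+1 ^ d) <= _)%N.
  apply: leq_sum => j _; apply: leq_trans (hC s).
  exact: box_shift.
by rewrite sum_nat_const card_ord expnS mulnCA.
Qed.

Lemma growth_delta : growth (fun nu : T => ((nu == 0) : nat)) 0.
Proof.
exists 1%N => s; rewrite expn0 muln1.
have /(sum_seq_sub (box_uniq s)) : uniq [:: 0 : T] by [].
move=> /(_ (fun nu => (nu == 0) : nat)) le; apply: leq_trans (le _) _.
  by move=> nu _; rewrite inE; case: (nu == 0).
by rewrite big_seq1 eqxx.
Qed.
End Boxes.

(** * Hilbert functions of homogeneous primes *)

Definition prime_chain (R : comNzRingType) (p : set R) (n : nat) : Prop :=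
  exists Z : nat -> set R, [/\ Z 0%N = p, forall i, (i <= n)%N -> prime_ideal (Z i)
    & forall i, (i < n)%N -> Z i `<` Z i.+1].

Lemma prime_chain0 (R : comNzRingType) (p : set R) : prime_ideal p -> prime_chain p 0.
Proof. by exists (fun=> p); split. Qed.

Lemma prime_chain_cons (R : comNzRingType) (p q : set R) n : prime_ideal p ->
  p `<` q -> prime_chain q n -> prime_chain p n.+1.
Proof.
move=> pp pq [Z [Z0 Zp Zl]]; exists (fun i => if i is i'.+1 then Z i' else p).
split=> //; first by case.
by case=> [|i] h; [rewrite Z0|apply: Zl].
Qed.

Section HilbertFunctions.
Variables (r : nat) (A : comNzRingType) (B : comAlgType A).
Variable Bg : 'X_{1..r} -> set B.
Local Notation T := 'rV[int]_r.
Local Notation BZ := (BZ Bg).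
Hypothesis B_graded : graded_algebra Bg.
Hypothesis B_standard : standard_graded Bg.
Hypothesis accB : acc (@is_ideal B).
Hypothesis A_unit_nil : forall a : A,
  (exists b, b * a = 1) \/ (exists n, a ^+ n = 0).
Let dB := BZ_direct B_graded.
Let gB := BZ_gmod B_graded.

Lemma BZ_alg (a : A) : BZ 0 (a%:A : B).
Proof. by apply: BZ_in_alg; case: B_standard. Qed.

Lemma BZ_1 : BZ 0 1.
Proof. by have := BZ_alg 1; rewrite scale1r. Qed.

Lemma Asub_gr (M : lmodType B) (Mg : T -> set M) nu : gmod Bg Mg ->
  A_submodule (Mg nu).
Proof.
move=> [dM MM]; split; first exact: gr0 dM nu.
  by move=> x y; apply: (grD dM).
by move=> a x Mx; rewrite -(add0r nu); apply: MM => //; apply: BZ_alg.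
Qed.

Lemma Asub_gr_cap (M : lmodType B) (Mg : T -> set M) U nu : gmod Bg Mg ->
  hsub Mg U -> A_submodule (U `&` Mg nu).
Proof. by move=> gM hU; apply: Asub_cap; [apply: (hsub_Asub hU)|apply: Asub_gr gM]. Qed.

(* Hilbert function of B/p, with value 0 where the length is infinite. *)
Definition hilb_fun (p : set B) (nu : T) : nat :=
  xget 0%N [set n | @has_len A B B^o (p `&` BZ nu) (BZ nu) n].

Definition hilb_finite (p : set B) : Prop :=
  forall nu, exists n, @has_len A B B^o (p `&` BZ nu) (BZ nu) n.

Lemma hilb_funE p nu n : @has_len A B B^o (p `&` BZ nu) (BZ nu) n ->
  hilb_fun p nu = n.
Proof.
move=> pn; rewrite /hilb_fun; case: xgetP => [m _ pm|/(_ n) //].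
exact: has_len_inj pm pn.
Qed.

Lemma hilb_funP p nu : hilb_finite p ->
  @has_len A B B^o (p `&` BZ nu) (BZ nu) (hilb_fun p nu).
Proof. by move=> /(_ nu) [n pn]; rewrite (hilb_funE pn). Qed.

Section Module.
Variables (M : lmodType B) (Mg : T -> set M).
Hypothesis gM : gmod Bg Mg.
Let dM : is_direct_sum Mg. Proof. by case: gM. Qed.

(** Multiplication by m maps degree nu - a of B onto degree nu of (V + B m)/V. If x has degree nu
    and x - b m is in V, then b may be replaced by its component of degree nu - a. *)
Lemma has_len_adj V m a nu n : hsub Mg V -> Mg a m ->
  @has_len A B B^o (colon V m `&` BZ (nu - a)) (BZ (nu - a)) n ->
  has_len (V `&` Mg nu) (adj V m `&` Mg nu) n.
Proof.
move=> hV Mm.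
have hadj := hsub_adj B_graded gM hV Mm.
have hcol := hsub_colon B_graded gM hV Mm.
apply: (@has_len_iso A B B^o M (fun b : B => b *: m)).
- by move=> x y; apply: scalerDl.
- by move=> x y; rewrite [RHS]scalerA.
- exact: Asub_gr gB.
- exact: Asub_gr_cap.
- exact: Asub_gr_cap.
- by move=> x [].
- by move=> x [Vx Mx]; split=> //; apply: adj_sub.
- move=> b Bb; split; first exact: (adj_gen hV).
  by rewrite -(subrK a nu); case: gM => _; apply.
- move=> b Bb; split; first by case.
  case=> Vb _; split=> //.
  by rewrite -(subrK a nu); case: gM => _; apply.
- move=> x [[b Vx] Mx]; exists (proj BZ (nu - a) b); first exact: (proj_in dB).
  have -> : x - (proj BZ (nu - a) b : B) *: m = proj Mg nu (x - b *: m).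
    by rewrite (projB dM) (projZr B_graded gM _ _ Mm) (proj_id dM Mx).
  by split; [apply: (hsub_proj hV)|apply: (proj_in dM)].
Qed.

Lemma pfilt_has_len U V L nu : hsub Mg U -> pfilt Mg U V L ->
  (forall p a, List.In (p, a) L -> hilb_finite p) ->
  has_len (U `&` Mg nu) (V `&` Mg nu) (\sum_(x <- L) hilb_fun x.1 (nu - x.2)).
Proof.
move=> hU; elim=> [_|V' K m a pV IH Mm pr h].
  rewrite big_nil; apply: has_len_refl.
  exact: Asub_gr_cap.
have hV := pfilt_hsub B_graded gM pV hU.
rewrite big_cons /= addnC; apply: (@has_len_cat _ _ _ _ (V' `&` Mg nu)).
- exact: Asub_gr_cap.
- apply: Asub_cap; last exact: Asub_gr gM.
  exact: (hsub_Asub (hsub_adj B_graded gM hV Mm)).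
- by apply: IH => p b inK; apply: (h p b); right.
- apply: (has_len_adj hV Mm); apply: hilb_funP.
  by apply: (h _ a); left.
Qed.
End Module.

(** B is generated in degrees e_1, ..., e_r, so a monomial whose degree is positive in direction i
    has a factor of degree e_i. *)
Lemma BZ_sub_of_generators p i : is_ideal p -> (forall x, Bg U_(i)%MM x -> p x) ->
  forall nu : T, 0 < nu 0 i -> BZ nu `<=` p.
Proof.
move=> ip pU; case: B_standard => _ B0 [k [x [xdeg gen]]].
suff H b : forall nu : T, 0 < nu 0 i -> p (proj BZ nu b).
  by move=> nu nui b Bb; rewrite -(proj_id dB Bb); apply: H.
move: b; apply: (@generated_ind A B k x gen
  (fun b => forall nu : T, 0 < nu 0 i -> p (proj BZ nu b))) =>
  [a|y z IHy IHz|j y IH] nu nui.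
- rewrite (proj_hom dB _ (BZ_alg a)); case: eqP => [e|_]; last exact: ideal0.
  by rewrite e mxE ltxx in nui.
- by rewrite (projD dB); apply: idealD => //; [apply: IHy|apply: IHz].
- have [l Bx] := xdeg j.
  have := projZl gB nu (y : B^o) (BZ_to Bx); rewrite /GRing.scale /= => ->.
  have [li|li] := eqVneq l i.
    by rewrite mulrC; apply: idealM => //; apply: pU; rewrite -li.
  by apply: idealM => //; apply: IH; rewrite !mxE mnm1E (negPf li) subr0.
Qed.

Lemma hideal_prime_cases p : is_ideal p ->
  (exists i x, BZ (basis i) x /\ ~ p x) \/ (forall nu, nu <> 0 -> BZ nu `<=` p).
Proof.
move=> ip; have [[i [x [Bx px]]]|nex] := pselect (exists i x, BZ (basis i) x /\ ~ p x).
  by left; exists i, x.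
right=> nu nu0 b Bb; case: (boolP (nonneg nu)) => [/nonnegP pos|neg]; last first.
  by rewrite (BZ_neg neg Bb); apply: ideal0.
have [i nui] : exists i, 0 < nu 0 i.
  apply: contrapT => nei; apply: nu0; apply/rowP => i; rewrite mxE; apply/eqP.
  rewrite eq_le pos andbT leNgt; apply/negP => h; apply: nei; by exists i.
apply: (BZ_sub_of_generators ip _ nui) => // x Bx; apply: contrapT => px.
by apply: nex; exists i, x; split=> //; apply: BZ_to.
Qed.

Lemma hilb_fun_neg p nu : is_ideal p -> ~~ nonneg nu ->
  @has_len A B B^o (p `&` BZ nu) (BZ nu) 0.
Proof.
move=> ip neg; have -> : p `&` BZ nu = BZ nu.
  apply/seteqP; split=> [b []//|b Bb]; split=> //.
  by rewrite (BZ_neg neg Bb); apply: ideal0.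
by apply: has_len_refl; apply: Asub_gr gB.
Qed.

(** B/p lives in degree 0, where it is A/(p ∩ A). This is a field, since every element of A is a
    unit or nilpotent, and so it has length 1. *)
Lemma hilb_fun_max p nu : prime_ideal p -> (forall nu, nu <> 0 -> BZ nu `<=` p) ->
  @has_len A B B^o (p `&` BZ nu) (BZ nu) (nu == 0).
Proof.
move=> pp Bp; have ip := prime_is_ideal pp.
have aB : @A_submodule A B B^o (BZ nu) by apply: Asub_gr gB.
case: eqP => [nu0|/Bp sub]; last first.
  have -> : p `&` BZ nu = BZ nu by apply/seteqP; split=> [b []//|b Bb]; split=> //; apply: sub.
  exact: has_len_refl.
have ap : @A_submodule A B B^o p.
  split; [exact: ideal0|by move=> x y; apply: idealD|].
  by move=> a x px; apply: (@idealM _ _ (a%:A)).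
rewrite nu0 in aB *; split.
  apply: len_ge1 => //; first exact: Asub_cap.
  split; first by move=> x [].
  by move=> /(_ 1 BZ_1) [/(prime_not1 pp)].
case=> [//|[//|k]] [Z [Zi Zl]].
have [a0 h0 _] := Zi 0%N isT; have [a1 h1 b1] := Zi 1%N isT; have [a2 h2 b2] := Zi 2%N isT.
have [s01 n10] := Zl 0%N isT; have [_ []] := Zl 1%N isT.
have [y Z1y nZ0y] : exists2 y, Z 1%N y & ~ Z 0%N y.
  by apply: contrapT => nex; apply: n10 => y Z1y; apply: contrapT => nZ; apply: nex; exists y.
have By := b1 y Z1y.
have npy : ~ p y by move=> py; apply: nZ0y; apply: h0.
case: B_standard => _ B0 _.
have [a _ ya] : range (in_alg B) y.
  by rewrite -B0; move: By; rewrite -(to_Zr0 r) => /(BZ_of B_graded).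
have [[c ca]|[n an]] := A_unit_nil a; last first.
  case: npy; apply: (@primeX _ _ _ n pp); rewrite -ya -rmorphXn an rmorph0.
  exact: ideal0.
have Z1_1 : Z 1%N 1.
  have := AsubZ c a1 Z1y; rewrite /GRing.scale /= -ya.
  by rewrite -(rmorphM (in_alg B)) ca rmorph1.
move=> z /b2 Bz.
have [d _ zd] : range (in_alg B) z.
  by rewrite -B0; move: Bz; rewrite -(to_Zr0 r) => /(BZ_of B_graded).
have := AsubZ d a1 Z1_1; rewrite -zd.
by have -> : d%:A *: (1 : B^o) = in_alg B d by rewrite /GRing.scale /= mulr1.
Qed.

Lemma prime_step p i x : hideal Bg p -> prime_ideal p -> BZ (basis i) x -> ~ p x ->
  exists L, [/\ @pfilt r A B B^o BZ (@adj A B B^o p x) setT L, L <> [::] &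
    forall q a, List.In (q, a) L ->
      [/\ prime_ideal q, hideal Bg q, p `<` q & nonneg a]].
Proof.
move=> hp pp Bx px; have hadj : hideal Bg (@adj A B B^o p x) := hsub_adj B_graded gB hp Bx.
have iadj := hideal_ideal hadj.
have [L pL] := pfilt_ideal_ex B_graded accB BZ_1 hadj; exists L.
(* If 1 - b x were in p, its component of degree 0 would be too; that component is 1, because b x
   has nothing in degree 0. *)
have adj1 : ~ @adj A B B^o p x 1.
  case=> b pb; have := hsub_proj hp 0 pb.
  rewrite (projB dB) (projZr B_graded gB _ _ Bx) (proj_id dB BZ_1) => h.
  apply: (prime_not1 pp); move: h; rewrite (@BZ_neg _ _ _ Bg (0 - basis i) (proj BZ (0 - basis i) b)).
  - by rewrite scale0r subr0.
  - by apply/negP => /nonnegP /(_ i); rewrite !mxE mnm1E eqxx.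
  - exact: (proj_in dB).
split=> //.
  move=> L0; move: pL; rewrite L0 => h.
  have : @adj A B B^o p x = setT by inversion h.
  by move=> e; apply: adj1; rewrite e.
move=> q a /(pfilt_prime B_graded gB hadj pL) [pq hq [m [_ Bm hm]]].
have sub : @adj A B B^o p x `<=` q.
  by move=> s ps; apply: hm; rewrite /GRing.scale /= mulrC; apply: idealM.
split=> //.
  split; first by move=> y py; apply: sub; apply: adj_sub.
  move=> /(_ x) h; apply: px; apply: h; apply: sub.
  by exists 1; rewrite /GRing.scale /= mul1r subrr; apply: ideal0; apply: prime_is_ideal.
(* The shift is the degree of an element of B whose annihilator modulo p + B x is proper; a degree
   with a negative entry would make that element 0. *)
apply: contraT => /BZ_neg/(_ Bm) m0; case: (prime_not1 pq); apply: hm.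
by rewrite m0 scaler0; apply: ideal0.
Qed.

(** Additivity of length on 0 -> (B/p)(-e_i) -> B/p -> B/(p + xB) -> 0, where the first map is
    multiplication by x and is injective because x is not in p. *)
Lemma hilb_step p i x nu k n : hideal Bg p -> prime_ideal p ->
  BZ (basis i) x -> ~ p x ->
  @has_len A B B^o (p `&` BZ (nu - basis i)) (BZ (nu - basis i)) k ->
  @has_len A B B^o (@adj A B B^o p x `&` BZ nu) (setT `&` BZ nu) n ->
  @has_len A B B^o (p `&` BZ nu) (BZ nu) (k + n).
Proof.
move=> hp pp Bx px hk hn.
have hadj : hideal Bg (@adj A B B^o p x) := hsub_adj B_graded gB hp Bx.
have ep : @colon A B B^o p x = p.
  apply/seteqP; split=> y.
    by move=> /(primeM pp) [].
  by move=> py; rewrite /colon /= /GRing.scale /= mulrC; apply: idealM => //; apply: prime_is_ideal.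
have h1 : @has_len A B B^o (p `&` BZ nu) (@adj A B B^o p x `&` BZ nu) k.
  by apply: (has_len_adj gB hp Bx); rewrite ep.
rewrite setTI in hn.
apply: has_len_cat h1 hn; last exact: Asub_gr gB.
exact: (Asub_gr_cap _ gB hadj).
Qed.

(** Finiteness is settled before any identity between Hilbert functions, because [hilb_fun] falls
    back to 0 on infinite lengths. The induction is on larger primes and, inside, on the i-th
    coordinate. *)
Lemma prime_hilb_finite p : hideal Bg p -> prime_ideal p -> hilb_finite p.
Proof.
move: p; apply: (hideal_ind accB) => p hp IH pp; have ip := prime_is_ideal pp.
have [[i [x [Bx px]]]|Bp] := hideal_prime_cases ip; last first.
  by move=> nu; exists (nu == 0); apply: hilb_fun_max.
have [L [pL _ hL]] := prime_step hp pp Bx px.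
have hadj : hideal Bg (@adj A B B^o p x) := hsub_adj B_graded gB hp Bx.
have finL q a : List.In (q, a) L -> hilb_finite q.
  by move=> /hL [pq hq pq' _]; apply: IH.
suff H k (nu : T) : nu 0 i < k%:Z -> exists n, @has_len A B B^o (p `&` BZ nu) (BZ nu) n.
  by move=> nu; apply: (H `|nu 0 i|.+1); lia.
elim: k nu => [|k IHk] nu hnu.
  exists 0%N; apply: hilb_fun_neg => //.
  by apply/negP => /nonnegP /(_ i); rewrite leNgt hnu.
have [|n hn] := IHk (nu - basis i).
  by rewrite !mxE mnm1E eqxx ltrBlDr -PoszD addn1.
exact: (ex_intro _ _ (hilb_step hp pp Bx px hn (pfilt_has_len gB nu hadj pL finL))).
Qed.

(* d is the dimension of B/p. *)
Definition hilb_prime (p : set B) (d : nat) : Prop :=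
  [/\ hdec (fun nu => (hilb_fun p nu)%:Z) d, growth (hilb_fun p) d & prime_chain p d].

Hypothesis r_gt0 : (0 < r)%N.

Definition hilb_sum (L : seq (set B * T)) (nu : T) : nat :=
  \sum_(x <- L) hilb_fun x.1 (nu - x.2).

(** The order of the sum is the maximum of the orders. A prime attaining it is recorded, since it
    supplies the long chain of primes. *)
Lemma hilb_sum_dec L : L <> [::] ->
  (forall p a, List.In (p, a) L -> exists d, hilb_prime p d) ->
  exists d, [/\ hdec (fun nu => (hilb_sum L nu)%:Z) d,
    exists p a, List.In (p, a) L /\ hilb_prime p d
    & forall p a, List.In (p, a) L -> exists2 d', (d' <= d)%N & hilb_prime p d'].
Proof.
elim: L => // -[p a] L IH _ hL.
have [d hd] := hL p a (or_introl erefl).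
have [dd _ _] := hd.
have hs := hdec_shift a dd.
have [L0|L0] := pselect (L = [::]).
  exists d; rewrite L0; split.
  - by apply: hdec_ext hs => nu; rewrite /hilb_sum big_seq1.
  - by exists p, a; split=> //; left.
  - by move=> q b [[<- _]|//]; exists d.
have [|d' [hd' [q [b [qb hq]]] le]] := IH L0.
  by move=> q b qb; apply: (hL q b); right.
exists (maxn d d'); split.
- apply: hdec_ext (hdec_add (Ordinal r_gt0) hs hd') => nu.
  by rewrite /hilb_sum big_cons PoszD.
- case: (leqP d' d) => dd'.
    by exists p, a; split; [left|].
  by exists q, b; split; [right|].
- move=> q' b' [[<- _]|/le [d'' le'' h'']]; first by exists d; rewrite // leq_maxl.
  by exists d'' => //; apply: leq_trans le'' (leq_maxr _ _).
Qed.

Lemma hilb_fun_neg0 p nu : is_ideal p -> ~~ nonneg nu -> hilb_fun p nu = 0%N.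
Proof. by move=> ip neg; apply: hilb_funE; apply: hilb_fun_neg. Qed.

Lemma hilb_sum_neg0 L nu : (forall p a, List.In (p, a) L -> is_ideal p /\ nonneg a) ->
  ~~ nonneg nu -> hilb_sum L nu = 0%N.
Proof.
elim: L => [|[p a] L IH] h neg; first by rewrite /hilb_sum big_nil.
have [ip pa] := h p a (or_introl erefl).
rewrite /hilb_sum big_cons -/(hilb_sum L nu) IH // ?addn0; last first.
  by move=> q b qb; apply: (h q b); right.
apply: hilb_fun_neg0 => //=; apply: contra neg => /nonnegP pos.
by apply/nonnegP => i; rewrite -(subrK a nu) mxE addr_ge0 ?pos //; apply/nonnegP.
Qed.

Lemma growth_hilb_sum L d : (forall p a, List.In (p, a) L ->
    [/\ is_ideal p, nonneg a & growth (hilb_fun p) d]) -> growth (hilb_sum L) d.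
Proof.
elim: L => [|[p a] L IH] h.
  by exists 0%N => s; rewrite big1 // => nu _; rewrite /hilb_sum big_nil.
have [ip pa gp] := h p a (or_introl erefl).
have -> : hilb_sum ((p, a) :: L) = (fun nu => hilb_fun p (nu - a)%R + hilb_sum L nu)%N.
  by apply/funext => nu; rewrite /hilb_sum big_cons.
apply: growth_add; last by apply: IH => q b qb; apply: (h q b); right.
by apply: growth_shift => // nu; apply: hilb_fun_neg0.
Qed.

Lemma hilb_prime_ex p : hideal Bg p -> prime_ideal p -> exists d, hilb_prime p d.
Proof.
move: p; apply: (hideal_ind accB) => p hp IH pp; have ip := prime_is_ideal pp.
have [[i [x [Bx px]]]|Bp] := hideal_prime_cases ip; last first.
  have e : hilb_fun p = (fun nu => (nu == 0) : nat).
    by apply/funext => nu; apply: hilb_funE; apply: hilb_fun_max.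
  exists 0%N; split; last exact: prime_chain0.
    by rewrite e; apply: hdec_ext (@hdec_delta r) => nu.
  by rewrite e; apply: growth_delta.
have [L [pL L0 hL]] := prime_step hp pp Bx px.
have hadj : hideal Bg (@adj A B B^o p x) := hsub_adj B_graded gB hp Bx.
(* Putting p below the chain of q lengthens it by one, which matches the increase of the order from
   d to d + 1 on division by 1 - t_i. *)
have [|d [hd [q [a [qa [_ _ cq]]]] le]] := hilb_sum_dec L0.
  by move=> q a /hL [pq hq pq' _]; apply: IH.
have finL q' a' : List.In (q', a') L -> hilb_finite q'.
  by move=> /hL [pq hq pq' _]; apply: prime_hilb_finite.
have step nu : hilb_fun p nu = (hilb_fun p (nu - basis i)%R + hilb_sum L nu)%N.
  apply: hilb_funE; apply: hilb_step => //; first exact: Bx.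
    by apply: px.
    by apply: hilb_funP; apply: prime_hilb_finite.
  exact: (pfilt_has_len gB nu hadj pL finL).
have neg nu : ~~ nonneg nu -> hilb_fun p nu = 0%N by apply: hilb_fun_neg0.
exists d.+1; split.
- apply: (hdec_div (i := i) _ _ hd) => nu; last by rewrite step PoszD.
  by move=> h; rewrite neg //; apply/negP => /nonnegP /(_ i); rewrite leNgt h.
- apply: (growth_div neg _ step).
    by move=> nu; apply: hilb_sum_neg0 => q' a' /hL [/prime_is_ideal ? _ _ ?].
  apply: growth_hilb_sum => q' a' qa'; have [/prime_is_ideal ? _ _ ?] := hL _ _ qa'.
  split=> //; have [d' dd' [_ g _]] := le _ _ qa'.
  exact: growth_le g.
- by have [_ _ pq _] := hL _ _ qa; apply: prime_chain_cons cq.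
Qed.

End HilbertFunctions.

(** * Krull dimension and growth *)

Lemma exp_le_binomial s n : (s ^ n <= n`! * 'C(s + n, n))%N.
Proof.
rewrite mulnC bin_ffact; elim: n => [|n IH]; first by rewrite ffactn0.
rewrite addnS ffactnS expnS; apply: leq_mul => //.
by rewrite -addnS leq_addr.
Qed.

Lemma leq_exp2 a b d : (a <= b)%N -> (a ^ d <= b ^ d)%N.
Proof. by case: d => // d ab; rewrite leq_exp2r. Qed.

Lemma binomial_growth_leq (C e n d : nat) :
  (forall s, ('C(s + n, n) <= C * (e * s).+1 ^ d)%N) -> (n <= d)%N.
Proof.
move=> h; rewrite leqNgt; apply/negP => dn.
(* K collects n! from [exp_le_binomial], C, and (e + 1)^d from e s + 1 <= (e + 1) s. At s = K + 1
   the bound s^n <= K s^d fails as soon as n > d. *)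
pose K := (n`! * C * e.+1 ^ d)%N.
have : (K.+1 ^ n <= K * K.+1 ^ d)%N.
  apply: leq_trans (exp_le_binomial _ _) _.
  have le : ((e * K.+1).+1 ^ d <= e.+1 ^ d * K.+1 ^ d)%N.
    by rewrite -expnMn; apply: leq_exp2 => //; rewrite mulSn addnC -addn1 leq_add2l.
  apply: (@leq_trans (n`! * (C * (e.+1 ^ d * K.+1 ^ d)))); last by rewrite /K !mulnA.
  by rewrite leq_mul2l; apply/orP; right; apply: leq_trans (h _) _; rewrite leq_mul2l le orbT.
apply/negP; rewrite -ltnNge; apply: (@leq_trans (K.+1 ^ d.+1)); last exact: leq_pexp2l.
by rewrite expnS ltn_mul2r expn_gt0 ltnSn.
Qed.

Section ChainGrowth.
Variables (r : nat) (A : comNzRingType) (B : comAlgType A).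
Variable Bg : 'X_{1..r} -> set B.
Local Notation T := 'rV[int]_r.
Local Notation BZ := (BZ Bg).
Hypothesis B_graded : graded_algebra Bg.
Hypothesis B_standard : standard_graded Bg.
Let dB := BZ_direct B_graded.
Let gB := BZ_gmod B_graded.

Definition deg_in (s : seq T) : set B := [set b | forall nu, nu \notin s -> proj BZ nu b = 0].

(** Modulo q this is the image of the part of B with degrees in s. Adding q makes sense of it for
    the members of an arbitrary chain, which need not be homogeneous primes. *)
Definition plus_deg_in (q : set B) (s : seq T) : set B :=
  [set x | exists2 b, deg_in s b & q (x - b)].

Lemma ideal_Asub q : is_ideal q -> @A_submodule A B B^o q.
Proof.
move=> iq; split; [exact: ideal0|by move=> x y; apply: idealD|].
by move=> a x px; apply: (@idealM _ _ (a%:A)).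
Qed.

Lemma deg_in_sub s t : {subset s <= t} -> deg_in s `<=` deg_in t.
Proof. by move=> st b hb nu nt; apply: hb; apply: contra nt; apply: st. Qed.

Lemma deg_in_Asub s : @A_submodule A B B^o (deg_in s).
Proof.
split.
- by move=> nu _; rewrite (proj0 dB).
- by move=> x y hx hy nu ns; rewrite (projD dB) hx ?hy ?addr0.
- move=> a x hx nu ns; have := projZl gB nu (x : B^o) (BZ_alg B_standard a).
  by rewrite subr0 hx // => ->; rewrite scaler0.
Qed.

Lemma plus_deg_in_Asub q s : is_ideal q -> @A_submodule A B B^o (plus_deg_in q s).
Proof. by move=> /ideal_Asub aq; apply: (@Asub_sum A B B^o) => //; apply: deg_in_Asub. Qed.

Lemma plus_deg_in_sub q s : q `<=` plus_deg_in q s.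
Proof.
by move=> x qx; exists 0; rewrite ?subr0 //; apply: Asub0 (deg_in_Asub s).
Qed.

(** Degrees are added one at a time, and each step is a quotient of B_nu/(q ∩ B_nu). It may be a
    proper quotient when q is not homogeneous, whence an inequality only. *)
Lemma plus_deg_in_len q s : is_ideal q -> hilb_finite Bg q -> uniq s ->
  @len_le A B B^o q (plus_deg_in q s) (\sum_(nu <- s) hilb_fun Bg q nu).
Proof.
move=> iq fq; have aq := ideal_Asub iq; elim: s => [|nu s IH] us.
  rewrite big_nil; have -> : plus_deg_in q [::] = q.
    apply/seteqP; split; last exact: plus_deg_in_sub.
    move=> x [b hb qx]; have b0 : b = 0.
      by apply: (proj_ext dB) => nu; rewrite hb // (proj0 dB).
    by rewrite b0 subr0 in qx.
  by case: (has_len_refl aq).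
have /andP [nus us'] := us.
rewrite big_cons addnC; apply: (@len_le_cat A B B^o q (plus_deg_in q s)).
- exact: plus_deg_in_Asub.
- exact: plus_deg_in_Asub.
- exact: plus_deg_in_sub.
- move=> x [b hb qx]; exists b => //; apply: deg_in_sub hb.
  by move=> mu; rewrite inE orbC => ->.
- exact: IH.
move=> k hk; have [_ le] := hilb_funP nu fq; apply: le.
apply: (@len_ge_preim A B B^o B^o id _ _ _ _ _ _ _ _ _ _ _ hk) => //.
- exact: (Asub_gr B_standard nu gB).
- by move=> x [qx _]; apply: plus_deg_in_sub.
- move=> x [b hb qx]; exists (proj BZ nu b); first exact: (proj_in dB).
  exists (b - proj BZ nu b); last first.
    by rewrite opprB addrA subrK.
  move=> mu mus; rewrite (projB dB) (proj_hom dB _ (proj_in dB nu b)).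
  by case: eqP => [->|ne]; rewrite ?subrr // subr0 hb // inE negb_or mus andbT; apply/eqP.
Qed.

Lemma deg_in_box b : exists e, deg_in (box r e) b.
Proof.
have [s us supp] := proj_supp dB b.
suff [e he] : exists e, forall nu, nu \in s -> nonneg nu -> nu \in box r e.
  exists e => nu nbox; apply/eqP; apply: contraNT nbox => nz.
  apply: he; first exact: supp.
  by apply: contraNT nz => /BZ_neg/(_ (proj_in dB nu b)) ->.
elim: s {us supp} => [|nu s [e IH]]; first by exists 0%N.
exists (e + \sum_(i < r) `|nu 0%R i|)%N => mu; rewrite inE => /orP [/eqP ->|ms] /nonnegP pos.
  rewrite mem_box; apply/forallP => i; rewrite pos /= -(gez0_abs (pos i)) lez_nat.
  by rewrite (bigD1 i) //= addnCA leq_addr.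
have := IH mu ms; move/(_ (introT (nonnegP _) pos)); rewrite !mem_box => /forallP h.
apply/forallP => i; have /andP [-> le] := h i; apply: le_trans le _.
by rewrite lez_nat leq_addr.
Qed.

Lemma box_sub s t : (s <= t)%N -> {subset box r s <= box r t}.
Proof.
move=> st nu; rewrite !mem_box => /forallP h; apply/forallP => i.
by have /andP [-> le] := h i; apply: le_trans le _; rewrite lez_nat.
Qed.

Lemma deg_inM s t f b : deg_in (box r s) f -> deg_in (box r t) b ->
  deg_in (box r (s + t)) (f * b).
Proof.
move=> hf hb nu nst.
have [u _ fE] := proj_sum dB f; rewrite {1}fE mulr_suml (proj_sumr dB) big1 // => mu _.
have := projZl gB nu (b : B^o) (proj_in dB mu f); rewrite /GRing.scale /= => ->.
case: (boolP (mu \in box r s)) => mus; last by rewrite hf ?mul0r.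
rewrite hb ?mulr0 //; apply: contra nst => nut; move: mus nut.
rewrite !mem_box => /forallP h1 /forallP h2; apply/forallP => i.
have /andP [a1 a2] := h1 i; have := h2 i; rewrite !mxE => /andP [b1 b2].
rewrite -(subrKC (mu 0 i) (nu 0 i)) addr_ge0 //= PoszD.
exact: lerD.
Qed.

Lemma prime_chain_len p n : is_ideal p -> prime_chain p n ->
  exists e, forall s, @len_ge A B B^o p (plus_deg_in p (box r (e * s))) 'C(s + n, n).
Proof.
have base q s : prime_ideal q -> @len_ge A B B^o q (plus_deg_in q (box r s)) 1.
  move=> pq; have iq := prime_is_ideal pq.
  apply: len_ge1; [exact: ideal_Asub|exact: plus_deg_in_Asub|].
  split; first exact: plus_deg_in_sub.
  move=> /(_ 1) h; apply: (prime_not1 pq); apply: h; exists 1; last by rewrite subrr; apply: ideal0.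
  move=> nu nb; rewrite (proj_hom dB _ (BZ_1 B_standard)); case: eqP => // e.
  by case/negP: nb; rewrite e mem_box; apply/forallP => i; rewrite mxE lexx.
elim: n p => [|n IH] p ip [Z [Z0 Zp Zl]].
  exists 0%N => s; rewrite bin0; apply: base; rewrite -Z0; exact: Zp.
have pp : prime_ideal p by rewrite -Z0; apply: Zp.
pose q := Z 1%N; have pq : prime_ideal q by apply: Zp.
have iq := prime_is_ideal pq.
have [pq_sub npq] : p `<` q by rewrite -Z0; apply: Zl.
have [|e1 he1] := IH q iq.
  exists (fun i => Z i.+1); split=> // i hi; [exact: Zp|exact: Zl].
have [f qf npf] : exists2 f, q f & ~ p f.
  by apply: contrapT => nex; apply: npq => y qy; apply: contrapT => py; apply: nex; exists y.
have [e2 hf] := deg_in_box f.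
(* The constant e1 comes from the chain above q, and e2 bounds the degrees of f: multiplying by f
   moves the box of side e s into that of side e (s + 1). *)
exists (e1 + e2)%N; elim=> [|s IHs].
  by rewrite add0n binn muln0; apply: base.
pose e := (e1 + e2)%N; pose V t : set B := plus_deg_in p (box r (e * t)).
(* [U1] is p + f B_s, where B_s is the part of B in the box of side e s. Multiplication by f embeds
   the chain for s between p and [U1]; since [U1] lies in q, the chain for q and s + 1 pulls back to
   one between [U1] and [V s.+1]. The two lengths add up by Pascal's rule. *)
pose U1 : set B := [set x | exists2 b, deg_in (box r (e * s)) b & p (x - f * b)].
have ap := ideal_Asub ip.
have aU1 : @A_submodule A B B^o U1.
  split.
  - exists 0; first exact: (Asub0 (deg_in_Asub _)).
    by rewrite mulr0 subr0; apply: ideal0.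
  - move=> x y [b hb px] [c hc py]; exists (b + c).
      exact: (AsubD (deg_in_Asub _) hb hc).
    by rewrite mulrDr opprD addrACA; apply: idealD.
  - move=> a x [b hb px]; exists ((a%:A : B) *: (b : B^o)).
      exact: (AsubZ a (deg_in_Asub _) hb).
    rewrite /GRing.scale /= mulrCA -mulrBr; exact: idealM.
have h1 : @len_ge A B B^o p U1 'C(s + n.+1, n.+1).
  apply: (@len_ge_im A B B^o B^o (fun x : B^o => (f * x : B^o)) _ _ _ _ _ _ _ _ _ _ _ _ _ IHs).
  - by move=> x y; apply: mulrDr.
  - by move=> a x; rewrite /GRing.scale /= mulrCA.
  - exact: plus_deg_in_Asub.
  - exact: ideal_Asub.
  - exact: aU1.
  - move=> x px; exists 0; first exact: (Asub0 (deg_in_Asub _)).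
    by rewrite mulr0 subr0.
  - move=> v [b hb pv]; exists b => //; rewrite -mulrBr; exact: idealM.
  - by move=> v _ /(primeM pp) [].
have h2 : @len_ge A B B^o U1 (V s.+1) 'C(s.+1 + n, n).
  apply: (@len_ge_preim A B B^o B^o id _ _ _ _ _ _ _ _ _ _ _ (he1 s.+1)) => //.
  - exact: plus_deg_in_Asub.
  - move=> x [b hb px]; exists (f * b) => //.
    apply: deg_in_sub (deg_inM hf hb); apply: box_sub.
    by rewrite /e; lia.
  - move=> x [b hb px]; rewrite -(subrK (f * b) x); apply: idealD => //.
      exact: pq_sub.
    by apply: idealMr.
  - move=> x [b hb qx]; exists b => //; exists b; last by rewrite subrr; apply: ideal0.
    by apply: deg_in_sub hb; apply: box_sub; rewrite /e; lia.
have -> : 'C(s.+1 + n.+1, n.+1) = ('C(s + n.+1, n.+1) + 'C(s.+1 + n, n))%N.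
  by rewrite addSn binS addSnnS.
exact: len_ge_cat h1 h2.
Qed.
End ChainGrowth.

(** * Uniqueness *)

Section Functional.
Variable r : nat.
Local Notation T := 'rV[int]_r.

(** For exponent 1, evaluate at one point beyond all mu: 1/(1 - t) gives 1 there and a monomial
    gives 0. Precomposing with the difference operator lowers every positive exponent by one, which
    raises the exponent detected. *)
Lemma detect1_pos n (N : nat) (l : int) : exists s : seq (int * int),
  (forall x, x \in s -> l <= x.2) /\
  forall m (mu : int), (m <= n.+1)%N -> `|mu| <= N%:Z ->
    \sum_(x <- s) x.1 * geom_coef m (x.2 - mu) = (m == n.+1)%:R.
Proof.
elim: n N l => [|n IH] N l.
  exists [:: (1, Num.max l N.+1%:Z)]; split.
    by move=> x; rewrite inE => /eqP -> /=; rewrite le_max lexx.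
  move=> m mu m1 muN; rewrite big_seq1 mul1r.
  have K : 0 < Num.max l N.+1%:Z - mu.
    rewrite subr_gt0 lt_max; apply/orP; right.
    by apply: le_lt_trans (ler_norm mu) _; apply: le_lt_trans muN _; rewrite ltz_nat.
  case: m m1 => [|[|//]] _; first by rewrite geom_coef0 gt_eqF.
  by rewrite -(gez0_abs (ltW K)) geom_coefS bin0.
(* The difference operator moves points down by 1, hence l + 1; for m = 0 the exponent does not drop
   and mu + 1 appears beside mu, hence N + 1. *)
have [s [sl hs]] := IH N.+1 (l + 1).
exists (s ++ [seq (- x.1, x.2 - 1) | x <- s]); split.
  move=> x; rewrite mem_cat => /orP [/sl|/mapP [y /sl ly ->]].
    by apply: le_trans; rewrite lerDl.
  by rewrite /= lerBrDr.
move=> m mu mn muN; rewrite big_cat big_map /= -big_split /=.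
have muN1 : `|mu| <= N.+1%:Z by apply: le_trans muN _; rewrite lez_nat.
case: m mn => [|m] mn.
  rewrite (eq_bigr (fun x => x.1 * geom_coef 0 (x.2 - mu) - x.1 * geom_coef 0 (x.2 - (mu + 1)))).
    rewrite big_split /= sumrN !hs ?subrr //.
    by apply: le_trans (ler_normD _ _) _; rewrite normr1 -addn1 PoszD lerD2r.
  by move=> x _; rewrite mulNr; congr (_ - _ * geom_coef _ _); ring.
rewrite (eq_bigr (fun x => x.1 * geom_coef m (x.2 - mu))); first by rewrite hs // eqSS.
move=> x _; rewrite mulNr -mulrBr -(geom_coef_diff m); congr (_ * (_ - geom_coef _ _)).
ring.
Qed.

(** A monomial t^mu is nonzero only at mu, so for n = 0 the functional must sum over the whole range
    from -N to N. This is why the lower bound l is promised for n > 0 only. *)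
Lemma detect1 n (N : nat) (l : int) : exists s : seq (int * int),
  ((0 < n)%N -> forall x, x \in s -> l <= x.2) /\
  forall m (mu : int), (m <= n)%N -> `|mu| <= N%:Z ->
    \sum_(x <- s) x.1 * geom_coef m (x.2 - mu) = (m == n)%:R.
Proof.
case: n => [|n]; last first.
  by have [s [sl hs]] := detect1_pos n N l; exists s.
exists [seq (1, k%:Z - N%:Z) | k <- iota 0 (N + N).+1]; split=> // -[|//] mu _ muN.
rewrite big_map; set I := iota _ _.
have pos : 0 <= mu + N%:Z.
  by rewrite -lerBlDr sub0r; apply: lerNnormlW.
rewrite (bigD1_seq (absz (mu + N%:Z))) ?iota_uniq //=; last first.
  rewrite mem_iota leq0n add0n ltnS -lez_nat gez0_abs // PoszD lerD2r.
  exact: le_trans (ler_norm mu) muN.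
rewrite gez0_abs // addrK subrr geom_coef0 eqxx mul1r big1 ?addr0 // => k kne.
rewrite mul1r geom_coef0; case: eqP => // e; case/eqP: kne.
have -> : mu + N%:Z = k%:Z; last by rewrite absz_nat.
by move/eqP: e; rewrite subr_eq0 => /eqP <-; rewrite subrK.
Qed.

(* The functional f |-> sum_(x in w) x.1 * f x.2 tells the denominator (1 - t)^n
   apart from all others of total degree <= |n|. *)
Definition detects (n : 'X_{1..r}) (N : nat) (w : seq (int * T)) : Prop :=
  forall (m : 'X_{1..r}) (mu : T), (mdeg m <= mdeg n)%N ->
    (forall i, `|mu 0 i| <= N%:Z) ->
    \sum_(x <- w) x.1 * \prod_(i < r) geom_coef (m i) (x.2 0 i - mu 0 i) =
    (m == n)%:R.

Lemma mnm_neq_lt (m n : 'X_{1..r}) : (mdeg m <= mdeg n)%N -> m <> n ->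
  exists i, (m i < n i)%N.
Proof.
move=> le ne; apply: contrapT => nex; apply: ne.
have nm i : (n i <= m i)%N by rewrite leqNgt; apply/negP => h; apply: nex; exists i.
apply/mnmP => i; apply/eqP; rewrite eqn_leq nm andbT.
move: le; rewrite !mdegE (bigD1 i) //= [leqRHS](bigD1 i) //= => le.
rewrite -(leq_add2r (\sum_(j < r | j != i) m j)%N); apply: leq_trans le _.
by rewrite leq_add2l; apply: leq_sum.
Qed.

(** A tensor product of one-variable functionals. If m differs from n and |m| <= |n|, then m_i < n_i
    for some i, and the i-th factor vanishes whatever the others are. *)
Lemma detects_ex n N (l : int) : exists w, detects n N w /\
  ((forall i, (0 < n i)%N) -> forall x, x \in w -> forall i, l <= x.2 0 i).
Proof.
have /choice [s hs] (i : 'I_r) := detect1 (n i) N l.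
pose Z := (\sum_(i < r) size (s i))%N.
(* Entries of weight 0 give all r lists the common length Z, so that the product is indexed by
   functions into ['I_Z]; placing them at l preserves the lower bound. *)
pose s' i := s i ++ nseq (Z - size (s i)) (0, l).
have size_s' i : size (s' i) = Z.
  by rewrite size_cat size_nseq subnKC // /Z (bigD1 i) //= leq_addr.
have sum_s' i (F : int -> int) :
    \sum_(k < Z) (nth (0, l) (s' i) k).1 * F (nth (0, l) (s' i) k).2 =
    \sum_(x <- s i) x.1 * F x.2.
  rewrite -(size_s' i) -(big_mkord predT (fun k => (nth (0, l) (s' i) k).1 * F (nth (0, l) (s' i) k).2)).
  rewrite -(big_nth (0, l) predT (fun x => x.1 * F x.2)) big_cat /=.
  rewrite [X in _ + X]big1_seq ?addr0 // => x /andP [_]; rewrite mem_nseq => /andP [_ /eqP ->].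
  by rewrite mul0r.
pose c (f : {ffun 'I_r -> 'I_Z}) i : int * int := nth (0, l) (s' i) (f i).
exists [seq (\prod_(i < r) (c f i).1, \row_i (c f i).2) | f : {ffun 'I_r -> 'I_Z}].
split.
  move=> m mu mn muN; rewrite big_map big_enum /=.
  rewrite (eq_bigr (fun f : {ffun 'I_r -> 'I_Z} =>
    \prod_(i < r) ((c f i).1 * geom_coef (m i) ((c f i).2 - mu 0 i)))); last first.
    by move=> f _; rewrite big_split /=; congr (_ * _); apply: eq_bigr => i _; rewrite mxE.
  rewrite -(bigA_distr_bigA (fun i (k : 'I_Z) => (nth (0, l) (s' i) k).1 *
    geom_coef (m i) ((nth (0, l) (s' i) k).2 - mu 0 i))).
  under eq_bigr => i _ do rewrite (sum_s' i (fun z => geom_coef (m i) (z - mu 0 i))).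
  have [->|/eqP ne] := eqVneq m n.
    by rewrite big1 // => i _; case: (hs i) => _ ->; rewrite ?eqxx.
  have [i mi] := mnm_neq_lt mn ne; rewrite (bigD1 i) //=.
  case: (hs i) => _ ->; rewrite ?(ltnW mi) //.
  by rewrite (ltn_eqF mi) mul0r.
move=> npos x /mapP [f _ ->] i; rewrite mxE /c.
have : nth (0, l) (s' i) (f i) \in s' i by apply: mem_nth; rewrite size_s'.
rewrite mem_cat => /orP [h|]; first by case: (hs i) => /(_ (npos i)) + _; apply.
by rewrite mem_nseq => /andP [_ /eqP ->].
Qed.

Lemma detects_le n N N' w : (N <= N')%N -> detects n N' w -> detects n N w.
Proof.
move=> NN h m mu mn muN; apply: h => // i; apply: le_trans (muN i) _.
by rewrite lez_nat.
Qed.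

Lemma mu_bound (s : seq T) : exists N : nat, forall mu, mu \in s ->
  forall i, `|mu 0 i| <= N%:Z.
Proof.
elim: s => [|nu s [N IH]]; first by exists 0%N.
exists (N + \sum_(i < r) `|nu 0%R i|)%N => mu; rewrite inE => /orP [/eqP -> i|/IH h i].
  by rewrite -abszE lez_nat (bigD1 i) //= addnCA leq_addr.
by apply: le_trans (h i) _; rewrite lez_nat leq_addr.
Qed.

Lemma detects_tsum L n : (forall t, t \in L -> mdeg t.2 <= mdeg n)%N ->
  exists N, forall w, detects n N w ->
    \sum_(x <- w) x.1 * tsum L x.2 = tval L n.
Proof.
move=> dL; have [N hN] := mu_bound [seq t.1.2 | t <- L]; exists N => w dw.
rewrite (eq_bigr (fun x => \sum_(t <- L) x.1 * tcoef t x.2)); last first.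
  by move=> x _; rewrite /tsum mulr_sumr.
rewrite exchange_big /= /tval [RHS]big_mkcond big_seq [RHS]big_seq.
apply: eq_bigr => t tL.
rewrite (eq_bigr (fun x : int * T => t.1.1 * (x.1 * \prod_(i < r) geom_coef (t.2 i) (x.2 0 i - t.1.2 0 i)))).
  rewrite -mulr_sumr dw; last by move=> i; apply: hN; apply: map_f.
    by case: eqP => _; rewrite ?mulr1 ?mulr0.
  exact: dL.
by move=> x _; rewrite /tcoef mulrCA.
Qed.

End Functional.

(** * Lists of terms and families of Laurent polynomials *)

Section Laurent.
Variable r : nat.
Local Notation T := 'rV[int]_r.

Definition terms_of (d : nat) (Q : 'X_{1..r} -> laurent r) : seq (term r) :=
  flatten [seq [seq (Q n mu, mu, (n : 'X_{1..r})) | mu <- enum_fset (finsupp (Q n))]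
    | n : 'X_{1..r < d.+1} <- enum [pred n : 'X_{1..r < d.+1} | mdeg n == d]].

Lemma terms_of_deg d Q t : t \in terms_of d Q -> mdeg t.2 = d.
Proof.
move=> /flattenP [_ /mapP [n + ->] /mapP [mu _ ->]] /=.
by rewrite mem_enum => /eqP.
Qed.

Lemma tsum_terms_of d Q nu : tsum (terms_of d Q) nu = sum_frac_coef (Fin d) Q nu.
Proof.
rewrite /tsum /terms_of big_flatten big_map big_enum /=.
by apply: eq_bigr => n _; rewrite big_map.
Qed.

Lemma tval_terms_of d Q n : mdeg n = d ->
  tval (terms_of d Q) n = laurent_at1 (Q n).
Proof.
move=> dn; rewrite /tval /terms_of big_mkcond big_flatten big_map big_enum /=.
have nd : (mdeg n < d.+1)%N by rewrite dn.
rewrite (bigD1 (BMultinom nd)) /=; last by rewrite inE /= dn.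
rewrite big_map [X in _ + X]big1 ?addr0.
  by apply: eq_bigr => mu _; rewrite eqxx.
move=> m /andP [_ mn]; rewrite big_map big1 // => mu _ /=.
by case: eqP => // e; case/eqP: mn; apply: val_inj.
Qed.

Definition laurent_of (L : seq (term r)) (n : 'X_{1..r}) : laurent r :=
  [fsfun mu in [fset t.1.2 | t in L]%fset => \sum_(t <- L | (t.2 == n) && (t.1.2 == mu)) t.1.1].

Lemma laurent_ofE L n mu : laurent_of L n mu =
  \sum_(t <- L | (t.2 == n) && (t.1.2 == mu)) t.1.1.
Proof.
rewrite /laurent_of fsfunE; case: ifP => // /negbT nin.
rewrite big_seq_cond big1 // => t /and3P [tL _ /eqP e]; case/negP: nin.
by rewrite -e; apply/imfsetP; exists t.
Qed.

Lemma laurent_of_sum L n (F : T -> int) :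
  \sum_(mu <- finsupp (laurent_of L n)) laurent_of L n mu * F mu =
  \sum_(t <- L | t.2 == n) t.1.1 * F t.1.2.
Proof.
pose S := undup [seq t.1.2 | t <- L].
have -> : \sum_(mu <- finsupp (laurent_of L n)) laurent_of L n mu * F mu =
    \sum_(mu <- S) laurent_of L n mu * F mu.
  apply/esym/big_seq_extend; [exact: fset_uniq|exact: undup_uniq| |].
    move=> mu; rewrite mem_finsupp laurent_ofE => h; rewrite mem_undup.
    apply: contraR h => nin; rewrite big_seq_cond big1 // => t /and3P [tL _ /eqP e].
    by case/negP: nin; rewrite -e; apply: map_f.
  by move=> mu; rewrite memNfinsupp => /eqP ->; rewrite mul0r.
under eq_bigr => mu _ do rewrite laurent_ofE mulr_suml big_mkcond.
rewrite exchange_big /= [RHS]big_mkcond big_seq [RHS]big_seq; apply: eq_bigr => t tL.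
have tS : t.1.2 \in S by rewrite mem_undup; apply: map_f.
rewrite (bigD1_seq t.1.2) ?undup_uniq //= eqxx andbT big1 ?addr0 // => mu ne.
by rewrite [t.1.2 == mu]eq_sym (negPf ne) andbF.
Qed.

Lemma laurent_of_at1 L n : laurent_at1 (laurent_of L n) = tval L n.
Proof.
rewrite /laurent_at1 /tval -[RHS](eq_bigr _ (fun t _ => mulr1 t.1.1)).
rewrite -(laurent_of_sum L n (fun=> 1)).
by apply: eq_bigr => mu _; rewrite mulr1.
Qed.

Lemma laurent_of_frac L d nu : (forall t, t \in L -> mdeg t.2 = d) ->
  sum_frac_coef (Fin d) (laurent_of L) nu = tsum L nu.
Proof.
move=> dL; rewrite /sum_frac_coef /frac_coef.
under eq_bigr => n _ do rewrite (laurent_of_sum L n (fun mu =>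
  \prod_(i < r) geom_coef ((n : 'X_{1..r}) i) (nu 0 i - mu 0 i))) big_mkcond.
rewrite exchange_big /= /tsum big_seq [RHS]big_seq; apply: eq_bigr => t tL.
have td : (mdeg t.2 < d.+1)%N by rewrite dL.
rewrite (bigD1 (BMultinom td)) /= ?dL // eqxx [X in _ + X]big1 ?addr0 // => n /andP [_ ne].
by case: eqP => // e; case/eqP: ne; apply: val_inj.
Qed.

Lemma sum_frac_coef_at1_inj d (Q Q' : 'X_{1..r} -> laurent r) :
  (forall nu, sum_frac_coef (Fin d) Q nu = sum_frac_coef (Fin d) Q' nu) ->
  forall n, mdeg n = d -> laurent_at1 (Q n) = laurent_at1 (Q' n).
Proof.
move=> e n dn.
have [|N hN] := @detects_tsum r (terms_of d Q) n.
  by move=> t /terms_of_deg ->; rewrite dn.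
have [|N' hN'] := @detects_tsum r (terms_of d Q') n.
  by move=> t /terms_of_deg ->; rewrite dn.
have [w [dw _]] := detects_ex n (maxn N N') 0.
rewrite -!(tval_terms_of _ dn) -(hN w); first rewrite -(hN' w).
- by apply: eq_bigr => x _; rewrite !tsum_terms_of e.
- by apply: detects_le dw; apply: leq_maxr.
- by apply: detects_le dw; apply: leq_maxl.
Qed.
End Laurent.

(** * Dimension and Hilbert series of modules: parts (I) and (II) *)

Section ModuleHilbert.
Variables (r : nat) (A : comNzRingType) (B : comAlgType A).
Variable Bg : 'X_{1..r} -> set B.
Local Notation T := 'rV[int]_r.
Local Notation BZ := (BZ Bg).
Hypothesis B_graded : graded_algebra Bg.
Hypothesis B_standard : standard_graded Bg.
Hypothesis accB : acc (@is_ideal B).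
Hypothesis A_unit_nil : forall a : A,
  (exists b, b * a = 1) \/ (exists n, a ^+ n = 0).
Hypothesis r_gt0 : (0 < r)%N.

Lemma prime_chain_growth_le p n d : hideal Bg p -> prime_ideal p ->
  growth (hilb_fun Bg p) d -> prime_chain p n -> (n <= d)%N.
Proof.
move=> hp pp [C hC] cp; have ip := prime_is_ideal pp.
have [e he] := prime_chain_len B_graded B_standard ip cp.
apply: (@binomial_growth_leq C e) => s; apply: leq_trans (hC (e * s)%N).
apply: (plus_deg_in_len B_graded B_standard ip _ (box_uniq r (e * s)) (he s)).
exact: prime_hilb_finite.
Qed.

Lemma prime_chain_over_le p q n d : hideal Bg p -> prime_ideal p ->
  growth (hilb_fun Bg p) d -> p `<=` q -> prime_chain q n -> (n <= d)%N.
Proof.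
move=> hp pp gp pq cq; have [e|ne] := pselect (p = q).
  by apply: (prime_chain_growth_le hp pp gp); rewrite e.
apply: ltnW; apply: (prime_chain_growth_le hp pp gp).
by apply: prime_chain_cons cq => //; apply: proper_of_neq.
Qed.

Section Module.
Variables (M : lmodType B) (Mg : T -> set M).
Hypothesis gM : gmod Bg Mg.
Let dM : is_direct_sum Mg. Proof. by case: gM. Qed.
Let h0 := hsub_zero gM.

Section Filtered.
Variable L : seq (set B * T).
Hypothesis pL : pfilt Mg [set 0] setT L.

Lemma pfilt_hideal p a : List.In (p, a) L -> prime_ideal p /\ hideal Bg p.
Proof. by move=> /(pfilt_prime B_graded gM h0 pL) []. Qed.

Lemma has_len_gr nu : has_len [set 0] (Mg nu) (hilb_sum Bg L nu).
Proof.
have := pfilt_has_len B_graded B_standard gM nu h0 pL.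
rewrite setTI; have -> : [set 0] `&` Mg nu = [set 0].
  by apply/seteqP; split=> [x [->]//|x ->]; split=> //; apply: (gr0 dM).
apply=> p a /pfilt_hideal [pp hp]; exact: prime_hilb_finite.
Qed.

Lemma lengthA_gr nu : lengthA (Mg nu) = Fin (hilb_sum Bg L nu).
Proof. by apply: lengthA_Fin; apply: has_len_gr. Qed.

(** If q contains no prime of the list, [pfilt_annihilator] with N = B gives an s outside q that
    kills M. Conversely, an element whose annihilator lies in p, and so in q, survives
    localization. *)
Lemma SuppP q : @Supp B M q <->
  prime_ideal q /\ exists p a, List.In (p, a) L /\ p `<=` q.
Proof.
split=> [[pq [m hm]]|[pq [p [a [inL sub]]]]]; split=> //.
  apply: contrapT => nex.
  have [|s [c [qs hs]]] := pfilt_annihilator (N := setT) B_graded gM h0 pL pq.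
    by move=> p a inL; left=> sub; apply: nex; exists p, a.
  have : (s *: m) = 0.
    have := hs m I; elim: c {hs} (s *: m) => [x //|c IH x h].
    by apply: IH; have := h 1 I; rewrite scale1r.
  by have := hm s qs => /eqP.
have [pp hp [m [_ _ hm]]] := pfilt_prime B_graded gM h0 pL inL.
exists m => s qs; apply/eqP => sm; apply: qs; apply: sub; apply: hm; exact: sm.
Qed.

(** A chain in the support starts above some prime of the list, whose growth exponent bounds its
    length; a prime of largest order provides a chain of length d. *)
Lemma krull_dim_module : L <> [::] -> exists d,
  krull_dim M = Fin d /\ hdec (fun nu => (hilb_sum Bg L nu)%:Z) d.
Proof.
move=> L0; have hL p a : List.In (p, a) L -> exists d, hilb_prime Bg p d.
  by move=> /pfilt_hideal [pp hp]; apply: hilb_prime_ex.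
have [d [hd [p [a [inL [_ _ [Z [Z0 Zp Zl]]]]]] le]] := hilb_sum_dec r_gt0 L0 hL.
exists d; split=> //; apply: chain_sup_Fin.
  exists Z; split=> // i id; apply/SuppP; split; first exact: Zp.
  exists p, a; split=> //; rewrite -Z0.
  elim: i id => [_ x //|i IH id]; apply: subset_trans (IH (ltnW id)) _.
  by case: (Zl i id).
move=> k [W [Wi Wl]].
have /SuppP [pW0 [q [b [qb qW]]]] := Wi 0%N isT.
have [d' dd' [_ gq _]] := le q b qb; have [pq hq] := pfilt_hideal qb.
apply: leq_trans dd'; apply: (prime_chain_over_le hq pq gq qW).
by exists W; split=> // i /Wi [].
Qed.

Lemma module_nontrivialP : (exists m : M, m != 0) <-> L <> [::].
Proof.
split=> [[m m0] L0|L0].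
  move: pL; rewrite L0 => h; have : [set: M] = [set 0] by inversion h.
  by move=> e; case/eqP: m0; have : [set: M] m by []; rewrite e.
case: L L0 pL => // -[p a] L' _ pL'.
have [pp hp [m [_ _ hm]]] := pfilt_prime B_graded gM h0 pL' (or_introl erefl).
exists m; apply/eqP => m0; apply: (prime_not1 pp); apply: hm.
by rewrite m0 scaler0.
Qed.

Lemma krull_dim_trivial : ~ (exists m : M, m != 0) -> krull_dim M = NegInf.
Proof.
move=> nM; rewrite /krull_dim /chain_sup; case: asboolP => // ne; case: ne.
apply/seteqP; split=> // n [Z [Zi _]]; have [_ [m hm]] := Zi 0%N isT.
apply: nM; exists m; rewrite -(scale1r m); apply: hm.
by case: (Zi 0%N isT) => /prime_not1.
Qed.

End Filtered.

Hypothesis M_fg : finitely_generated M.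

Theorem hilb_decomposition_ex : exists Q : 'X_{1..r} -> laurent r,
  hilb_decomposition Mg Q /\
  ((exists m : M, m != 0) ->
   exists n : 'X_{1..r}, krull_dim M = Fin (mdeg n) /\ 0 < laurent_at1 (Q n)).
Proof.
have [L pL] := pfilt_module_ex B_graded accB (BZ_1 B_standard) gM M_fg.
have [L0|L0] := pselect (L = [::]).
  have nM : ~ (exists m : M, m != 0) by move=> /(module_nontrivialP pL).
  (* For M = 0 the dimension is [NegInf], where [sum_frac_coef] is 0 by definition, so the zero
     family fits. *)
  exists (fun=> [fsfun]); split=> //; split.
    move=> nu; exists 0%N; last by rewrite (krull_dim_trivial nM).
    by rewrite (lengthA_gr pL) L0 /hilb_sum big_nil.
  by move=> n; rewrite (krull_dim_trivial nM).
have [d [kd [Ls [dL hL vL] [n vn]]]] := krull_dim_module pL L0.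
exists (laurent_of Ls); split; first split.
- move=> nu; exists (hilb_sum Bg L nu); first exact: lengthA_gr.
  by rewrite kd laurent_of_frac.
- by move=> m _; rewrite laurent_of_at1.
- move=> _; exists n; rewrite kd laurent_of_at1; split=> //; congr Fin.
  have [t tL tn] : exists2 t, t \in Ls & t.2 == n.
    apply: contrapT => nex; move: vn; rewrite /tval big_seq_cond big1 ?ltxx // => t /andP [tL tn].
    by case: nex; exists t.
  by rewrite -(eqP tn) dL.
Qed.

Lemma hilb_identity_at1 (Q Q' : 'X_{1..r} -> laurent r) :
  hilb_identity Mg Q -> hilb_identity Mg Q' ->
  forall n : 'X_{1..r}, krull_dim M = Fin (mdeg n) ->
    laurent_at1 (Q n) = laurent_at1 (Q' n).
Proof.
move=> hQ hQ' n kn; apply: (@sum_frac_coef_at1_inj r (mdeg n)) => // nu.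
have [l el hl] := hQ nu; have [l' el' hl'] := hQ' nu.
by move: hl hl'; rewrite kn => <- <-; move: el'; rewrite el => -[->].
Qed.

Lemma hilb_mult_eq (Q : 'X_{1..r} -> laurent r) (n : T) :
  hilb_decomposition Mg Q -> krull_dim M = Fin (mdeg (succ_exp n)) ->
  hilb_mult Mg n = laurent_at1 (Q (succ_exp n)).
Proof.
move=> hQ kn; rewrite /hilb_mult; case: xgetP => [c _ [Q' hQ' ->]|h].
  by case: hQ' hQ => hQ' _ [hQ _]; apply: hilb_identity_at1.
by case: (h (laurent_at1 (Q (succ_exp n)))); exists Q.
Qed.

Lemma mdeg_succ_exp (n : T) (d : nat) : (forall i, -1 <= n 0 i) ->
  \sum_(i < r) n 0 i = d%:Z - r%:Z -> mdeg (succ_exp n) = d.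
Proof.
move=> n1 sn; apply/eqP; rewrite -eqz_nat mdegE; apply/eqP.
rewrite (big_morph Posz PoszD erefl) /=.
under eq_bigr => i _.
  rewrite mnmE gez0_abs; last by rewrite -lerBlDr sub0r.
  over.
by rewrite big_split /= sn sumr_const card_ord natz subrK.
Qed.

End Module.
End ModuleHilbert.

(** * The quotient by H^0 *)

Section Torsion.
Local Open Scope quotient_scope.
Variables (r : nat) (A : comNzRingType) (B : comAlgType A).
Variable Bg : 'X_{1..r} -> set B.
Local Notation T := 'rV[int]_r.
Local Notation BZ := (BZ Bg).
Local Notation N := (irrelevant_ideal Bg).
Hypothesis B_graded : graded_algebra Bg.

Lemma irrelevant_gr nu b : Bg nu b -> (forall i, (0 < nu i)%N) -> N b.
Proof.
move=> Bb pos; exists [:: nu], (fun=> b); rewrite big_seq1; split=> // i.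
by rewrite inE => /eqP ->.
Qed.

Lemma irrelevant_ind (Q : set B) : Q 0 -> (forall x y, Q x -> Q y -> Q (x + y)) ->
  (forall nu b, Bg nu b -> (forall i, (0 < nu i)%N) -> Q b) -> N `<=` Q.
Proof.
move=> Q0 QD Qh _ [s [f [fs ->]]]; rewrite big_seq_cond.
elim/big_ind: _ => // i /andP [/fs [Bi pos] _]; exact: Qh Bi pos.
Qed.

Lemma homogeneous_hideal J : is_ideal J -> homogeneous Bg J -> hideal Bg J.
Proof.
move=> iJ hJ; split; [exact: ideal0|by move=> x y; apply: idealD| |].
  by move=> b x; apply: idealM.
move=> nu x /hJ [s [f [fs ->]]].
rewrite (proj_sumr (BZ_direct B_graded)) big_seq_cond.
elim/big_ind: _ => [|y z|i /andP [/fs [Bi Ji] _]]; [exact: ideal0|exact: idealD|].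
rewrite (proj_hom (BZ_direct B_graded) _ (BZ_to Bi)); case: ifP => // _.
exact: ideal0.
Qed.

Lemma hideal_homogeneous J : hideal Bg J -> homogeneous Bg J.
Proof.
move=> hJ x Jx; have dB : is_direct_sum Bg by case: B_graded.
have [s _ xs] := proj_sum dB x; exists s, (fun i => proj Bg i x); split=> // i _.
by split; [apply: (proj_in dB)|rewrite -(proj_BZ B_graded); apply: (hsub_proj hJ)].
Qed.

Section Module.
Variables (M : lmodType B) (Mg : T -> set M).
Hypothesis gM : gmod Bg Mg.
Let dM : is_direct_sum Mg. Proof. by case: gM. Qed.

Lemma torsion_hsub U k : hsub Mg U -> hsub Mg (torsion N U k).
Proof.
move=> hU; elim: k => [//|k IH]; split => /=.
- by move=> y _; rewrite scaler0; apply: hsub0 IH.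
- by move=> x y hx hy z Nz; rewrite scalerDr; apply: (hsubD IH); [apply: hx|apply: hy].
- by move=> b x hx y Ny; rewrite scalerA mulrC -scalerA; apply: (hsubZ IH); apply: hx.
- move=> nu x hx; apply: irrelevant_ind => [|y z|n y By pos].
  + by rewrite scale0r; apply: hsub0 IH.
  + by move=> hy hz; rewrite scalerDl; apply: (hsubD IH).
  have := projZl gM (nu + to_Zr n) x (BZ_to By); rewrite addrK => <-.
  by apply: (hsub_proj IH); apply: hx; apply: irrelevant_gr By pos.
Qed.

Lemma torsion_mono (U : set M) k l : hsub Mg U -> (k <= l)%N -> torsion N U k `<=` torsion N U l.
Proof.
move=> hU; apply: chain_mono => {l}k x hx y _.
exact: (hsubZ (torsion_hsub k hU)).
Qed.

Lemma torsion_exp (U : set M) k y (x : M) : N y -> torsion N U k x -> U (y ^+ k *: x).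
Proof.
move=> Ny; elim: k x => [|k IH] x; first by rewrite expr0 scale1r.
by move=> /(_ y Ny) /IH; rewrite scalerA -exprSr.
Qed.

(** The annihilator of x is an ideal, so it contains the k-th power of N as soon as it contains all
    k-fold products; these are peeled off one factor at a time. *)
Lemma ideal_pow_torsion k (x : M) :
  (forall b, ideal_pow N k b -> b *: x = 0) <-> torsion N [set (0 : M)] k x.
Proof.
split=> [h|].
  have : forall y : 'I_k -> B, (forall j, N (y j)) -> (\prod_(j < k) y j) *: x = 0.
    by move=> y Ny; apply: h => J [_ sub]; apply: sub; exists y.
  elim: k x {h} => [|k IH] x h /=.
    have := h (fun=> 0); rewrite big_ord0 scale1r; apply=> -[[]] //.
  move=> z Nz; apply: IH => y Ny.
  pose f i := if unlift ord0 i is Some j then y j else z.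
  have Nf j : N (f j) by rewrite /f; case: unliftP => [i|] _.
  have := h f Nf; rewrite big_ord_recl {1}/f unlift_none.
  under eq_bigr => j _ do rewrite /f liftK.
  by rewrite mulrC -scalerA.
move=> tx b h; apply: (h [set b | b *: x = 0]); split.
  split; rewrite /= ?scale0r //.
    by move=> b1 b2 /= h1 h2; rewrite scalerDl h1 h2 addr0.
  by move=> a b1 /= h1; rewrite -scalerA h1 scaler0.
move=> _ [y Ny <-] /= {h}; elim: k x y tx Ny => [|k IH] x y tx Ny.
  by rewrite big_ord0 scale1r.
rewrite big_ord_recl mulrC -scalerA; apply: IH => //.
by apply: tx; apply: Ny.
Qed.

Lemma H0P (x : M) : H0_set Bg M x <-> exists k, torsion N [set (0 : M)] k x.
Proof. by split=> -[k /ideal_pow_torsion h]; exists k. Qed.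

Lemma H0_hsub : hsub Mg (H0_set Bg M).
Proof.
have h0 := hsub_zero gM; split.
- by apply/H0P; exists 0%N.
- move=> x y /H0P [k hk] /H0P [l hl]; apply/H0P; exists (maxn k l).
  apply: (hsubD (torsion_hsub _ h0)).
    by apply: torsion_mono hk => //; apply: leq_maxl.
  by apply: torsion_mono hl => //; apply: leq_maxr.
- by move=> b x /H0P [k hk]; apply/H0P; exists k; apply: (hsubZ (torsion_hsub _ h0)).
- by move=> nu x /H0P [k hk]; apply/H0P; exists k; apply: (hsub_proj (torsion_hsub _ h0)).
Qed.

Hypothesis accB : acc (@is_ideal B).

(* The exponents killing the multiples y m of a fixed m are bounded since the
   ideals (torsion k : m) stabilize. *)
Lemma H0_saturated c (m : M) : torsion N (H0_set Bg M) c m -> H0_set Bg M m.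
Proof.
have h0 := hsub_zero gM.
elim: c m => [//|c IH] m h.
have {IH}h y : N y -> H0_set Bg M (y *: m) by move=> Ny; apply: IH; apply: h.
have [k|k b|k0 hk0] := accB (I := fun k => colon (torsion N [set (0 : M)] k) m).
- have ht := torsion_hsub k h0; split; rewrite /colon /=.
  + by rewrite scale0r; apply: hsub0 ht.
  + by move=> x y hx hy; rewrite scalerDl; apply: (hsubD ht).
  + by move=> a x hx; rewrite -scalerA; apply: (hsubZ ht).
- by apply: torsion_mono.
apply/H0P; exists k0.+1 => y /h /H0P [k hk].
have : colon (torsion N [set (0 : M)] (maxn k k0)) m y.
  by apply: torsion_mono hk => //; apply: leq_maxl.
by rewrite hk0 ?leq_maxr.
Qed.

(** A nonzero torsion element x of degree nu is seen in some (B/p)(-a) as an element b outside p.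
    Since y^k b lies in p for all y in N, the prime p contains N; but b lies in N once nu exceeds a
    in every coordinate. *)
Lemma H0_gr_eventually0 L : pfilt Mg [set 0] setT L ->
  exists nu0 : T, forall nu : T, (forall i, nu0 0 i <= nu 0 i) ->
    forall x, Mg nu x -> H0_set Bg M x -> x = 0.
Proof.
have h0 := hsub_zero gM; move=> pL.
have [l hl] : exists l : T, forall p (a : T), List.In (p, a) L -> forall i, a 0 i <= l 0 i.
  elim: (L) => [|[p a] K [l IH]]; first by exists 0.
  exists (\row_i Num.max (l 0 i) (a 0 i)) => q b [[_ <-] i|/IH h i].
    by rewrite mxE le_max lexx orbT.
  by rewrite mxE le_max h.
exists (\row_i (l 0 i + 1)) => nu hnu x Mx /H0P [k hk].
apply: contrapT => x0.
have [p [a [b [inL Bb npb hb]]]] := pfilt_homog B_graded gM h0 pL Mx I x0.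
have [pp hp _] := pfilt_prime B_graded gM h0 pL inL; have ip := prime_is_ideal pp.
have [Np|nNp] := pselect (N `<=` p).
  apply: npb; apply: Np.
  have pos i : 0 < (nu - a) 0 i.
    rewrite !mxE subr_gt0; apply: le_lt_trans (hl _ _ inL i) _.
    by apply: lt_le_trans (hnu i); rewrite mxE ltrDl.
  case: Bb => [->|[n e Bn]]; first by exists [::], (fun=> 0); rewrite big_nil.
  by apply: irrelevant_gr Bn _ => i; have := pos i; rewrite e mxE.
apply: nNp => y Ny; have := hb (y ^+ k) (torsion_exp Ny hk).
by move=> /(primeM pp) [/(primeX pp)|].
Qed.

Local Notation M' := (mod_H0 Bg M).
Local Notation pi := (\pi_(quot_module (H0 Bg M)) : M -> M').

Lemma piD x y : pi (x + y) = pi x + pi y.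
Proof. exact: pi_quotD. Qed.

Lemma piZ (b : B) x : pi (b *: x) = b *: pi x.
Proof. by rewrite -[RHS]/(quot_scale b (pi x)) pi_quotZ. Qed.

Lemma pi_surj (y : M') : exists x, y = pi x.
Proof. by elim/quotW: y => x; exists x. Qed.

Lemma pi_eq0 x : pi x = 0 <-> H0_set Bg M x.
Proof.
have -> : (0 : M') = pi 0 by rewrite -(scale0r (0 : M)) piZ scale0r.
rewrite -[pi x]/(\pi_(quot_module (H0 Bg M)) x) pi_quotE subr0.
by split=> [/set_mem|/mem_set].
Qed.

Lemma pi0 : pi 0 = 0.
Proof. by apply/pi_eq0; apply: (hsub0 H0_hsub). Qed.

Lemma piB x y : pi (x - y) = pi x - pi y.
Proof. by rewrite -scaleN1r piD piZ scaleN1r. Qed.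

Lemma pi_sum (J : eqType) (s : seq J) (f : J -> M) :
  pi (\sum_(i <- s) f i) = \sum_(i <- s) pi (f i).
Proof. exact: (big_morph pi piD pi0). Qed.

(** The sum stays direct in the quotient because H^0 contains the homogeneous components of its
    elements. *)
Lemma mod_H0_gmod : gmod Bg (mod_H0_grading Bg Mg).
Proof.
split; last first.
  move=> mu nu b _ Bb [m Mm <-]; exists (b *: m); last by rewrite piZ.
  by case: gM => _; apply.
split.
- move=> nu; split; first by apply/mem_predP; exists 0; [apply: (gr0 dM)|apply: pi0].
  move=> _ _ /mem_predP [x Mx <-] /mem_predP [y My <-]; apply/mem_predP.
  by exists (x - y); [apply: (grB dM)|apply: piB].
- move=> y; have [x ->] := pi_surj y; have [s _ xs] := proj_sum dM x.
  exists s, (fun i => pi (proj Mg i x)); rewrite -pi_sum -xs; split=> // i _.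
  by exists (proj Mg i x) => //; apply: (proj_in dM).
- move=> s f us fs f0 i si.
  have /choice [g hg] j : exists m, j \in s -> Mg j m /\ f j = pi m.
    case: (boolP (j \in s)) => [/fs [m Mm <-]|_]; last by exists 0.
    by exists m.
  have : H0_set Bg M (\sum_(j <- s) g j).
    apply/pi_eq0; rewrite pi_sum -[RHS]f0 big_seq [RHS]big_seq.
    by apply: eq_bigr => j /hg [_ ->].
  move=> /(hsub_proj H0_hsub i); rewrite (proj_sumr dM) (bigD1_seq i) //= big_seq_cond big1.
    have [Mi fi] := hg i si; rewrite addr0 (proj_id dM Mi) fi.
    by move/pi_eq0.
  move=> j /andP [js ji]; have [Mj _] := hg j js.
  by rewrite (proj_hom dM _ Mj) eq_sym (negPf ji).
Qed.

Lemma mod_H0_fg : finitely_generated M -> finitely_generated M'.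
Proof.
move=> [k [g gen]]; exists k, (fun j => pi (g j)) => y.
have [x ->] := pi_surj y; have [c ->] := gen x; exists c.
by rewrite pi_sum; apply: eq_bigr => j _; rewrite piZ.
Qed.

Lemma mod_H0_torsionfree c (y : M') : torsion N [set (0 : M')] c y -> y = 0.
Proof.
have [x ->] := pi_surj y => h; apply/pi_eq0; apply: (@H0_saturated c).
elim: c x h => [|c IH] x h; first exact/pi_eq0.
by move=> z Nz; apply: IH; rewrite piZ; apply: h.
Qed.

Lemma mod_H0_Supp p : @Supp B M' p -> @Supp B M p.
Proof.
move=> [pp [y hy]]; split=> //; have [x e] := pi_surj y; exists x => s ps.
apply/eqP => sx; have := hy s ps; rewrite e -piZ sx pi0 eqxx //.
Qed.

(** If s outside p sent x into H^0, then y^k s would kill x for every y in N, forcing N into p. *)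
Lemma Supp_mod_H0 p : @Supp B M p -> ~ (N `<=` p) -> @Supp B M' p.
Proof.
move=> [pp [x hx]] nN; split=> //; exists (pi x) => s ps.
apply/eqP; rewrite -piZ => /pi_eq0/H0P [k hk].
apply: nN => y Ny; apply: contrapT => py.
have := torsion_exp Ny hk; rewrite /= scalerA => e.
have /eqP // : (y ^+ k * s) *: x != 0 by apply: hx => /(primeM pp) [/(primeX pp)|].
Qed.

Lemma mod_H0_has_len nu n : (forall x, Mg nu x -> H0_set Bg M x -> x = 0) ->
  A_submodule (Mg nu) ->
  has_len [set 0] (Mg nu) n -> has_len [set 0] (mod_H0_grading Bg Mg nu) n.
Proof.
move=> h aM; have aM' : A_submodule (mod_H0_grading Bg Mg nu).
  split; first by exists 0; [apply: Asub0 aM|apply: pi0].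
    by move=> _ _ [x Mx <-] [y My <-]; exists (x + y); [apply: AsubD|apply: piD].
  by move=> a _ [x Mx <-]; exists (a%:A *: x); [apply: AsubZ|apply: piZ].
have a0 (K : lmodType B) : @A_submodule A B K [set 0].
  by split=> // [x y -> ->|a x ->]; rewrite ?addr0 ?scaler0.
apply: (@has_len_iso A B M M' pi).
- exact: piD.
- by move=> a x; apply: piZ.
- exact: aM.
- exact: a0.
- exact: aM'.
- by move=> x ->; apply: Asub0 aM.
- by move=> x ->; apply: Asub0 aM'.
- by move=> x Mx; exists x.
- move=> x Mx; split; last by move=> ->; apply: pi0.
  by move=> /pi_eq0; apply: h.
- by move=> _ [x Mx <-]; exists x; rewrite ?subrr.
Qed.

End Module.
End Torsion.

(** * Relevant primes *)

Lemma prime_chain_cat (R : comNzRingType) (Z : nat -> set R) n m :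
  (forall i, (i <= n)%N -> prime_ideal (Z i)) ->
  (forall i, (i < n)%N -> Z i `<` Z i.+1) ->
  prime_chain (Z n) m -> prime_chain (Z 0%N) (n + m).
Proof.
elim: n Z => [//|n IH] Z Zp Zl cm; rewrite addSn.
apply: (@prime_chain_cons _ _ (Z 1%N)); [exact: Zp|exact: Zl|].
by apply: (IH (fun i => Z i.+1)) => // i hi; [apply: Zp|apply: Zl].
Qed.

Section Relevant.
Variables (r : nat) (A : comNzRingType) (B : comAlgType A).
Variable Bg : 'X_{1..r} -> set B.
Local Notation T := 'rV[int]_r.
Local Notation BZ := (BZ Bg).
Local Notation N := (irrelevant_ideal Bg).
Hypothesis B_graded : graded_algebra Bg.
Hypothesis B_standard : standard_graded Bg.
Hypothesis accB : acc (@is_ideal B).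
Hypothesis A_unit_nil : forall a : A,
  (exists b, b * a = 1) \/ (exists n, a ^+ n = 0).
Let dB := BZ_direct B_graded.
Let gB := BZ_gmod B_graded.

Definition relevant (p : set B) : Prop :=
  [/\ prime_ideal p, hideal Bg p & ~ (N `<=` p)].

Definition relevant_chain (p : set B) (n : nat) : Prop :=
  exists Z : nat -> set B, [/\ Z 0%N = p, forall i, (i <= n)%N -> relevant (Z i)
    & forall i, (i < n)%N -> Z i `<` Z i.+1].

Lemma MultiProj_relevant p : MultiProj Bg p <-> relevant p.
Proof.
split=> [[pp hp Np]|[pp hp Np]]; split=> //.
  by apply: homogeneous_hideal => //; apply: prime_is_ideal.
exact: hideal_homogeneous.
Qed.

Lemma relevant_basis p i : relevant p -> exists2 x, BZ (basis i) x & ~ p x.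
Proof.
move=> [pp hp nN]; apply: contrapT => nex; apply: nN.
have ip := prime_is_ideal pp.
apply: irrelevant_ind; [exact: ideal0|by move=> x y; apply: idealD|].
move=> nu b Bb pos.
have pU x : Bg U_(i)%MM x -> p x.
  by move=> Bx; apply: contrapT => px; apply: nex; exists x => //; apply: BZ_to.
have nui : 0 < (to_Zr nu : T) 0 i by rewrite mxE ltz_nat.
exact: (BZ_sub_of_generators B_graded B_standard ip pU nui (BZ_to Bb)).
Qed.

(* The primes p + (elements of positive degree in one of the first j
   directions) form a chain of length r above p. *)
Lemma relevant_prime_chain p : relevant p -> prime_chain p r.
Proof.
move=> rp; have [pp hp nN] := rp; have ip := prime_is_ideal pp.
pose Z j : set B := [set b | forall nu : T, (forall i : 'I_r, (i < j)%N -> nu 0 i = 0) ->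
  p (proj BZ nu b)].
have Zhom j : hideal Bg (Z j).
  split.
  - by move=> nu _; rewrite (proj0 dB); apply: ideal0.
  - by move=> x y hx hy nu h; rewrite (projD dB); apply: idealD => //; [apply: hx|apply: hy].
  - move=> b x hx nu h; have [s _ bs] := proj_sum dB b.
    rewrite /GRing.scale /= bs mulr_suml (proj_sumr dB); apply: ideal_sum => // mu _.
    have Bb := proj_in dB mu b.
    have := projZl gB nu (x : B^o) Bb; rewrite /GRing.scale /= => ->.
    case: (boolP (nonneg mu)) => [/nonnegP pos|neg]; last first.
      by rewrite (BZ_neg neg Bb) mul0r; apply: ideal0.
    have [e|/existsNP [i /not_implyP [ij mui]]] :=
        pselect (forall i : 'I_r, (i < j)%N -> mu 0 i = 0).
      by apply: idealM => //; apply: hx => i ij; rewrite !mxE h // e // subrr.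
    rewrite (@BZ_neg _ _ _ Bg (nu - mu) (proj BZ (nu - mu) x)).
    + by rewrite mulr0; apply: ideal0.
    + apply/negP => /nonnegP /(_ i); rewrite !mxE h // sub0r oppr_ge0 => le.
      by apply: mui; apply/eqP; rewrite eq_le le pos.
    + exact: (proj_in dB).
  - move=> mu x hx nu h; rewrite (proj_hom dB _ (proj_in dB mu x)).
    by case: eqP => [<-|_]; [apply: hx|apply: ideal0].
have Zh j nu b : BZ nu b -> (Z j b <-> ((forall i : 'I_r, (i < j)%N -> nu 0 i = 0) -> p b)).
  move=> Bb; split=> [h e|h mu e].
    by rewrite -(proj_id dB Bb); apply: h.
  rewrite (proj_hom dB _ Bb); case: eqP => [em|_]; last exact: ideal0.
  by apply: h; rewrite -em.
exists Z; split.
- apply/seteqP; split=> b; last first.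
    by move=> pb nu _; apply: (hsub_proj hp).
  by move=> h; apply: (hideal_sumE B_graded hp) => nu; apply: h.
- move=> j _; apply: (hideal_prime B_graded) => //.
    move=> /(Zh j 0 1 (BZ_1 B_standard)) h; apply: (prime_not1 pp); apply: h.
    by move=> i _; rewrite mxE.
  move=> mu nu a b Ba Bb Zab; apply: contrapT => /not_orP [nZa nZb].
  have [ea npa] : (forall i : 'I_r, (i < j)%N -> mu 0 i = 0) /\ ~ p a.
    split; first by apply: contrapT => ne; apply: nZa; apply/(Zh j _ _ Ba) => /ne.
    by move=> pa; apply: nZa; apply/(Zh j _ _ Ba).
  have [eb npb] : (forall i : 'I_r, (i < j)%N -> nu 0 i = 0) /\ ~ p b.
    split; first by apply: contrapT => ne; apply: nZb; apply/(Zh j _ _ Bb) => /ne.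
    by move=> pb; apply: nZb; apply/(Zh j _ _ Bb).
  have Bab : BZ (mu + nu) (a * b) by case: gB => _; apply.
  have pab : p (a * b) by apply: (proj1 (Zh j _ _ Bab) Zab) => i ij; rewrite mxE ea // eb // addr0.
  by case: (primeM pp pab).
- move=> j jr; split.
    move=> b h nu e; apply: h => i ij; apply: e; exact: ltnW.
  (* An element of degree [basis j] outside p belongs to [Z j.+1], where its degree is no longer
     tested, but not to [Z j]. *)
  have [x Bx npx] := relevant_basis (Ordinal jr) rp.
  move=> /(_ x) h; apply: npx; apply: (proj1 (Zh j _ _ Bx)).
    apply: h; apply/(Zh _ _ _ Bx) => /(_ (Ordinal jr) (leqnn _)).
    by rewrite basisE eqxx.
  by move=> i ij; rewrite basisE; case: eqP => // e; rewrite -e ltnn in ij.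
Qed.

(** A relevant prime misses some element of each degree e_i, so the recursion holds in every
    direction and not just in one; monotonicity and the paths below depend on this. *)
Lemma relevant_step p i : relevant p -> exists L,
  (forall q a, List.In (q, a) L ->
     [/\ prime_ideal q, hideal Bg q, p `<` q & nonneg a]) /\
  forall nu, hilb_fun Bg p nu = (hilb_fun Bg p (nu - basis i)%R + hilb_sum Bg L nu)%N.
Proof.
move=> rp; have [pp hp nN] := rp; have [x Bx px] := relevant_basis i rp.
have hadj : hideal Bg (@adj A B B^o p x) := hsub_adj B_graded gB hp Bx.
have [L [pL _ hL]] := prime_step B_graded B_standard accB hp pp Bx px.
have finL q a : List.In (q, a) L -> hilb_finite Bg q.
  by move=> /hL [pq hq _ _]; apply: prime_hilb_finite.
exists L; split=> // nu; have fp := prime_hilb_finite B_graded B_standard accB A_unit_nil hp pp.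
have h2 := pfilt_has_len B_graded B_standard gB nu hadj pL finL.
exact: hilb_funE (hilb_step B_graded B_standard hp pp Bx px (hilb_funP _ fp) h2).
Qed.

Definition size1 (x : T) : nat := \sum_(i < r) `|x 0%R i|.

Lemma size1_pred (nu mu : T) i : 0 < (nu - mu) 0 i ->
  (size1 (nu - basis i - mu) < size1 (nu - mu))%N.
Proof.
move=> posi; have ei j : (nu - basis i - mu) 0 j = (nu - mu) 0 j - (i == j)%:Z.
  by rewrite !mxE mnm1E addrAC.
rewrite /size1 (bigD1 i) //= [leqRHS](bigD1 i) //=.
rewrite (eq_bigr (fun j => absz ((nu - mu)%R 0%R j))); last first.
  by move=> j ji; rewrite ei eq_sym (negPf ji) subr0.
rewrite ltn_add2r ei eqxx -ltz_nat !gez0_abs ?(ltW posi) //.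
  by rewrite gtrBl.
by rewrite subr_ge0.
Qed.

Lemma nonneg_pred (nu mu : T) : nonneg (nu - mu) -> nu != mu ->
  exists i, [/\ 0 < (nu - mu) 0 i, nonneg (nu - basis i - mu)
    & (size1 (nu - basis i - mu) < size1 (nu - mu))%N].
Proof.
move=> /nonnegP pos ne; have [i nui] : exists i, (nu - mu) 0 i != 0.
  apply: contrapT => nex; case/eqP: ne; apply/rowP => i; apply/eqP.
  rewrite -subr_eq0; apply: contrapT => /negP h; apply: nex; exists i.
  by rewrite !mxE.
have posi : 0 < (nu - mu) 0 i by rewrite lt_neqAle eq_sym nui pos.
exists i; split=> //; last exact: size1_pred.
apply/nonnegP => j.
have -> : (nu - basis i - mu) 0 j = (nu - mu) 0 j - (i == j)%:Z.
  by rewrite !mxE mnm1E addrAC.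
by case: eqP => [<-|_]; [rewrite subr_ge0|rewrite subr0].
Qed.

Lemma hilb_fun_mono p (mu nu : T) : relevant p -> nonneg (nu - mu) ->
  (hilb_fun Bg p mu <= hilb_fun Bg p nu)%N.
Proof.
move=> rp; have [k] := ubnP (size1 (nu - mu)).
elim: k nu => // k IH nu hk pos.
have [->//|ne] := eqVneq nu mu.
have [i [_ pos' lt]] := nonneg_pred pos ne.
have [L [_ step]] := relevant_step i rp; rewrite (step nu).
apply: leq_trans (leq_addr _ _); apply: IH => //.
by apply: leq_trans lt _; rewrite -ltnS.
Qed.

Lemma hilb_fun_irrelevant q (nu : T) : is_ideal q -> N `<=` q ->
  (forall i, 0 < nu 0 i) -> hilb_fun Bg q nu = 0%N.
Proof.
move=> iq Nq pos; apply: hilb_funE.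
have -> : q `&` BZ nu = BZ nu.
  apply/seteqP; split=> [b []//|b Bb]; split=> //; apply: Nq.
  case: Bb => [->|[n e Bn]]; first by exists [::], (fun=> 0); rewrite big_nil.
  by apply: irrelevant_gr Bn _ => i; have := pos i; rewrite e mxE.
by apply: has_len_refl; apply: Asub_gr gB.
Qed.

Definition diag (s : nat) : T := \row_i s%:Z.

(** A prime containing N contributes 0 once nu exceeds its shift a in every coordinate, which
    [(size1 a).+1] guarantees and which determines b. A relevant prime contributes at most its value
    at the diagonal point s, by monotonicity. *)
Lemma hilb_sum_bound L (F : nat -> nat) : (forall q a, List.In (q, a) L ->
    [/\ prime_ideal q, hideal Bg q, nonneg a
      & ~ N `<=` q -> exists C, forall s, (hilb_fun Bg q (diag s) <= C * F s)%N]) ->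
  exists C b : nat, forall s (nu : T),
    (forall i, b%:Z <= nu 0 i) -> (forall i, nu 0 i <= s%:Z) ->
    (hilb_sum Bg L nu <= C * F s)%N.
Proof.
elim: L => [|[q a] L IH] hL.
  by exists 0%N, 0%N => s nu _ _; rewrite /hilb_sum big_nil.
have [|C [b hCb]] := IH; first by move=> q' a' h; apply: hL; right.
have [pq hq /nonnegP pa hN] := hL q a (or_introl erefl); have iq := prime_is_ideal pq.
have [Nq|nNq] := pselect (N `<=` q).
  exists C, (b + (size1 a).+1)%N => s nu bnu nus.
  rewrite /hilb_sum big_cons /= hilb_fun_irrelevant //.
    by apply: hCb => // i; apply: le_trans (bnu i); rewrite lez_nat leq_addr.
  move=> i; rewrite !mxE subr_gt0; apply: lt_le_trans (bnu i).
  rewrite -(gez0_abs (pa i)) ltz_nat addnS ltnS /size1 (bigD1 i) //=.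
  by rewrite addnCA leq_addr.
have [C' hC'] := hN nNq; exists (C' + C)%N, b => s nu bnu nus.
rewrite /hilb_sum big_cons /= mulnDl; apply: leq_add; last exact: hCb.
case: (boolP (nonneg (nu - a))) => [_|neg]; last by rewrite hilb_fun_neg0.
apply: leq_trans (hC' s); apply: hilb_fun_mono; first by split.
apply/nonnegP => i; rewrite !mxE opprB addrCA addr_ge0 // subr_ge0; exact: nus.
Qed.

(** Walk from the diagonal point b to nu by unit steps, staying in the range where each step adds at
    most K. *)
Lemma hilb_fun_path_bound p (K b s : nat) : relevant p ->
  (forall i, exists L, (forall nu, hilb_fun Bg p nu =
      (hilb_fun Bg p (nu - basis i)%R + hilb_sum Bg L nu)%N) /\
    forall nu : T, (forall j, b%:Z <= nu 0 j) -> (forall j, nu 0 j <= s%:Z) ->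
      (hilb_sum Bg L nu <= K)%N) ->
  forall nu : T, nonneg (nu - diag b) -> nonneg (diag s - nu) ->
  (hilb_fun Bg p nu <= hilb_fun Bg p (diag b) + size1 (nu - diag b) * K)%N.
Proof.
move=> rp hK nu; have [k] := ubnP (size1 (nu - diag b)).
elim: k nu => // k IH nu hk pos posU.
have [->|ne] := eqVneq nu (diag b); first exact: leq_addr.
have [i [posi pos' lt]] := nonneg_pred pos ne.
have [L [step hL]] := hK i; rewrite (step nu).
have le1 : (hilb_sum Bg L nu <= K)%N.
  apply: hL => j; have := elimT (nonnegP _) pos j; have := elimT (nonnegP _) posU j.
    by rewrite !mxE !subr_ge0.
  by rewrite !mxE !subr_ge0.
apply: (@leq_trans (hilb_fun Bg p (diag b) + (size1 (nu - basis i - diag b) * K) + K)).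
  apply: leq_add => //; apply: IH => //; first by apply: leq_trans lt _; rewrite -ltnS.
  rewrite opprB addrA; apply/nonnegP => j; rewrite !mxE addrAC addr_ge0 //.
  by have := elimT (nonnegP _) posU j; rewrite !mxE.
rewrite -addnA leq_add2l -mulSnr leq_mul2r lt orbT //.
Qed.

(** At most r s steps of size O(F s) lead to the diagonal point s. Keeping F abstract covers both
    the base case, with F = 0 since no relevant prime lies strictly above p, and the inductive step,
    with F s = (s + 1)^n. *)
Lemma relevant_diag_bound_step n (F : nat -> nat) p : relevant p ->
  (forall s, (s * F s <= s.+1 ^ n)%N) ->
  (forall q, relevant q -> p `<` q ->
     exists C, forall s, (hilb_fun Bg q (diag s) <= C * F s)%N) ->
  exists C, forall s, (hilb_fun Bg p (diag s) <= C * s.+1 ^ n)%N.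
Proof.
move=> rp hF hq.
have /choice [f hf] (i : 'I_r) : exists x : seq (set B * T) * (nat * nat),
    (forall nu, hilb_fun Bg p nu =
      (hilb_fun Bg p (nu - basis i)%R + hilb_sum Bg x.1 nu)%N) /\
    forall s (nu : T), (forall i, x.2.2%:Z <= nu 0 i) -> (forall i, nu 0 i <= s%:Z) ->
      (hilb_sum Bg x.1 nu <= x.2.1 * F s)%N.
  have [L [hL step]] := relevant_step i rp.
  have [|C [b hb]] := @hilb_sum_bound L F; last by exists (L, (C, b)).
  move=> q a /hL [pq hhq lt pa]; split=> // nNq; exact: hq.
pose C := (\sum_(i < r) (f i).2.1)%N; pose b := (\sum_(i < r) (f i).2.2)%N.
exists (hilb_fun Bg p (diag b) + r * C)%N => s.
have pow : (0 < s.+1 ^ n)%N by rewrite expn_gt0.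
case: (leqP b s) => bs; last first.
  apply: (@leq_trans (hilb_fun Bg p (diag b))).
    apply: hilb_fun_mono => //; apply/nonnegP => i.
    by rewrite !mxE subr_ge0 lez_nat ltnW.
  by rewrite mulnDl; apply: leq_trans (leq_addr _ _); apply: leq_pmulr.
have := @hilb_fun_path_bound p (C * F s) b s rp.
move=> /(_ _ (diag s)) le; apply: leq_trans (le _ _ _) _.
- move=> i; have [step hb] := hf i; exists (f i).1; split=> // nu hnu hs.
  apply: leq_trans (hb s nu _ hs) _.
    move=> j; apply: le_trans (hnu j); rewrite lez_nat /b (bigD1 i) //=.
    exact: leq_addr.
  by rewrite leq_mul2r /C (bigD1 i) //= leq_addr orbT.
- by apply/nonnegP => i; rewrite !mxE subr_ge0 lez_nat.
- by rewrite subrr; apply/nonnegP => i; rewrite mxE.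
rewrite mulnDl; apply: leq_add; first exact: leq_pmulr.
have sz : (size1 (diag s - diag b) <= r * s)%N.
  rewrite /size1 (eq_bigr (fun=> (s - b)%N)).
    by rewrite sum_nat_const card_ord leq_mul2l leq_subr orbT.
  by move=> i _; rewrite !mxE subzn // absz_nat.
apply: leq_trans (leq_mul sz (leqnn _)) _.
have -> : (r * s * (C * F s) = r * C * (s * F s))%N by ring.
by rewrite leq_mul2l hF orbT.
Qed.

Lemma relevant_diag_bound n p : relevant p -> ~ relevant_chain p n.+1 ->
  exists C, forall s, (hilb_fun Bg p (diag s) <= C * s.+1 ^ n)%N.
Proof.
elim: n p => [|n IH] p rp nch.
  apply: (@relevant_diag_bound_step 0 (fun=> 0%N)) => // [s|q rq pq].
    by rewrite muln0.
  case: nch; exists (fun i => if i is 0%N then p else q).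
  by split=> // [[|i] //|[]].
apply: (@relevant_diag_bound_step n.+1 (fun s => s.+1 ^ n)%N) => // [s|q rq pq].
  by rewrite expnS leq_mul2r leqnSn orbT.
apply: IH => // -[Z [Z0 Zr Zl]]; apply: nch.
exists (fun i => if i is i'.+1 then Z i' else p); split=> //.
  by case=> // i; apply: Zr.
by case=> [_|i]; [rewrite Z0|apply: Zl].
Qed.

Lemma relevant_growth n p : relevant p -> ~ relevant_chain p n.+1 ->
  growth (hilb_fun Bg p) (n + r).
Proof.
move=> rp nch; have [C hC] := relevant_diag_bound rp nch.
exists C => s; apply: (@leq_trans (\sum_(nu <- box r s) hilb_fun Bg p (diag s))).
  rewrite big_seq [leqRHS]big_seq; apply: leq_sum => nu; rewrite mem_box => /forallP h.
  apply: hilb_fun_mono => //; apply/nonnegP => i; rewrite !mxE subr_ge0.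
  by case/andP: (h i).
rewrite big_const_seq count_predT iter_addn_0 size_box.
by rewrite expnD mulnA leq_mul2r hC orbT.
Qed.

End Relevant.

(** * Dimension of Supp_++(M) and of M/H^0 *)

Section Dimension.
Variables (r : nat) (A : comNzRingType) (B : comAlgType A).
Variable Bg : 'X_{1..r} -> set B.
Local Notation T := 'rV[int]_r.
Local Notation BZ := (BZ Bg).
Local Notation N := (irrelevant_ideal Bg).
Hypothesis B_graded : graded_algebra Bg.
Hypothesis B_standard : standard_graded Bg.
Hypothesis accB : acc (@is_ideal B).
Hypothesis A_unit_nil : forall a : A,
  (exists b, b * a = 1) \/ (exists n, a ^+ n = 0).

Variables (M : lmodType B) (Mg : T -> set M).
Hypothesis gM : gmod Bg Mg.
Hypothesis M_fg : finitely_generated M.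
Let gB := BZ_gmod B_graded.

Lemma pfilt_ex : exists L, pfilt Mg [set 0] setT L.
Proof. exact: (pfilt_module_ex B_graded accB (BZ_1 B_standard) gM M_fg). Qed.

Lemma Supp_up p q : @Supp B M p -> p `<=` q -> prime_ideal q -> @Supp B M q.
Proof. by move=> [pp [m hm]] pq pq'; split=> //; exists m => s qs; apply: hm => /pq. Qed.

Lemma annihilator_avoids q : prime_ideal q -> ~ @Supp B M q ->
  exists s, ~ q s /\ forall m : M, s *: m = 0.
Proof.
move=> pq nS; have [L pL] := pfilt_ex; have h0 := hsub_zero gM.
have [|s [c [qs hs]]] := pfilt_annihilator (N := setT) B_graded gM h0 pL pq.
  move=> p a inL; left=> sub; apply: nS; apply/(SuppP B_graded gM pL).
  by split=> //; exists p, a.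
exists s; split=> // m.
have := hs m I; elim: c {hs} (s *: m) => [x //|c IH x h].
by apply: IH; have := h 1 I; rewrite scale1r.
Qed.

Definition vanishing (Z : set (set B)) : set B := [set b | forall p, Z p -> p b].

Definition irreducible_closed : set (set (set B)) :=
  [set Z | (exists2 C, MultiProj_closed Bg C & Z = Supp_pp Bg M `&` C) /\
           irreducible_set (MultiProj_closed Bg) Z].

Lemma hideal_principal mu a : BZ mu a -> hideal Bg [set x | exists c, x = c * a].
Proof.
move=> Ba; split.
- by exists 0; rewrite mul0r.
- by move=> _ _ [b ->] [c ->]; exists (b + c); rewrite mulrDl.
- by move=> b _ [c ->]; exists (b * c); rewrite -mulrA.
- move=> nu _ [c ->]; exists (proj BZ (nu - mu) c).
  by have := projZr B_graded gB nu c Ba; rewrite /GRing.scale /= => ->.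
Qed.

(** The vanishing ideal is the generic point of Z. It is prime because, for homogeneous a and b with
    a b in it, Z is covered by the closed sets where a, respectively b, vanishes. It is in the
    support, since otherwise M would be killed by an element outside it, hence outside some point of
    Z. *)
Lemma irreducible_vanishing Z : irreducible_closed Z ->
  [/\ relevant Bg (vanishing Z), @Supp B M (vanishing Z) &
      Z = Supp_pp Bg M `&` [set p | vanishing Z `<=` p]].
Proof.
move=> [[C [J [iJ hJ ->]] ZE] [[p0 Zp0] irr]].
have Zrel p : Z p -> relevant Bg p.
  by rewrite ZE => -[[_ /MultiProj_relevant]] h _; apply: h.
have ZS p : Z p -> @Supp B M p by rewrite ZE => -[[]].
have hv : hideal Bg (vanishing Z).
  split.
  - by move=> p /Zrel [_ hp _]; apply: hsub0 hp.
  - by move=> x y hx hy p Zp; have [_ hp _] := Zrel p Zp; apply: (hsubD hp); [apply: hx|apply: hy].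
  - by move=> b x hx p Zp; have [_ hp _] := Zrel p Zp; apply: (hsubZ hp); apply: hx.
  - by move=> nu x hx p Zp; have [_ hp _] := Zrel p Zp; apply: (hsub_proj hp); apply: hx.
have pv : prime_ideal (vanishing Z).
  apply: (hideal_prime B_graded hv).
    by move=> h; have [pp _ _] := Zrel p0 Zp0; apply: (prime_not1 pp); apply: h.
  move=> mu nu a b Ba Bb vab.
  pose V x : set (set B) := [set p | MultiProj Bg p /\ [set y | exists c, y = c * x] `<=` p].
  have clV mu' x : BZ mu' x -> MultiProj_closed Bg (V x).
    move=> Bx; exists [set y | exists c, y = c * x]; split=> //.
      exact: hideal_ideal (hideal_principal Bx).
    exact: (hideal_homogeneous B_graded (hideal_principal Bx)).
  have VE x p : relevant Bg p -> V x p <-> p x.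
    move=> rp; have [pp _ _] := rp; split=> [[_ h]|px].
      by apply: h; exists 1; rewrite mul1r.
    split; first exact/MultiProj_relevant.
    by move=> _ [c ->]; apply: idealM => //; apply: prime_is_ideal.
  have [|h|h] := irr _ _ (clV _ _ Ba) (clV _ _ Bb).
  - move=> p Zp; have rp := Zrel p Zp; have [pp _ _] := rp.
    by case: (primeM pp (vab p Zp)) => px; [left|right]; apply/VE.
  - by left=> p Zp; apply/VE; [apply: Zrel|apply: h].
  - by right=> p Zp; apply/VE; [apply: Zrel|apply: h].
have vsub p : Z p -> vanishing Z `<=` p by move=> Zp x; apply.
split.
- split=> // h; have [_ _ nN] := Zrel p0 Zp0; apply: nN.
  exact: subset_trans (vsub p0 Zp0).
- apply: contrapT => nS; have [s [vs sM]] := annihilator_avoids pv nS.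
  apply: vs => p Zp; apply: contrapT => ps.
  by have [_ [m hm]] := ZS p Zp; have := hm s ps; rewrite sM eqxx.
- apply/seteqP; split=> p.
    move=> Zp; split; last exact: vsub.
    by move: Zp; rewrite {1}ZE => -[].
  move=> [Sp vp]; rewrite ZE; split=> //; split; first by case: Sp.
  apply: subset_trans vp => x Jx q Zq.
  by move: Zq; rewrite ZE => -[_ [_]]; apply.
Qed.

Lemma dim_pp_relevant_chain D : dim_pp Bg M = Fin D ->
  (exists p, @Supp B M p /\ relevant_chain Bg p D) /\
  (forall p, @Supp B M p -> ~ relevant_chain Bg p D.+1).
Proof.
move=> /chain_sup_FinP [[Z [Zi Zl]] maxD]; split.
  exists (vanishing (Z D)); have [_ SD _] := irreducible_vanishing (Zi D (leqnn _)).
  (* Vanishing ideals reverse inclusions, hence the index D - i. Strictness persists because each Z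
     is recovered from its vanishing ideal. *)
  split=> //; exists (fun i => vanishing (Z (D - i)%N)); rewrite subn0; split=> //.
    by move=> i iD; case: (irreducible_vanishing (Zi (D - i)%N (leq_subr _ _))).
  move=> i iD; have iD' : (D - i.+1 < D)%N by lia.
  have e : (D - i = (D - i.+1).+1)%N by lia.
  have := Zl _ iD'; rewrite -e => -[ZZ nZZ].
  split; first by move=> x vx p /ZZ; apply: vx.
  move=> sub; apply: nZZ.
  have [_ _ ->] := irreducible_vanishing (Zi _ (leq_subr i D)).
  have [_ _ E2] := irreducible_vanishing (Zi _ (ltnW iD')).
  rewrite [X in _ `<=` X]E2 => p [Sp vp]; split=> //.
  exact: subset_trans vp.
move=> p Sp [W [W0 Wr Wl]].
have Wmono i j : (i <= j)%N -> (j <= D.+1)%N -> W i `<=` W j.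
  move=> ij jD; have [k ke] : exists k, (j = i + k)%N by exists (j - i)%N; lia.
  elim: k j ke jD {ij} => [|k IH] j -> jD; first by rewrite addn0.
  rewrite addnS; apply: subset_trans (IH _ erefl _) _; first by lia.
  by case: (Wl (i + k)%N) => //; lia.
have WS i : (i <= D.+1)%N -> @Supp B M (W i).
  move=> iD; apply: (Supp_up Sp); first by rewrite -W0; apply: Wmono.
  by case: (Wr i iD).
have WSp i : (i <= D.+1)%N -> Supp_pp Bg M (W i).
  by move=> iD; split; [apply: WS|apply/MultiProj_relevant => //; apply: Wr].
suff : chain_lengths irreducible_closed D.+1 by move/maxD; rewrite ltnn.
exists (fun i => Supp_pp Bg M `&` [set q | MultiProj Bg q /\ W (D.+1 - i)%N `<=` q]).
split=> i iD.
  have [pW hW _] := Wr _ (leq_subr i D.+1); split.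
    eexists; last by []. exists (W (D.+1 - i)%N); split=> //; first exact: prime_is_ideal.
    exact: hideal_homogeneous.
  split.
    exists (W (D.+1 - i)%N); split; first exact/WSp/leq_subr.
    by split=> //; case: (WSp _ (leq_subr i D.+1)).
  (* [W (D.+1 - i)] is a generic point of the i-th set: a closed set containing it contains the
     whole set, so irreducibility reduces to the location of one point. *)
  have key C : MultiProj_closed Bg C -> C (W (D.+1 - i)%N) ->
      Supp_pp Bg M `&` [set q | MultiProj Bg q /\ W (D.+1 - i)%N `<=` q] `<=` C.
    move=> [J [_ _ ->]] [_ JW] q [_ [mq Wq]]; split=> //.
    exact: subset_trans Wq.
  move=> C1 C2 c1 c2 sub; have : (C1 `|` C2) (W (D.+1 - i)%N).
    apply: sub; split; first exact/WSp/leq_subr.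
    by split=> //; case: (WSp _ (leq_subr i D.+1)).
  by case=> h; [left|right]; apply: key.
have iD' : (D.+1 - i.+1 < D.+1)%N by lia.
have e : (D.+1 - i = (D.+1 - i.+1).+1)%N by lia.
have [WW nWW] := Wl _ iD'; rewrite e; split.
  by move=> q [Sq [mq Wq]]; split=> //; split=> //; apply: subset_trans Wq.
move=> /(_ (W (D.+1 - i.+1)%N)) [|_ [_]]; last exact: nWW.
by split; [apply/WSp/ltnW|split=> //; case: (WSp _ (ltnW iD'))].
Qed.

(** If every prime of the filtration below q contained N, some s outside q would send y to a torsion
    element; this is 0 in M/H^0, contradicting the choice of y. *)
Lemma Supp_mod_H0_relevant q : @Supp B (mod_H0 Bg M) q ->
  exists2 p, relevant Bg p & @Supp B (mod_H0 Bg M) p /\ p `<=` q.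
Proof.
move=> [pq [y hy]].
have gM' := mod_H0_gmod gM; have h0 := hsub_zero gM'.
have [L pL] := pfilt_module_ex B_graded accB (BZ_1 B_standard) gM' (mod_H0_fg gM M_fg).
apply: contrapT => nex.
have [|s [c [qs hs]]] := pfilt_annihilator (N := N) B_graded gM' h0 pL pq.
  move=> p a inL; apply: contrapT => /not_orP [/contrapT pq' nN].
  have [pp hp _] := pfilt_prime B_graded gM' h0 pL inL.
  apply: nex; exists p; first by split.
  split=> //; apply/(SuppP B_graded gM' pL); split=> //.
  by exists p, a; split.
have := hy s qs; rewrite (mod_H0_torsionfree gM accB (hs y I)).
by rewrite eqxx.
Qed.

Lemma krull_dim_mod_H0 D : dim_pp Bg M = Fin D ->
  krull_dim (mod_H0 Bg M) = Fin (D + r).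
Proof.
move=> /dim_pp_relevant_chain [[p [Sp [Z [Z0 Zr Zl]]]] nch].
apply: chain_sup_Fin.
  have [pp _ nN] : relevant Bg p by rewrite -Z0; apply: Zr.
  have Sp' := Supp_mod_H0 Sp nN.
  have [W [W0 Wp Wl]] : prime_chain p (D + r).
    rewrite -Z0; apply: prime_chain_cat => //; first by move=> i /Zr [].
    exact: (relevant_prime_chain B_graded B_standard (Zr D (leqnn D))).
  exists W; split=> // i iD; have [_ [y hy]] := Sp'.
  split; first exact: Wp.
  exists y => s Ws; apply: hy => ps; apply: Ws.
  elim: i iD => [|i IH] iD; first by rewrite W0.
  by case: (Wl i iD) => + _; apply; apply: IH; apply: ltnW.
move=> k [W [Wi Wl]].
have [q rq [Sq qW]] := Supp_mod_H0_relevant (Wi 0%N isT).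
have [pq hq _] := rq.
have Sq' := mod_H0_Supp gM Sq.
have gq := relevant_growth B_graded B_standard accB A_unit_nil rq (nch q Sq').
apply: (prime_chain_over_le B_graded B_standard accB A_unit_nil hq pq gq qW).
by exists W; split=> // i /Wi [].
Qed.

End Dimension.

(** * Hilbert polynomials *)

Section BinomialBasis.
Variable r : nat.
Local Notation T := 'rV[int]_r.

(** As a coefficient of a power series this vanishes when some coordinate of nu is negative, so it
    is compared with the product of binomial polynomials on nonnegative nu only. *)
Definition binom_fun (n : 'X_{1..r}) (nu : T) : int :=
  \prod_(i < r) geom_coef (n i).+1 (nu 0 i).

Definition binom_mpoly (n : 'X_{1..r}) : {mpoly rat[r]} :=
  \prod_(i < r) binom_poly i (n i).

Definition msucc (n : 'X_{1..r}) : 'X_{1..r} := [multinom (n i).+1 | i < r].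

Lemma mdeg_msucc n : mdeg (msucc n) = (mdeg n + r)%N.
Proof.
rewrite !mdegE; under eq_bigr => i _ do rewrite mnmE -addn1.
by rewrite big_split /= sum_nat_const card_ord muln1.
Qed.

Lemma msucc_inj : injective msucc.
Proof. by move=> m n /mnmP e; apply/mnmP => i; have := e i; rewrite !mnmE => -[]. Qed.

Lemma succ_exp_to_Zr n : succ_exp (to_Zr n) = msucc n.
Proof. by apply/mnmP => i; rewrite !mnmE mxE -PoszD absz_nat addn1. Qed.

Lemma binom_poly_eval (i : 'I_r) k (v : 'I_r -> rat) (a : nat) : v i = a%:R ->
  (binom_poly i k).@[v] = 'C(a + k, k)%:R.
Proof.
move=> va; rewrite /binom_poly mevalZ rmorph_prod /=.
have -> : \prod_(j < k) ('X_i + j.+1%:R : {mpoly rat[r]}).@[v] = ((a + k) ^_ k)%:R.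
  under eq_bigr => j _ do rewrite mevalD mevalXU va rmorph_nat -natrD.
  rewrite -natr_prod; congr _%:R.
  elim: k => [|k IH]; first by rewrite big_ord0 ffactn0.
  by rewrite big_ord_recr /= IH addnS ffactnS mulnC.
by rewrite -bin_ffact natrM mulrCA mulVf ?mulr1 // pnatr_eq0 -lt0n fact_gt0.
Qed.

Lemma binom_mpoly_eval n (nu : T) : (forall i, 0 <= nu 0 i) ->
  (binom_mpoly n).@[fun i => (nu 0 i)%:~R] = (binom_fun n nu)%:~R.
Proof.
move=> pos; rewrite /binom_mpoly rmorph_prod /= /binom_fun rmorph_prod /=.
apply: eq_bigr => i _.
rewrite (@binom_poly_eval i (n i) _ `|nu 0%R i|%N); last by rewrite pmulrn gez0_abs.
by rewrite -{2}(gez0_abs (pos i)) geom_coefS.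
Qed.

Lemma sum_by_key (R : pzRingType) (V : lmodType R) (s : seq (R * 'X_{1..r}))
    (K : seq 'X_{1..r}) (F : 'X_{1..r} -> V) :
  uniq K -> {subset [seq x.2 | x <- s] <= K} ->
  \sum_(x <- s) x.1 *: F x.2 =
  \sum_(n <- K) (\sum_(x <- s | x.2 == n) x.1) *: F n.
Proof.
move=> uK sK; under [RHS]eq_bigr => n _ do rewrite scaler_suml big_mkcond.
rewrite exchange_big /= big_seq [RHS]big_seq; apply: eq_bigr => x xs.
have xK : x.2 \in K by apply: sK; apply: map_f.
rewrite (bigD1_seq x.2) //= eqxx big1 ?addr0 // => n ne.
by rewrite eq_sym (negPf ne).
Qed.

(** [binom_fun m] lists the coefficients of 1/(1 - t)^(m+1), so a functional detecting n + 1 reads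
    off the coefficient of [binom_fun n]. *)
Lemma detects_binom_coef (K : seq 'X_{1..r}) (c : 'X_{1..r} -> rat) n N w :
  uniq K -> (forall m, m \notin K -> c m = 0) ->
  (forall m, c m != 0 -> (mdeg m <= mdeg n)%N) ->
  detects (msucc n) N w ->
  \sum_(y <- w) y.1%:~R * (\sum_(m <- K) c m * (binom_fun m y.2)%:~R) = c n.
Proof.
move=> uK cK cn dw.
under eq_bigr => y _ do rewrite mulr_sumr.
rewrite exchange_big /=.
have key m : \sum_(y <- w) y.1%:~R * (c m * (binom_fun m y.2)%:~R) =
    c m * (m == n)%:R.
  have [->|/cn mn] := eqVneq (c m) 0.
    by rewrite mul0r big1 // => y _; rewrite mul0r mulr0.
  have := dw (msucc m) 0; rewrite !mdeg_msucc leq_add2r => /(_ mn).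
  move=> /(_ (fun i => ltac:(rewrite mxE normr0 lez_nat; exact: leq0n))).
  rewrite (inj_eq msucc_inj) => e.
  rewrite -[RHS]/(c m * ((m == n) : nat)%:R) -[((m == n) : nat)%:R](rmorph_nat intr) -[(_ == _)%:R]e.
  rewrite rmorph_sum mulr_sumr; apply: eq_bigr => y _.
  rewrite rmorphM mulrCA; congr (_ * (_ * _%:~R)); apply: eq_bigr => i _.
  by rewrite mnmE mxE subr0.
rewrite (eq_bigr _ (fun m _ => key m)).
case: (boolP (n \in K)) => nK.
  rewrite (bigD1_seq n) //= eqxx mulr1 big1 ?addr0 // => m /negPf ->.
  by rewrite mulr0.
rewrite cK // big_seq big1 // => m mK; case: eqP => [e|_]; last by rewrite mulr0.
by rewrite e (negPf nK) in mK.
Qed.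
End BinomialBasis.

Section HilbertPolynomial.
Variable r : nat.
Local Notation T := 'rV[int]_r.

Definition qspan (P : {mpoly rat[r]}) : Prop :=
  exists s : seq (rat * 'X_{1..r}), P = \sum_(x <- s) x.1 *: binom_mpoly x.2.

Lemma qspan0 : qspan 0. Proof. by exists [::]; rewrite big_nil. Qed.

Lemma qspanD P Q : qspan P -> qspan Q -> qspan (P + Q).
Proof. by move=> [s ->] [t ->]; exists (s ++ t); rewrite big_cat. Qed.

Lemma qspanZ a P : qspan P -> qspan (a *: P).
Proof.
move=> [s ->]; exists [seq (a * x.1, x.2) | x <- s].
by rewrite big_map scaler_sumr; apply: eq_bigr => x _; rewrite scalerA.
Qed.

Lemma binom_polyS (i : 'I_r) k :
  (k.+1%:R : rat) *: binom_poly i k.+1 = binom_poly i k * ('X_i + k.+1%:R).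
Proof.
rewrite /binom_poly big_ord_recr /= factS scalerA scalerAl natrM invfM mulrA.
by rewrite divff ?mul1r // pnatr_eq0.
Qed.

(* x binom(x + k, k) = (k + 1) (binom(x + k + 1, k + 1) - binom(x + k, k)). *)
Lemma qspanX i P : qspan P -> qspan (P * 'X_i).
Proof.
move=> [s ->]; rewrite mulr_suml; elim/big_ind: _ => [| |x _]; [exact: qspan0|exact: qspanD|].
rewrite -scalerAl; apply: qspanZ; set n := x.2.
have -> : binom_mpoly n * 'X_i = (n i).+1%:R *: (binom_mpoly (n + U_(i))%MM - binom_mpoly n).
  rewrite /binom_mpoly (bigD1 i) //= [in RHS](bigD1 i) //= mnmDE mnm1E eqxx addn1.
  rewrite [X in _ * X - _](eq_bigr (fun j => binom_poly j (n j))); last first.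
    by move=> j ji; rewrite mnmDE mnm1E eq_sym (negPf ji) addn0.
  rewrite -mulrBl scalerAl scalerBr binom_polyS.
  rewrite mulrDr mulr_natr scaler_nat addrK.
  by rewrite mulrAC.
apply: qspanZ; apply: qspanD; first by exists [:: (1, (n + U_(i))%MM)]; rewrite big_seq1 scale1r.
by exists [:: (-1, n)]; rewrite big_seq1 scaleN1r.
Qed.

Lemma qspan1 : qspan 1.
Proof.
exists [:: (1, 0%MM)]; rewrite big_seq1 scale1r /binom_mpoly big1 // => i _.
by rewrite /binom_poly mnm0E big_ord0 fact0 invr1 scale1r.
Qed.

Lemma qspan_all P : qspan P.
Proof.
rewrite (mpolyE P); elim/big_ind: _ => [| |m _]; [exact: qspan0|exact: qspanD|].
apply: qspanZ; rewrite mpolyXE_id.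
suff H Q : qspan Q -> qspan (Q * \prod_(i < r) 'X_i ^+ m i).
  by rewrite -[X in qspan X]mul1r; apply: H; apply: qspan1.
apply: (big_rec (fun x => forall Q, qspan Q -> qspan (Q * x))) => [{}Q|i x _ IH {}Q] hQ.
  by rewrite mulr1.
rewrite mulrA; apply: IH; elim: (m i) => [|k IH]; first by rewrite expr0 mulr1.
by rewrite exprSr mulrA; apply: qspanX.
Qed.

Definition keys (R : pzRingType) (s : seq (R * 'X_{1..r})) : seq 'X_{1..r} :=
  undup [seq x.2 | x <- s].

Definition key_coef (R : pzRingType) (s : seq (R * 'X_{1..r})) (n : 'X_{1..r}) : R :=
  \sum_(x <- s | x.2 == n) x.1.

Lemma sum_keys (R : pzRingType) (V : lmodType R) (s : seq (R * 'X_{1..r}))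
    (F : 'X_{1..r} -> V) :
  \sum_(x <- s) x.1 *: F x.2 = \sum_(n <- keys s) key_coef s n *: F n.
Proof. by apply: sum_by_key; [apply: undup_uniq|move=> n; rewrite mem_undup]. Qed.

Lemma key_coef_out (R : pzRingType) (s : seq (R * 'X_{1..r})) n :
  n \notin keys s -> key_coef s n = 0.
Proof.
rewrite mem_undup => nK; rewrite /key_coef big_seq_cond big1 // => x /andP [xs /eqP e].
by case/negP: nK; rewrite -e; apply: map_f.
Qed.

Lemma max_mdeg (K : seq 'X_{1..r}) (Q : 'X_{1..r} -> Prop) :
  (exists2 n, n \in K & Q n) ->
  exists2 n, n \in K /\ Q n & forall m, m \in K -> Q m -> (mdeg m <= mdeg n)%N.
Proof.
move=> [n nK Qn].
pose D d := `[< exists2 k, k \in K & mdeg k = d /\ Q k >].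
have exD : exists d, D d by exists (mdeg n); apply/asboolP; exists n.
have ubD d : D d -> (d <= \max_(k <- K) mdeg k)%N.
  by move=> /asboolP [k kK [<- _]]; apply: leq_bigmax_seq.
case: (ex_maxnP exD ubD) => d /asboolP [k kK [<- Qk]] dmax.
by exists k => // m mK Qm; apply: dmax; apply/asboolP; exists m.
Qed.

(** In the binomial expansion, a nonzero coefficient of largest degree would be returned by a
    functional supported where P vanishes. *)
Lemma mpoly_eq0_eventually (P : {mpoly rat[r]}) (l : int) :
  (forall nu : T, (forall i, l <= nu 0 i) -> P.@[fun i => (nu 0 i)%:~R] = 0) -> P = 0.
Proof.
have [s ->] := qspan_all P; rewrite sum_keys => h.
have [z|/existsNP [n0 nz]] := pselect (forall n, key_coef s n = 0).
  by rewrite big1 // => n _; rewrite z scale0r.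
have [|n [nK /eqP cn] nmax] := @max_mdeg (keys s) (fun n => key_coef s n != 0).
  exists n0; last exact/eqP.
  by apply: contraT => /key_coef_out /nz.
have [w [dw wl]] := detects_ex (msucc n) 0 (Num.max l 0).
case: cn; rewrite -(@detects_binom_coef r (keys s) _ n 0 w) //.
- rewrite big_seq big1 // => y yw.
  have yl i : Num.max l 0 <= y.2 0 i by apply: wl => // j; rewrite mnmE.
  have lm : l <= Num.max l 0 by rewrite le_max lexx.
  have := h y.2 (fun i => le_trans lm (yl i)).
  rewrite rmorph_sum /=; under eq_bigr => m _.
    rewrite mevalZ binom_mpoly_eval; last first.
      by move=> i; apply: le_trans (yl i); rewrite le_max lexx orbT.
    over.
  by move=> ->; rewrite mulr0.
- exact: undup_uniq.
- exact: key_coef_out.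
- by move=> m cm; apply: nmax => //; apply: contraT => /key_coef_out /eqP; rewrite (negPf cm).
Qed.

Definition zsum (s : seq (int * 'X_{1..r})) (nu : T) : int :=
  \sum_(x <- s) x.1 * binom_fun x.2 nu.

Definition evspan (h : T -> int) : Prop := exists s (l : int),
  forall nu : T, (forall i, l <= nu 0 i) -> h nu = zsum s nu.

(** The sum may be cut at any Z >= K, so that in [evspan_tcoef] all r coordinates can share one
    Z. *)
Definition span1 (f : int -> int) : Prop := exists (e : nat -> int) (K : nat) (l : int),
  forall Z j, (K <= Z)%N -> l <= j ->
    f j = \sum_(k < Z) e k * geom_coef k.+1 j.

Lemma span1_0 f (l : int) : (forall j, l <= j -> f j = 0) -> span1 f.
Proof.
move=> h; exists (fun=> 0), 0%N, l => Z j _ lj; rewrite h // big1 // => k _.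
by rewrite mul0r.
Qed.

Lemma span1_lin (a : int) f g : span1 f -> span1 g -> span1 (fun j => f j + a * g j).
Proof.
move=> [e [K [l h]]] [e' [K' [l' h']]].
exists (fun k => e k + a * e' k), (maxn K K'), (Num.max l l') => Z j.
rewrite geq_max ge_max => /andP [KZ K'Z] /andP [lj l'j].
rewrite (h Z j) // (h' Z j) // mulr_sumr -big_split /=; apply: eq_bigr => k _.
by rewrite mulrDl mulrA.
Qed.

Lemma span1_ext f g (l : int) : (forall j, l <= j -> f j = g j) -> span1 f -> span1 g.
Proof.
move=> fg [e [K [l' h]]]; exists e, K, (Num.max l l') => Z j KZ.
by rewrite ge_max => /andP [lj l'j]; rewrite -fg // (h Z j).
Qed.

(** By [geom_coef_diff], changing mu by one changes the function by one of exponent n - 1. For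
    increasing mu that function has the old shift; for decreasing mu it has the new one, whence the
    inner induction on n. Exponent 0 vanishes far out. *)
Lemma span1_geom n (mu : int) : span1 (fun j => geom_coef n (j - mu)).
Proof.
elim/int_ind: mu n => [|m IH|m IH] n.
- case: n => [|n].
    apply: (@span1_0 _ 1) => j j1; by rewrite subr0 geom_coef0 gt_eqF.
  exists (fun k => (k == n)%:R), n.+1, 0 => Z j nZ _; rewrite subr0.
  rewrite (bigD1 (Ordinal nZ)) //= eqxx mul1r big1 ?addr0 // => k kn.
  have -> : (k == n :> nat) = false by apply: contraNF kn => /eqP e; apply/eqP/val_inj.
  by rewrite mul0r.
- have e (j : int) : j - m.+1%:Z = j - m%:Z - 1 by rewrite -addn1 PoszD opprD addrA.
  case: n => [|n].
    apply: (@span1_0 _ (m%:Z + 2)) => j j1; rewrite geom_coef0 gt_eqF // subr_gt0.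
    by apply: lt_le_trans j1; rewrite -addn1 PoszD ltrD2l.
  apply: (@span1_ext _ _ 0 _ (span1_lin (-1) (IH n.+1) (IH n))) => j _.
  by rewrite e -(geom_coef_diff n) mulN1r opprB addrC subrK.
- have e (j : int) : j - - m.+1%:Z = j - - m%:Z + 1 by rewrite !opprK -addn1 PoszD addrA.
  elim: n => [|n IHn].
    apply: (@span1_0 _ 0) => j j0; rewrite geom_coef0 opprK gt_eqF // -addn1 PoszD addrA.
    by apply: ltr_wpDl => //; apply: addr_ge0.
  apply: (@span1_ext _ _ 0 _ (span1_lin 1 (IH n.+1) IHn)) => j _.
  by rewrite e mul1r -(geom_coef_diff n) addrK addrC subrK.
Qed.

Lemma evspan_0 : evspan (fun=> 0).
Proof. by exists [::], 0 => nu _; rewrite /zsum big_nil. Qed.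

Lemma evspan_add h h' : evspan h -> evspan h' -> evspan (fun nu => h nu + h' nu).
Proof.
move=> [s [l hs]] [s' [l' hs']]; exists (s ++ s'), (Num.max l l') => nu lnu.
rewrite /zsum big_cat /= hs ?hs' // => i; apply: le_trans (lnu i).
  by rewrite le_max lexx orbT.
by rewrite le_max lexx.
Qed.

Lemma evspan_tcoef (t : term r) : evspan (tcoef t).
Proof.
have /choice [e /choice [K /choice [l h]]] (i : 'I_r) := span1_geom (t.2 i) (t.1.2 0 i).
pose Z := (\sum_(i < r) K i)%N.
exists [seq (t.1.1 * \prod_(i < r) e i (f i), [multinom (f i : nat) | i < r])
       | f : {ffun 'I_r -> 'I_Z}], (\sum_(i < r) `|l i|) => nu lnu.
rewrite /zsum big_map big_enum /= /tcoef.
rewrite (eq_bigr (fun i => \sum_(k < Z) e i k * geom_coef k.+1 (nu 0 i))); last first.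
  move=> i _; apply: h; first by rewrite /Z (bigD1 i) //= leq_addr.
  apply: le_trans (lnu i); apply: le_trans (ler_norm _) _.
  by rewrite (bigD1 i) //= lerDl sumr_ge0.
rewrite (bigA_distr_bigA (fun i (k : 'I_Z) => e i k * geom_coef k.+1 (nu 0 i))) mulr_sumr /=.
apply: eq_bigr => f _; rewrite -mulrA; congr (_ * _).
rewrite big_split /=; congr (_ * _); apply: eq_bigr => i _.
by rewrite mnmE.
Qed.

Lemma evspan_tsum (L : seq (term r)) : evspan (tsum L).
Proof.
elim: L => [|t L IH].
  suff -> : tsum [::] = (fun=> 0) :> (T -> int) by apply: evspan_0.
  by apply/funext => nu; rewrite /tsum big_nil.
suff -> : tsum (t :: L) = (fun nu => tcoef t nu + tsum L nu) :> (T -> int).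
  by apply: evspan_add => //; apply: evspan_tcoef.
by apply/funext => nu; rewrite /tsum big_cons.
Qed.

Definition fsfun_of (s : seq (int * 'X_{1..r})) : {fsfun 'X_{1..r} -> int with 0} :=
  [fsfun n in [fset x.2 | x in s]%fset => key_coef s n].

Lemma fsfun_ofE s n : fsfun_of s n = key_coef s n.
Proof.
rewrite /fsfun_of fsfunE; case: ifP => // /negbT nin.
rewrite key_coef_out //; apply: contra nin; rewrite mem_undup => /mapP [x xs ->].
by apply/imfsetP; exists x.
Qed.

Lemma sum_fsfun_of (s : seq (int * 'X_{1..r})) (V : lmodType rat) (F : 'X_{1..r} -> V) :
  \sum_(n <- finsupp (fsfun_of s)) (fsfun_of s n)%:~R *: F n =
  \sum_(x <- s) x.1%:~R *: F x.2.
Proof.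
have := sum_keys [seq (x.1%:~R : rat, x.2) | x <- s] F; rewrite big_map /= => ->.
have ekeys : keys [seq (x.1%:~R : rat, x.2) | x <- s] = keys s.
  by rewrite /keys -map_comp.
have ecoef n : key_coef [seq (x.1%:~R : rat, x.2) | x <- s] n = (key_coef s n)%:~R.
  by rewrite /key_coef big_map rmorph_sum.
rewrite ekeys; apply/esym; under eq_bigr => n _ do rewrite ecoef -fsfun_ofE.
apply: big_seq_extend; [exact: fset_uniq|exact: undup_uniq| |].
  move=> n; rewrite mem_finsupp fsfun_ofE; apply: contraR => /key_coef_out ->.
  by [].
by move=> n; rewrite memNfinsupp => /eqP ->; rewrite scale0r.
Qed.

Lemma zsum_eval (s : seq (int * 'X_{1..r})) (nu : T) : (forall i, 0 <= nu 0 i) ->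
  (\sum_(x <- s) x.1%:~R *: binom_mpoly x.2).@[fun i => (nu 0 i)%:~R] = (zsum s nu)%:~R.
Proof.
move=> pos; rewrite rmorph_sum /zsum rmorph_sum /=; apply: eq_bigr => x _.
by rewrite mevalZ binom_mpoly_eval // rmorphM.
Qed.

Lemma eventual_coef_eq (e : {fsfun 'X_{1..r} -> int with 0}) (Ls : seq (term r))
    (D : nat) (l : int) :
  (forall t, t \in Ls -> mdeg t.2 = (D + r)%N) ->
  (forall nu : T, (forall i, l <= nu 0 i) ->
     (\sum_(n <- finsupp e) (e n)%:~R *: binom_mpoly n).@[fun i => (nu 0 i)%:~R] =
     (tsum Ls nu)%:~R :> rat) ->
  forall n, mdeg n = D -> e n = tval Ls (msucc n).
Proof.
move=> dLs he.
have detect n : (D <= mdeg n)%N -> (forall m, e m != 0 -> (mdeg m <= mdeg n)%N) ->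
    e n = tval Ls (msucc n).
  move=> Dn en; have [|N hN] := @detects_tsum r Ls (msucc n).
    by move=> t /dLs ->; rewrite mdeg_msucc leq_add2r.
  have [w [dw wl]] := detects_ex (msucc n) N (Num.max l 0).
  apply: (@intr_inj rat); rewrite -(hN w dw) rmorph_sum /=.
  rewrite -(@detects_binom_coef r (finsupp e) (fun m => (e m)%:~R) n N w) //.
  - rewrite big_seq [RHS]big_seq; apply: eq_bigr => y yw.
    have yl i : Num.max l 0 <= y.2 0 i by apply: wl => // j; rewrite mnmE.
    rewrite intrM; congr (_ * _); rewrite -he; last first.
      by move=> i; apply: le_trans (yl i); rewrite le_max lexx.
    rewrite rmorph_sum; apply: eq_bigr => m _ /=.
    rewrite mevalZ binom_mpoly_eval // => i.
    by apply: le_trans (yl i); rewrite le_max lexx orbT.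
  - exact: fset_uniq.
  - by move=> m; rewrite memNfinsupp => /eqP ->.
  - by move=> m; rewrite intr_eq0; apply: en.
(* A coefficient of largest degree above D would equal a value of [Ls] at a denominator of degree
   above D + r, where [Ls] has no terms. This bounds the degree of the polynomial without assuming
   it. *)
have le m : e m != 0 -> (mdeg m <= D)%N.
  move=> em; rewrite leqNgt; apply/negP => Dm.
  have [|k [kK Dk] kmax] := @max_mdeg (finsupp e) (fun k => (D < mdeg k)%N).
    by exists m; rewrite ?mem_finsupp.
  have : e k = tval Ls (msucc k).
    apply: detect; first exact: ltnW.
    move=> j ej; case: (leqP (mdeg j) D) => [jD|Dj]; first exact: leq_trans (ltnW Dk).
    by apply: kmax; rewrite ?mem_finsupp.
  rewrite /tval big_seq_cond big1 => [e0|t /andP [tL /eqP tk]].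
    by move: kK; rewrite mem_finsupp e0 eqxx.
  by move: (dLs t tL); rewrite tk mdeg_msucc => /addIn kD; rewrite kD ltnn in Dk.
move=> n nD; apply: detect; first by rewrite nD.
by move=> m; rewrite nD; apply: le.
Qed.
End HilbertPolynomial.

(** * The two mixed multiplicities: part (III) *)

Section Comparison.
Variables (r : nat) (A : comNzRingType) (B : comAlgType A).
Variable Bg : 'X_{1..r} -> set B.
Local Notation T := 'rV[int]_r.
Hypothesis B_graded : graded_algebra Bg.
Hypothesis B_standard : standard_graded Bg.
Hypothesis accB : acc (@is_ideal B).
Hypothesis A_unit_nil : forall a : A,
  (exists b, b * a = 1) \/ (exists n, a ^+ n = 0).
Hypothesis r_gt0 : (0 < r)%N.

Lemma hilb_terms_ex (M : lmodType B) (Mg : T -> set M) : gmod Bg Mg ->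
  finitely_generated M -> exists Ls : seq (term r), forall nu,
    exists2 l, lengthA (Mg nu) = Fin l & l%:Z = tsum Ls nu.
Proof.
move=> gM M_fg.
have [Q [[hQ _] _]] := hilb_decomposition_ex B_graded B_standard accB A_unit_nil r_gt0 gM M_fg.
case kd : (krull_dim M) => [|d|].
- exists [::] => nu; have [l ll le] := hQ nu; exists l => //.
  by rewrite le kd /tsum big_nil.
- exists (terms_of d Q) => nu; have [l ll le] := hQ nu; exists l => //.
  by rewrite le kd tsum_terms_of.
- exists [::] => nu; have [l ll le] := hQ nu; exists l => //.
  by rewrite le kd /tsum big_nil.
Qed.

Variables (M : lmodType B) (Mg : T -> set M).
Hypothesis gM : gmod Bg Mg.
Hypothesis M_fg : finitely_generated M.

(** [hilb_poly] is a chosen polynomial; uniqueness identifies it with one built from integer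
    coefficients, so that the choice in [binom_coefs] does not fall back to its default. *)
Lemma hilb_poly_binom : exists2 e : {fsfun 'X_{1..r} -> int with 0},
  hilb_poly Mg = \sum_(n <- finsupp e) (e n)%:~R *: binom_mpoly n
  & is_hilb_poly Mg (hilb_poly Mg).
Proof.
have [Ls hLs] := hilb_terms_ex gM M_fg.
have [s [l hs]] := evspan_tsum Ls.
pose P : {mpoly rat[r]} := \sum_(x <- s) x.1%:~R *: binom_mpoly x.2.
have max_l (nu : T) : (forall i, (\row_i Num.max l 0 : T) 0 i <= nu 0 i) ->
    (forall i, l <= nu 0 i) /\ (forall i, 0 <= nu 0 i).
  by move=> h; split=> i; have := h i; rewrite mxE ge_max => /andP [].
have hP : is_hilb_poly Mg P.
  exists (\row_i Num.max l 0) => nu /max_l [lnu pos].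
  have [k kl ke] := hLs nu; exists k => //.
  by rewrite zsum_eval // -hs // -ke.
have uniqP P' : is_hilb_poly Mg P' -> P' = P.
  move=> [nu0 hP']; apply/eqP; rewrite -subr_eq0; apply/eqP.
  have [N hN] := mu_bound [:: nu0].
  apply: (@mpoly_eq0_eventually r _ (Num.max N%:Z (Num.max l 0))) => nu hnu.
  have [|l1 e1 e2] := hP' nu.
    move=> i; apply: le_trans (hnu i); rewrite le_max; apply/orP; left.
    by apply: le_trans (ler_norm _) (hN nu0 _ i); rewrite mem_head.
  have [lnu pos] : (forall i, l <= nu 0 i) /\ (forall i, 0 <= nu 0 i).
    by split=> i; apply: le_trans (hnu i); rewrite !le_max lexx ?orbT.
  rewrite mevalB e2 zsum_eval // -hs //.
  by have [k kl <-] := hLs nu; move: kl; rewrite e1 => -[->]; rewrite subrr.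
have hpoly : is_hilb_poly Mg (hilb_poly Mg).
  by rewrite /hilb_poly; case: xgetP => [P' _ //|/(_ P)].
exists (fsfun_of s) => //; rewrite (uniqP _ hpoly).
exact: (esym (sum_fsfun_of s (@binom_mpoly r))).
Qed.

Lemma poly_mult_hilb_mult n : dim_pp Bg M = Fin (mdeg n) ->
  poly_mult Mg n = hilb_mult (mod_H0_grading Bg Mg) (to_Zr n).
Proof.
move=> dn; have gM' := mod_H0_gmod gM; have M'_fg := mod_H0_fg gM M_fg.
have kd := krull_dim_mod_H0 B_graded B_standard accB A_unit_nil gM M_fg dn.
have [Q [hQ _]] := hilb_decomposition_ex B_graded B_standard accB A_unit_nil r_gt0 gM' M'_fg.
have kd' : krull_dim (mod_H0 Bg M) = Fin (mdeg (succ_exp (to_Zr n))).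
  by rewrite succ_exp_to_Zr mdeg_msucc kd.
rewrite (hilb_mult_eq hQ kd') succ_exp_to_Zr.
have [e0 Pe0 [nu0 hP]] := hilb_poly_binom.
pose e := binom_coefs (hilb_poly Mg).
have Pe : hilb_poly Mg = \sum_(m <- finsupp e) (e m)%:~R *: binom_mpoly m.
  by rewrite /e /binom_coefs; case: xgetP => [e' _ //|/(_ e0)].
have [L pL] := pfilt_ex B_graded B_standard accB gM M_fg.
(* In large degrees H^0 vanishes, so M and M/H^0 have equal lengths there, and the Hilbert
   polynomial of M can be compared with the series of M/H^0. *)
have [nu1 hnu1] := H0_gr_eventually0 B_graded gM pL.
have [N hN] := mu_bound [:: nu0; nu1].
rewrite -(@tval_terms_of r (mdeg n + r)%N Q (msucc n)); last by rewrite mdeg_msucc.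
apply: (@eventual_coef_eq r e _ (mdeg n) N%:Z) => //.
  by move=> t /terms_of_deg.
move=> nu hnu; rewrite -Pe.
have big (mu : T) : mu \in [:: nu0; nu1] -> forall i, mu 0 i <= nu 0 i.
  move=> mui i; apply: le_trans (hnu i); apply: le_trans (ler_norm _) (hN mu mui i).
have [l ll ->] := hP nu (big nu0 (mem_head _ _)).
have hl := has_len_gr B_graded B_standard accB A_unit_nil gM pL nu.
have hl' := mod_H0_has_len gM (hnu1 nu (big nu1 (ltac:(by rewrite !inE eqxx orbT))))
  (Asub_gr B_standard nu gM) hl.
case: hQ => /(_ nu) [l' ll' le'] _.
rewrite tsum_terms_of -kd -le'; congr (_%:R).
move: ll ll'; rewrite (lengthA_Fin hl) (lengthA_Fin hl') => -[<-] [<-] //.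
Qed.
End Comparison.

Theorem mainTheorem1 (r : nat) (A : comNzRingType) (B : comAlgType A)
    (Bg : 'X_{1..r} -> set B) (M : lmodType B) (Mg : 'rV[int]_r -> set M)
    (r_gt0 : (0 < r)%N)
    (A_artinian : artinian_ring A) (A_local : local_ring A)
    (B_graded : graded_algebra Bg) (B_standard : standard_graded Bg)
    (M_graded : graded_module Bg Mg) (M_fg : finitely_generated M) :
  (* (I) *)
  ((exists Q : 'X_{1..r} -> laurent r,
      hilb_decomposition Mg Q /\
      ((exists m : M, m != 0) ->
       exists n : 'X_{1..r}, krull_dim M = Fin (mdeg n) /\
                             0 < laurent_at1 (Q n))) /\
   (forall Q Q' : 'X_{1..r} -> laurent r,
      hilb_identity Mg Q -> hilb_identity Mg Q' ->
      forall n : 'X_{1..r}, krull_dim M = Fin (mdeg n) ->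
        laurent_at1 (Q n) = laurent_at1 (Q' n))) /\
  (* (II) *)
  (forall Q : 'X_{1..r} -> laurent r, hilb_decomposition Mg Q ->
   forall d : nat, krull_dim M = Fin d ->
   forall n : 'rV[int]_r, (forall i, -1 <= n 0 i) ->
     \sum_(i < r) n 0 i = d%:Z - r%:Z ->
     hilb_mult Mg n = laurent_at1 (Q (succ_exp n))) /\
  (* (III) *)
  (forall n : 'X_{1..r}, dim_pp Bg M = Fin (mdeg n) ->
     poly_mult Mg n = hilb_mult (mod_H0_grading Bg Mg) (to_Zr n)).
Proof.
have un := artinian_local_unit_or_nilpotent A_artinian A_local.
have accB : acc (@is_ideal B).
  have [inj _ [k [x [_ gen]]]] := B_standard.
  exact: (fg_algebra_noetherian gen A_artinian A_local inj).
have gM := graded_module_gmod M_graded.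
split; first split.
- exact: (hilb_decomposition_ex B_graded B_standard accB un r_gt0 gM M_fg).
- exact: hilb_identity_at1.
split.
- move=> Q hQ d kd n n1 sn; apply: hilb_mult_eq => //.
  by rewrite kd (mdeg_succ_exp n1 sn).
- move=> n dn.
  exact: (poly_mult_hilb_mult B_graded B_standard accB un r_gt0 gM M_fg dn).
Qed.
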